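(* Let $g\ge 0$, let $\mathcal{H}:=H_1(\Sigma_{g,1};\mathbb{Z})$ be the symplectic representation of the mapping class group $\Gamma_{g,1}$, let $\phi\colon \mathfrak{Br}_{2g+1}\to\Gamma_{g,1}$ be the Birman-Hilden inclusion, and let $\phi^*\mathcal{H}$ be the pull-back representation of $\mathfrak{Br}_{2g+1}$. Then the homology $H_*(\mathfrak{Br}_{2g+1};\phi^*\mathcal{H})$ is $4$-torsion, i.e. for every $k$ and every $a\in H_k(\mathfrak{Br}_{2g+1};\phi^*\mathcal{H})$ one has $4a=0$.
   Context: $\Sigma_{g,1}$ is a smooth, oriented, compact, connected surface of genus $g$ with one parametrised boundary component. $\mathrm{Diff}_{g,1}$ is the topological group (Whitney $C^\infty$-topology) of diffeomorphisms of $\Sigma_{g,1}$ that restrict to the identity on some collar neighbourhood of $\partial\Sigma_{g,1}$, and $\Gamma_{g,1}=\pi_0(\mathrm{Diff}_{g,1})$ is the mapping class group. It acts on $H_1(\Sigma_{g,1};\mathbb{Z})$ by the maps induced by diffeomorphisms (the symplectic representation). $\mathfrak{Br}_n$ is Artin's braid group on $n$ strands, with generators $\sigma_1,\dots,\sigma_{n-1}$ and relations $\sigma_i\sigma_j=\sigma_j\sigma_i$ for $|i-j|\ge2$ and $\sigma_i\sigma_j\sigma_i=\sigma_j\sigma_i\sigma_j$ for $|i-j|=1$. Fix on $\Sigma_{g,1}$ a chain of $2g$ simple closed curves $c_1,\dots,c_{2g}$ such that $c_i\cap c_j=\emptyset$ for $|i-j|\ge2$, and $c_i,c_j$ intersect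 transversely in exactly one point for $|i-j|=1$ (a tubular neighbourhood of the union of these curves is diffeomorphic to $\Sigma_{g,1}$). Let $D_i\in\Gamma_{g,1}$ be the Dehn twist about $c_i$. The Birman-Hilden inclusion is the group homomorphism $\phi\colon\mathfrak{Br}_{2g+1}\to\Gamma_{g,1}$ with $\phi(\sigma_i)=D_i$ for $1\le i\le 2g$. *)

(* Defs.v *)
From HB Require Import structures.
From mathcomp Require Import all_boot all_order all_algebra.
From mathcomp Require Import generic_quotient ring_quotient finmap.
From mathcomp Require Import -(notations) monalg.
From mathcomp Require Import boolp classical_sets functions.
From mathcomp Require Import reals topology normedtype landau derive.

Set Implicit Arguments.
Unset Strict Implicit.
Unset Printing Implicit Defensive.

Import Order.TTheory GRing.Theory Num.Theory.
Import numFieldNormedType.Exports.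
Local Open Scope classical_set_scope.
Local Open Scope ring_scope.
Local Open Scope quotient_scope.

Section Smooth.
Context {R : realType}.

Definition iterated_derive (V W : normedModType R) (l : seq V) (f : V -> W) :
    V -> W := foldr (fun v h => 'D_v h) f l.

(* Requiring Frechet differentiability of every iterated directional
   derivative is the same as requiring all of them to exist and be continuous
   when V is finite-dimensional and U is open. *)
Definition smooth_on (V W : normedModType R) (U : set V) (f : V -> W) :=
  forall (l : seq V) x, U x -> differentiable (iterated_derive l f) x.

(* Smoothness of a map on an arbitrary subset A, in particular up to the
   boundary of a half-plane: near x the map extends smoothly to an open set. *)
Definition smooth_at (V W : normedModType R) (A : set V) (f : V -> W) (x : V) :=
  exists (U : set V) (g : V -> W),
    [/\ open U, U x, smooth_on U g & forall y, A y -> U y -> f y = g y].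

Lemma iterated_derive_eq (V W : normedModType R) (U : set V) (f g : V -> W) :
  open U -> (forall x, U x -> f x = g x) ->
  forall l x, U x -> iterated_derive l f x = iterated_derive l g x.
Proof.
move=> oU fg; elim=> [|v l IH] x Ux /=; first exact: fg.
apply: near_eq_derive.
have : nbhs x U by exact: open_nbhs_nbhs.
by apply: filterS => y; exact: IH.
Qed.

Lemma near_eq_differentiable (V W : normedModType R) (f g : V -> W) x :
  {near x, f =1 g} -> differentiable f x -> differentiable g x.
Proof.
move=> fg /diff_locallyP[dfc df].
have dg : g \o shift x = cst (g x) + 'd f x +o_ 0 id.
  move/eqaddoP: df => df; apply/eqaddoP => e e0.
  have fgx : f x = g x by exact: nbhs_singleton fg.
  have := df e e0; have : \forall h \near (0 : V), f (h + x) = g (h + x).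
    move: fg; rewrite (near_shift 0 x) /=.
    by apply: filterS => h; rewrite subr0.
  apply: filterS2 => h fgh /=.
  by rewrite -[(_ - _) h]/(f (h + x) - (f x + 'd f x h))
    -[X in _ -> `|X| <= _]/(g (h + x) - (g x + 'd f x h)) fgh fgx.
have E := diff_unique dfc dg.
by apply/diff_locallyP; rewrite E.
Qed.

Lemma smooth_on_eq (V W : normedModType R) (U : set V) (f g : V -> W) :
  open U -> (forall x, U x -> f x = g x) -> smooth_on U f -> smooth_on U g.
Proof.
move=> oU fg sf l x Ux; apply: near_eq_differentiable (sf l x Ux).
have : nbhs x U by exact: open_nbhs_nbhs.
by apply: filterS => y; exact: iterated_derive_eq.
Qed.

Lemma smooth_on_derive (V W : normedModType R) (U : set V) (f : V -> W) v :
  smooth_on U f -> smooth_on U ('D_v f).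
Proof.
move=> sf l x Ux; have := sf (rcons l v) x Ux.
by rewrite /iterated_derive -cats1 foldr_cat.
Qed.

Lemma smooth_on_ind (V W : normedModType R) (U : set V)
    (P : set (V -> W)) : open U ->
  (forall h, P h -> forall x, U x -> differentiable h x) ->
  (forall h v, P h -> exists2 h', P h' & forall x, U x -> 'D_v h x = h' x) ->
  forall h, P h -> smooth_on U h.
Proof.
move=> oU dP DP h Ph l; elim/last_ind: l h Ph => [|l v IH] h Ph x Ux.
  exact: dP.
have [h' Ph' hh'] := DP h v Ph.
rewrite /iterated_derive -cats1 foldr_cat -/(iterated_derive l _) /=.
apply: near_eq_differentiable (IH _ Ph' x Ux).
have : nbhs x U by exact: open_nbhs_nbhs.
by apply: filterS => y Uy; apply/esym/(@iterated_derive_eq _ _ U).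
Qed.

Lemma smooth_on_linear (V W Z : normedModType R) (U : set V)
    (F : {linear W -> Z}) (h : V -> W) :
  open U -> continuous F -> smooth_on U h -> smooth_on U (F \o h).
Proof.
move=> oU cF sh.
apply: (@smooth_on_ind _ _ U
  [set k | exists2 h : V -> W, smooth_on U h & k = F \o h]) => //;
  last by exists h.
- move=> _ [k sk ->] x Ux; apply: differentiable_comp; first exact: (sk [::]).
  exact: linear_differentiable.
- move=> _ v [k sk ->]; exists (F \o 'D_v k).
    by exists ('D_v k) => //; exact: smooth_on_derive.
  move=> x Ux; have dk : differentiable k x by exact: (sk [::]).
  have dF y : differentiable F y by exact: linear_differentiable.
  rewrite deriveE; last exact: differentiable_comp.
  by rewrite diff_comp //= diff_lin //= deriveE.
Qed.

Lemma smooth_on_pair (V W Z : normedModType R) (U : set V)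
    (h : V -> W) (k : V -> Z) :
  open U -> smooth_on U h -> smooth_on U k -> smooth_on U (fun x => (h x, k x)).
Proof.
move=> oU sh sk.
apply: (@smooth_on_ind _ _ U [set q | exists (h : V -> W) (k : V -> Z),
  [/\ smooth_on U h, smooth_on U k & q = fun x => (h x, k x)]]) => //.
- move=> _ [h1 [k1 [sh1 sk1 ->]]] x Ux.
  by apply: differentiable_pair; [exact: (sh1 [::])|exact: (sk1 [::])].
- move=> _ v [h1 [k1 [sh1 sk1 ->]]].
  exists (fun x => ('D_v h1 x, 'D_v k1 x)).
    by exists ('D_v h1), ('D_v k1); split => //; exact: smooth_on_derive.
  move=> x Ux; have dh : differentiable h1 x by exact: (sh1 [::]).
  have dk : differentiable k1 x by exact: (sk1 [::]).
  rewrite deriveE; last exact: differentiable_pair.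
  by rewrite diff_pair //= !deriveE.
- by exists h, k.
Qed.

Section Chain.
Variables (V : normedModType R) (U : set V) (U' : set (R * R)).
Variables (f : V -> R * R).
Hypotheses (oU : open U).
Hypotheses (sf : smooth_on U f) (fU : forall x, U x -> U' (f x)).

(* A class of functions containing g \o f and closed, up to equality on U, under
   directional derivatives. *)
Inductive chain_terms : (V -> R) -> Prop :=
| chain_base (g : R * R -> R) : smooth_on U' g -> chain_terms (g \o f)
| chain_add h h' : chain_terms h -> chain_terms h' -> chain_terms (h + h')
| chain_mul (a h : V -> R) :
    smooth_on U a -> chain_terms h -> chain_terms (a * h).

Lemma chain_terms_differentiable h :
  chain_terms h -> forall x, U x -> differentiable h x.
Proof.
elim=> [g sg|h1 h2 _ d1 _ d2|a h1 sa _ d1] x Ux.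
- apply: differentiable_comp; first exact: (sf [::]).
  by apply: (sg [::]); exact: fU.
- exact: differentiableD (d1 x Ux) (d2 x Ux).
- exact: differentiableM (sa [::] x Ux) (d1 x Ux).
Qed.

Lemma chain_terms_derive h v : chain_terms h ->
  exists2 h', chain_terms h' & forall x, U x -> 'D_v h x = h' x.
Proof.
elim=> [g sg|h1 h2 c1 [h1' c1' D1] c2 [h2' c2' D2]|
  a h1 sa c1 [h1' c1' D1]].
- have cfst : continuous (fst : R * R -> R) by move=> ?; exact: cvg_fst.
  have csnd : continuous (snd : R * R -> R) by move=> ?; exact: cvg_snd.
  have sD : smooth_on U ('D_v f) by exact: smooth_on_derive.
  exists ((fst \o 'D_v f) * ('D_(1, 0) g \o f) +
          (snd \o 'D_v f) * ('D_(0, 1) g \o f)).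
    apply: chain_add; apply: chain_mul.
    + exact: (smooth_on_linear oU cfst sD).
    + by apply: chain_base; exact: smooth_on_derive.
    + exact: (smooth_on_linear oU csnd sD).
    + by apply: chain_base; exact: smooth_on_derive.
  move=> x Ux; have df : differentiable f x by exact: (sf [::]).
  have dg : differentiable g (f x) by apply: (sg [::]); exact: fU.
  rewrite deriveE; last exact: differentiable_comp.
  rewrite diff_comp //= -deriveE //.
  rewrite -[RHS]/(('D_v f x).1 * 'D_(1, 0) g (f x) +
                  ('D_v f x).2 * 'D_(0, 1) g (f x)).
  rewrite !(deriveE _ dg) -(deriveE _ df); set w : R * R := 'D_v f x.
  have wE : w = w.1 *: (1, 0) + w.2 *: (0, 1).
    case: w => w1 w2; congr (_, _) => /=.
      by rewrite /GRing.scale /= mulr1 mulr0 addr0.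
    by rewrite /GRing.scale /= mulr1 mulr0 add0r.
  by rewrite {1}wE linearD !linearZ.
- exists (h1' + h2'); first exact: chain_add.
  move=> x Ux; rewrite deriveD ?D1 ?D2 //;
  apply: diff_derivable; exact: chain_terms_differentiable.
- exists (('D_v a : V -> R) * h1 + a * h1').
    apply: chain_add; apply: chain_mul => //; exact: smooth_on_derive.
  move=> x Ux; rewrite deriveM; last 2 first.
  + by apply: diff_derivable; exact: (sa [::]).
  + by apply: diff_derivable; exact: chain_terms_differentiable.
  by rewrite D1 // addrC mulrC.
Qed.

Lemma smooth_on_comp (g : R * R -> R) : smooth_on U' g -> smooth_on U (g \o f).
Proof.
move=> sg; apply: (@smooth_on_ind _ _ U chain_terms) => //.
- exact: chain_terms_differentiable.
- by move=> h v; exact: chain_terms_derive.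
- exact: chain_base.
Qed.
End Chain.

Lemma smooth_at_comp (V : normedModType R) (A : set V) (B : set (R * R))
    (f : V -> R * R) (g : R * R -> R * R) x :
  A x -> (forall y, A y -> B (f y)) ->
  smooth_at A f x -> smooth_at B g (f x) -> smooth_at A (g \o f) x.
Proof.
move=> Ax AB [U [f' [oU Ux sf ff']]] [U' [g' [oU' U'fx sg gg']]].
have oW : open (U `&` f' @^-1` U').
  rewrite openE => y [Uy U'y]; apply: filterI; first exact: open_nbhs_nbhs.
  apply: (differentiable_continuous (sf [::] y Uy)).
  exact: open_nbhs_nbhs.
exists (U `&` f' @^-1` U'), (g' \o f'); split => //.
- by split => //=; rewrite -ff'.
- have sf' : smooth_on (U `&` f' @^-1` U') f' by move=> l y [Uy _]; exact: sf.
  have cfst : continuous (fst : R * R -> R) by move=> ?; exact: cvg_fst.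
  have csnd : continuous (snd : R * R -> R) by move=> ?; exact: cvg_snd.
  have -> : g' \o f' = fun y => (((fst \o g') \o f') y, ((snd \o g') \o f') y).
    by apply/funext => y /=; case: (g' _).
  apply: smooth_on_pair => //; (apply: (@smooth_on_comp _ _ U') => //;
    first by move=> ? []).
  + exact: (smooth_on_linear oU' cfst sg).
  + exact: (smooth_on_linear oU' csnd sg).
- by move=> y Ay [Uy U'y] /=; rewrite gg' ?ff' //; rewrite -ff' //; exact: AB.
Qed.
End Smooth.

Lemma within_continuous_near (T U : topologicalType) (A : set T)
    (f : T -> U) x :
  {within A, continuous f} -> A x ->
  forall N, nbhs (f x) N -> within A (nbhs x) (f @^-1` N).
Proof. by move=> cf Ax N fN; rewrite nbhs_subspace_in //; exact: (cf x). Qed.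

Section Homology.
Variables (C : nat -> zmodType) (d : forall n, {additive C n.+1 -> C n}).

Definition is_cycle n : {pred C n} :=
  match n with 0 => predT | m.+1 => fun x => d m x == 0 end.

Lemma cycle_zmod n : zmod_closed (@is_cycle n).
Proof.
case: n => [|n]; first by split.
split=> [|x y]; rewrite !unfold_in ?raddf0 // => /eqP dx /eqP dy.
by rewrite raddfB dx dy subrr.
Qed.
HB.instance Definition _ n :=
  GRing.isZmodClosed.Build (C n) (@is_cycle n) (@cycle_zmod n).

Definition cycles n := {x : C n | x \in @is_cycle n}.
HB.instance Definition _ n := SubChoice.on (cycles n).
HB.instance Definition _ n := [SubChoice_isSubZmodule of cycles n by <:].

Definition is_boundary n : {pred cycles n} :=
  fun z => `[< exists w, d n w = val z >].

Lemma is_boundary_zmod n : zmod_closed (@is_boundary n).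
Proof.
split=> [|x y]; rewrite !unfold_in.
  by apply/asboolP; exists 0; rewrite raddf0.
move=> /asboolP[v dv] /asboolP[w dw]; apply/asboolP; exists (v - w).
by rewrite raddfB dv dw raddfB.
Qed.
HB.instance Definition _ n :=
  GRing.isZmodClosed.Build (cycles n) (@is_boundary n) (@is_boundary_zmod n).

(* The differentials are not required to square to zero here: the group is
   ker d / (ker d :&: im d), which is the usual homology for a complex. *)
Definition homology n := Quotient.quot (@is_boundary n).
HB.instance Definition _ n := GRing.Zmodule.on (homology n).
HB.instance Definition _ n := EqQuotient.on (homology n).
End Homology.

Section HomologyMap.
Variables (C D : nat -> zmodType).
Variables (d : forall n, {additive C n.+1 -> C n}).
Variables (e : forall n, {additive D n.+1 -> D n}).
Variables (f : forall n, {additive C n -> D n}).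
Hypothesis fd : forall n x, f n (d n x) = e n (f n.+1 x).

Lemma chain_map_cycle n (z : cycles d n) : f n (val z) \in is_cycle e (n := n).
Proof.
case: n z => [|n] [z /= zc] //; rewrite unfold_in -fd.
by move: zc; rewrite unfold_in => /eqP ->; rewrite raddf0.
Qed.

Definition cycle_map n (z : cycles d n) : cycles e n :=
  exist (fun x : D n => x \in @is_cycle D e n) _ (chain_map_cycle z).

Definition homology_map n (a : homology d n) : homology e n :=
  \pi_(homology e n) (cycle_map (repr a)).

Lemma homology_map_pi n (z : cycles d n) :
  homology_map (\pi_(homology d n) z) = \pi_(homology e n) (cycle_map z).
Proof.
apply/eqP; rewrite -Quotient.idealrBE.
have : repr (\pi_(homology d n) z) - z \in @is_boundary _ d n.
  by rewrite Quotient.idealrBE reprK.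
rewrite !unfold_in => /asboolP[w dw]; apply/asboolP; exists (f n.+1 w).
by rewrite -fd dw !raddfB.
Qed.

Lemma homology_map_additive n : zmod_morphism (@homology_map n).
Proof.
move=> x y; rewrite -[x]reprK -[y]reprK.
have piB (E : nat -> zmodType) (h : forall n, {additive E n.+1 -> E n})
    (u v : cycles h n) :
    \pi_(homology h n) u - \pi_(homology h n) v = \pi_(homology h n) (u - v).
  by rewrite [RHS]Quotient.pi_add Quotient.pi_opp.
rewrite piB !homology_map_pi piB; congr (\pi _).
by apply: val_inj; rewrite /= raddfB.
Qed.
HB.instance Definition _ n := GRing.isZmodMorphism.Build
  (homology d n) (homology e n) (@homology_map n) (@homology_map_additive n).
End HomologyMap.

(* Finitely supported functions from K to M, i.e. the direct sum of copies of M
   indexed by K. *)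
Definition chains (K : choiceType) (M : zmodType) := monalg.malg K M.
HB.instance Definition _ K M := GRing.Zmodule.on (chains K M).

Section ChainMaps.
Context {K L : choiceType} {M N : zmodType}.
Variables (h : K -> L) (u : K -> {additive M -> N}).

Definition chains_map (c : chains K M) : chains L N :=
  \sum_(k <- monalg.msupp c) monalg.mkmalgU (h k) (u k (monalg.mcoeff k c)).

Lemma chains_map_additive : zmod_morphism chains_map.
Proof.
pose F k x : chains L N := monalg.mkmalgU (h k) (u k x).
have FB k x y : F k (x - y) = F k x - F k y by rewrite /F !raddfB.
have wide (s : {fset K}) (c : chains K M) : (monalg.msupp c `<=` s)%fset ->
    chains_map c = \sum_(k <- s) F k (monalg.mcoeff k c).
  move=> cs; rewrite /chains_map (big_fset_incl _ cs) // => k _ kNc.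
  by rewrite monalg.mcoeff_outdom // !raddf0.
move=> c c'.
pose s := (monalg.msupp c `|` monalg.msupp c')%fset.
rewrite (wide s) ?monalg.msuppB_le // (wide s c) ?fsubsetUl //.
rewrite (wide s c') ?fsubsetUr // -sumrB; apply: eq_bigr => k _.
by rewrite -FB raddfB.
Qed.
HB.instance Definition _ := GRing.isZmodMorphism.Build _ _ chains_map
  chains_map_additive.
End ChainMaps.

Section AlternatingSum.
Variables (U V : zmodType) (n : nat) (f : 'I_n -> {additive U -> V}).
Definition alternating_sum (x : U) : V := \sum_(i < n) f i x *~ (-1) ^+ i.
Lemma alternating_sum_additive : zmod_morphism alternating_sum.
Proof.
move=> x y; rewrite -sumrB; apply: eq_bigr => i _.
by rewrite raddfB mulrzBl.
Qed.
HB.instance Definition _ := GRing.isZmodMorphism.Build _ _ alternating_sum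
  alternating_sum_additive.
End AlternatingSum.

Section GroupHomology.
Variables (G : groupType) (M : zmodType) (rho : G -> {additive M -> M}).

(* The inhomogeneous bar complex: the left G-module M is made a right module by
   m . g = g^-1 m, so that
     d (m [g_0|...|g_n]) = (g_0^-1 m) [g_1|...|g_n]
       + \sum_(0 < i <= n) (-1)^i m [g_0|...|g_(i-1) g_i|...|g_n]
       + (-1)^(n+1) m [g_0|...|g_(n-1)]. *)
Definition bar_face n (i : 'I_n.+2) (g : {ffun 'I_n.+1 -> G}) :
    {ffun 'I_n -> G} :=
  [ffun j : 'I_n =>
    if (j.+1 < i)%N then g (widen_ord (leqnSn n) j)
    else if j.+1 == i :> nat
    then (g (widen_ord (leqnSn n) j) * g (lift ord0 j))%g
    else g (lift ord0 j)].

Definition bar_coef n (i : 'I_n.+2) (g : {ffun 'I_n.+1 -> G}) :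
    {additive M -> M} :=
  if i == ord0 then rho ((g ord0)^-1)%g else idfun.

Definition bar_diff n :
    {additive chains {ffun 'I_n.+1 -> G} M -> chains {ffun 'I_n -> G} M} :=
  alternating_sum (fun i : 'I_n.+2 => chains_map (bar_face i) (bar_coef i)).

Definition group_homology := homology bar_diff.
End GroupHomology.

Section Braid.
Variable n : nat.

(* A letter (i, b) is the generator of index i if b, and its inverse if not. *)
Definition braid_word := seq ('I_n.-1 * bool).
Definition generator_word (i : 'I_n.-1) : braid_word := [:: (i, true)].

Inductive braid_relation : braid_word -> braid_word -> Prop :=
| braid_cancel i b : braid_relation [:: (i, b); (i, ~~ b)] [::]
| braid_commute (i j : 'I_n.-1) : (i.+1 < j)%N ->
    braid_relation (generator_word i ++ generator_word j)
      (generator_word j ++ generator_word i)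
| braid_yang_baxter (i j : 'I_n.-1) : i.+1 = j :> nat ->
    braid_relation (generator_word i ++ generator_word j ++ generator_word i)
      (generator_word j ++ generator_word i ++ generator_word j).

Inductive braid_equiv : braid_word -> braid_word -> Prop :=
| braid_step u v x y : braid_relation x y ->
    braid_equiv (u ++ x ++ v) (u ++ y ++ v)
| braid_refl w : braid_equiv w w
| braid_sym w w' : braid_equiv w w' -> braid_equiv w' w
| braid_trans w w' w'' :
    braid_equiv w w' -> braid_equiv w' w'' -> braid_equiv w w''.

Definition braid_eqb : rel braid_word := fun w w' => `[< braid_equiv w w' >].
Lemma braid_eqb_equiv : equiv_class_of braid_eqb.
Proof.
split=> [w|w w'|w' w w'']; first by apply/asboolP; exact: braid_refl.
  by apply/asboolP/asboolP; apply: braid_sym.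
by move=> /asboolP h /asboolP h'; apply/asboolP; apply: braid_trans h h'.
Qed.

Canonical braid_eqb_canonical := EquivRelPack braid_eqb_equiv.
Canonical braid_eqb_enc := defaultEncModRel braid_eqb.
Definition braid_group := {eq_quot braid_eqb}.
HB.instance Definition _ := Choice.on braid_group.
HB.instance Definition _ := EqQuotient.on braid_group.

Definition braid_class (w : braid_word) : braid_group := \pi_braid_group w.
Definition braid_one := braid_class [::].
Definition braid_mul (a b : braid_group) := braid_class (repr a ++ repr b).
Definition inv_word (w : braid_word) : braid_word :=
  rev [seq (x.1, ~~ x.2) | x <- w].
Definition braid_inv (a : braid_group) := braid_class (inv_word (repr a)).

Lemma braid_reprK (a : braid_group) : braid_class (repr a) = a.
Proof. exact: reprK. Qed.

Lemma braid_classP w w' : braid_class w = braid_class w' <-> braid_equiv w w'.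
Proof.
split=> [/eqP|h]; first by rewrite eqmodE => /asboolP.
by apply/eqP; rewrite eqmodE; apply/asboolP.
Qed.

Lemma braid_equiv_repr w : braid_equiv (repr (braid_class w)) w.
Proof. by apply/braid_classP; rewrite /braid_class reprK. Qed.

Lemma braid_equiv_ctx u v w w' :
  braid_equiv w w' -> braid_equiv (u ++ w ++ v) (u ++ w' ++ v).
Proof.
elim=> [u' v' x y xy|x|x y _|x y z _ + _].
- by rewrite -!catA !(catA u u'); exact: braid_step.
- exact: braid_refl.
- exact: braid_sym.
- exact: braid_trans.
Qed.

Lemma braid_equiv_cat u u' v v' :
  braid_equiv u u' -> braid_equiv v v' -> braid_equiv (u ++ v) (u' ++ v').
Proof.
move=> h h'; apply: (@braid_trans _ (u' ++ v)).
  exact: (@braid_equiv_ctx [::] v).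
by have := @braid_equiv_ctx u' [::] _ _ h'; rewrite !cats0.
Qed.

Lemma braid_classM w w' :
  braid_mul (braid_class w) (braid_class w') = braid_class (w ++ w').
Proof.
by apply/braid_classP; apply: braid_equiv_cat; exact: braid_equiv_repr.
Qed.

Lemma inv_wordVl w : braid_equiv (inv_word w ++ w) [::].
Proof.
elim: w => [|[i b] w IH]; first exact: braid_refl.
apply: braid_trans IH; rewrite /inv_word /= rev_cons cat_rcons.
have := @braid_step (inv_word w) w _ _ (braid_cancel i (~~ b)).
by rewrite negbK.
Qed.

Lemma inv_wordVr w : braid_equiv (w ++ inv_word w) [::].
Proof.
have {1}-> : w = inv_word (inv_word w).
  rewrite /inv_word map_rev revK -map_comp map_id_in // => -[i b] _ /=.
  by rewrite negbK.
exact: inv_wordVl.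
Qed.

Lemma braid_mulA : associative braid_mul.
Proof.
move=> a b c; rewrite -[a]braid_reprK -[b]braid_reprK -[c]braid_reprK.
by rewrite !braid_classM catA.
Qed.

Lemma braid_mul1 : left_id braid_one braid_mul.
Proof. by move=> a; rewrite -[a]braid_reprK braid_classM. Qed.

Lemma braid_mulr1 : right_id braid_one braid_mul.
Proof. by move=> a; rewrite -[a]braid_reprK braid_classM cats0. Qed.

Lemma braid_mulV : left_inverse braid_one braid_inv braid_mul.
Proof.
move=> a; rewrite -{2}[a]braid_reprK /braid_inv braid_classM.
by apply/braid_classP; exact: inv_wordVl.
Qed.

Lemma braid_mulVr : right_inverse braid_one braid_inv braid_mul.
Proof.
move=> a; rewrite -{1}[a]braid_reprK /braid_inv braid_classM.
by apply/braid_classP; exact: inv_wordVr.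
Qed.

HB.instance Definition _ := isGroup.Build braid_group
  braid_mulA braid_mul1 braid_mulr1 braid_mulV braid_mulVr.

Definition sigma (i : 'I_n.-1) : braid_group := braid_class (generator_word i).
End Braid.

Section ChainMapsTheory.
Context {K L : choiceType} {M N P : zmodType}.

Lemma chains_mapU (h : K -> L) (u : K -> {additive M -> N}) k x :
  chains_map h u (monalg.mkmalgU k x) = monalg.mkmalgU (h k) (u k x).
Proof.
rewrite /chains_map (big_fset_incl _ (@monalg.msuppU_le _ _ k x)) //.
  by rewrite big_seq_fset1 monalg.mcoeffUU.
by move=> l _ /monalg.mcoeff_outdom ->; rewrite !raddf0.
Qed.

Lemma chains_eq (F G : {additive chains K M -> P}) :
  (forall k x, F (monalg.mkmalgU k x) = G (monalg.mkmalgU k x)) -> F =1 G.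
Proof.
move=> FG c; rewrite (monalg.monalgE c) !raddf_sum.
by apply: eq_bigr => k _; exact: FG.
Qed.
End ChainMapsTheory.

Section SingularHomology.
Variable R : realType.

Definition simplex n : set 'rV[R]_n.+1 :=
  [set x | (forall j, 0 <= x ord0 j) /\ \sum_j x ord0 j = 1].
Arguments simplex n : clear implicits.

Definition insert0 n (i : 'I_n.+2) (x : 'rV[R]_n.+1) : 'rV[R]_n.+2 :=
  \row_j if unlift i j is Some k then x ord0 k else 0.

Lemma insert0_simplex n i x : simplex n x -> simplex n.+1 (insert0 i x).
Proof.
move=> [x0 x1]; split=> [j|].
  by rewrite mxE; case: unliftP => [k _|_].
rewrite (bigD1_ord i) //= mxE unlift_none add0r -[RHS]x1.
by apply: eq_bigr => k _; rewrite mxE liftK.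
Qed.

Lemma insert0_continuous n i : continuous (@insert0 n i).
Proof.
move=> x N [P xP PN]; exists (fun _ k => P ord0 (lift i k)).
  move=> a k; rewrite ord1.
  by have := xP ord0 (lift i k); rewrite mxE liftK.
move=> y yP; apply: PN => a j; rewrite ord1 mxE.
case: unliftP => [k ->|->]; first exact: yP.
by have := nbhs_singleton (xP ord0 i); rewrite mxE unlift_none.
Qed.

Definition face_inclusion n (i : 'I_n.+2) (x : simplex n) : simplex n.+1 :=
  exist _ (insert0 i (\val x)) (mem_set (insert0_simplex i (set_mem (valP x)))).

Lemma face_inclusion_continuous n i : continuous (@face_inclusion n i).
Proof.
apply: continuous_comp_initial => x.
apply: (@continuous_comp _ _ _ (fun y : simplex n => set_val y) (insert0 i)).
  exact: initial_continuous.
exact: insert0_continuous.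
Qed.
HB.instance Definition _ n i := isContinuous.Build _ _ (@face_inclusion n i)
  (@face_inclusion_continuous n i).

Definition singular_simplex (X : topologicalType) n :=
  continuousType (simplex n) X.

Definition singular_face (X : topologicalType) n (i : 'I_n.+2)
    (s : singular_simplex X n.+1) : singular_simplex X n :=
  s \o face_inclusion i.

Definition singular_chains (X : topologicalType) n : zmodType :=
  chains (singular_simplex X n) int.

Definition singular_diff (X : topologicalType) n :
    {additive singular_chains X n.+1 -> singular_chains X n} :=
  alternating_sum
    (fun i : 'I_n.+2 => chains_map (@singular_face X n i) (fun=> idfun)).

Definition singular_homology (X : topologicalType) n :=
  homology (@singular_diff X) n.

Section Pushforward.
Variables (X Y : topologicalType) (f : continuousType X Y).

Definition simplex_pushforward n (s : singular_simplex X n) :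
  singular_simplex Y n := f \o s.

Definition chain_pushforward n :
    {additive singular_chains X n -> singular_chains Y n} :=
  chains_map (@simplex_pushforward n) (fun=> idfun).

Lemma chain_pushforward_diff n (c : singular_chains X n.+1) :
  chain_pushforward n (singular_diff X n c) =
  singular_diff Y n (chain_pushforward n.+1 c).
Proof.
have comm i :
    chain_pushforward n \o chains_map (@singular_face X n i) (fun=> idfun) =1
    chains_map (@singular_face Y n i) (fun=> idfun) \o chain_pushforward n.+1.
  apply: chains_eq => s x /=; rewrite !chains_mapU /=.
  by congr monalg.mkmalgU; apply/continuousEP.
rewrite /singular_diff /= /alternating_sum raddf_sum; apply: eq_bigr => i _.
rewrite raddfMz; exact: (congr1 (fun u => u *~ _) (comm i c)).
Qed.

Definition homology_pushforward n :
    {additive singular_homology X n -> singular_homology Y n} :=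
  @homology_map _ _ _ _ chain_pushforward chain_pushforward_diff n.
End Pushforward.
End SingularHomology.

Section Surfaces.
Variable R : realType.

Definition half_plane : set (R * R) := [set p | 0 <= p.1].

Definition det2 (u v : R * R) : R := u.1 * v.2 - u.2 * v.1.

Definition jacobian_det (f : R * R -> R * R) (p : R * R) : R :=
  det2 ('D_(1, 0) f p) ('D_(0, 1) f p).

(* A smooth oriented surface with boundary, given by an oriented atlas with
   values in the half-plane; param i is the inverse of coord i.  Orientation is
   only imposed at interior points, where the derivatives of a chart transition
   are two-sided; it extends to the boundary by continuity. *)
Record oriented_surface := OrientedSurface {
  carrier :> topologicalType;
  chart : Type;
  dom : chart -> set carrier;
  coord : chart -> carrier -> R * R;
  param : chart -> R * R -> carrier;
  dom_cover : forall x, exists i, dom i x;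
  dom_open : forall i, open (dom i);
  image_open : forall i,
    exists2 U, open U & coord i @` dom i = half_plane `&` U;
  coordK : forall i x, dom i x -> param i (coord i x) = x;
  coord_continuous : forall i, {within dom i, continuous (coord i)};
  param_continuous : forall i, {within coord i @` dom i, continuous (param i)};
  transition_smooth : forall i j x, dom i x -> dom j x ->
    smooth_at (coord i @` (dom i `&` dom j)) (coord j \o param i) (coord i x);
  transition_oriented : forall i j x, dom i x -> dom j x -> 0 < (coord i x).1 ->
    0 < jacobian_det (coord j \o param i) (coord i x)
}.

Variable S : oriented_surface.

Definition boundary_points : set S :=
  [set x | exists2 i : chart S, dom i x & (coord i x).1 = 0].

Definition smooth_map (f : S -> S) := continuous f /\
  forall (i j : chart S) x, dom i x -> dom j (f x) ->
    smooth_at (coord i @` (dom i `&` f @^-1` dom j))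
      (coord j \o f \o param i) (coord i x).

Definition smooth_into (V : normedModType R) (D : set V) (u : V -> S) :=
  {within D, continuous u} /\
  forall (j : chart S) p, D p -> dom j (u p) ->
    smooth_at (D `&` u @^-1` dom j) (coord j \o u) p.

(* Every neighbourhood of the boundary contains a collar. *)
Definition is_diffeo (f : S -> S) :=
  [/\ smooth_map f,
      exists h, [/\ smooth_map h, cancel f h & cancel h f] &
      exists U, [/\ open U, boundary_points `<=` U & forall x, U x -> f x = x]].

Record diffeo := Diffeo {
  diffeo_fun :> S -> S;
  diffeoP : is_diffeo diffeo_fun
}.
HB.instance Definition _ := gen_eqMixin diffeo.
HB.instance Definition _ := gen_choiceMixin diffeo.

Lemma smooth_map_comp f g : smooth_map f -> smooth_map g -> smooth_map (f \o g).
Proof.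
move=> [cf sf] [cg sg]; split.
  by move=> x; apply: continuous_comp; [exact: cg|exact: cf].
move=> i j x ix jfgx; have [k kgx] := dom_cover (g x).
have xi : (coord i @` dom i) (coord i x) by exists x.
have near_k : nbhs x (g @^-1` dom k).
  by apply: (cg x); apply: open_nbhs_nbhs; split => //; exact: dom_open.
have pc := within_continuous_near (@param_continuous S i) xi.
rewrite coordK // in pc.
have := pc _ near_k.
rewrite /within /= nbhsE => -[V [oV Vx] Vk].
pose A := coord i @` (dom i `&` (f \o g) @^-1` dom j).
have AV y : (A `&` V) y -> [/\ dom i (param i y), y = coord i (param i y),
    dom k (g (param i y)) & dom j (f (g (param i y)))].
  move=> [[z [iz jz] zy] Vy]; have Ez : param i y = z by rewrite -zy coordK.
  rewrite Ez; split => //; rewrite -Ez; apply: Vk => //.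
  by exists z.
have [] := @smooth_at_comp R _ (A `&` V)
  (coord k @` (dom k `&` f @^-1` dom j))
  (coord k \o g \o param i) (coord j \o f \o param k) (coord i x).
- by split => //; exists x.
- move=> y /AV[iy _ ky jy]; exists (g (param i y)) => //.
- have [U [h [oU Ux sh gh]]] := sg i k x ix kgx.
  exists U, h; split => // y /AV[iy Ey ky jy] Uy; apply: gh => //.
  by rewrite Ey; exists (param i y).
- by rewrite /= coordK //; apply: sf.
move=> U [h [oU Ux sh Eh]].
exists (U `&` V), h; split => //.
- exact: openI.
- by move=> l y [Uy _]; exact: sh.
- move=> y Ay [Uy Vy]; have AVy : (A `&` V) y by [].
  by rewrite -Eh //= coordK //; have [_ _ ky _] := AV y AVy.
Qed.

Lemma is_diffeo_comp f g : is_diffeo f -> is_diffeo g -> is_diffeo (f \o g).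
Proof.
move=> [sf [f' [sf' fK f'K]] [U [oU bU fU]]].
move=> [sg [g' [sg' gK g'K]] [V [oV bV gV]]]; split.
- exact: smooth_map_comp.
- exists (g' \o f'); split; [exact: smooth_map_comp|exact: can_comp|].
  exact: can_comp.
- exists (U `&` V); split; first exact: openI.
    by move=> x bx; split; [exact: bU|exact: bV].
  by move=> x [Ux Vx] /=; rewrite gV // fU.
Qed.

Definition diffeo_comp (f g : diffeo) : diffeo :=
  Diffeo (is_diffeo_comp (diffeoP f) (diffeoP g)).

(* The Whitney topology on diffeomorphisms of a compact surface: uniform
   convergence of all derivatives on compact subsets of charts.  Derivatives are
   compared at interior points only, which loses nothing: the maps are the
   identity near the boundary. *)
Definition whitney_subbase : set (set diffeo) := [set N |
  exists (f : diffeo) (i j : chart S) (K : set S) (l : seq (R * R)) (eps : R),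
    [/\ compact K, K `<=` dom i, f @` K `<=` dom j, 0 < eps &
    N = [set g : diffeo | g @` K `<=` dom j /\
      forall x, K x -> 0 < (coord i x).1 ->
        `| iterated_derive l (coord j \o g \o param i) (coord i x)
         - iterated_derive l (coord j \o f \o param i) (coord i x) | < eps]]].

HB.instance Definition _ :=
  isSubBaseTopological.Build diffeo whitney_subbase id.

Lemma diffeo_continuous (f : diffeo) : continuous f.
Proof. by have [[cf _] _ _] := diffeoP f. Qed.

End Surfaces.
Arguments boundary_points {R} S _.

Section MappingClasses.
Context {R : realType}.
Variable S : oriented_surface R.

Definition isotopic (f : diffeo S) : set (diffeo S) := [set g |
  exists gamma : R -> diffeo S,
    [/\ {within `[0, 1], continuous gamma}, gamma 0 = f & gamma 1 = g]].

(* The set of path components of the space of diffeomorphisms. *)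
Definition mapping_class_group :=
  {A : set (diffeo S) | exists f, A = isotopic f}.

Definition class_of (f : diffeo S) : mapping_class_group :=
  exist _ (isotopic f) (ex_intro _ f erefl).

Definition representative (a : mapping_class_group) : diffeo S :=
  projT1 (cid (svalP a)).

(* The group law of pi_0; composition of diffeomorphisms is continuous, so the
   choice of representatives is immaterial. *)
Definition class_mul (a b : mapping_class_group) : mapping_class_group :=
  class_of (diffeo_comp (representative a) (representative b)).

Definition H1 := singular_homology R S 1.

(* Isotopic diffeomorphisms are homotopic, so this does not depend on the
   representative. *)
Definition mapping_class_action (a : mapping_class_group) :
    {additive H1 -> H1} :=
  homology_pushforward R (mkcts (@diffeo_continuous R S (representative a))) 1.

(* Smooth embeddings of the circle R/Z, as 1-periodic maps on R. *)
Definition simple_closed_curve (c : R -> S) :=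
  [/\ smooth_into (setT : set R) c,
      forall s, c (s + 1) = c s,
      forall s t, c s = c t -> exists m : int, t = s + m%:~R &
      forall j s, dom j (c s) -> derive1 (coord j \o c) s != 0].

Definition meet_transversely_once (c c' : R -> S) :=
  exists s t, [/\ c s = c' t, range c `&` range c' = [set c s] &
    forall j, dom j (c s) ->
      det2 (derive1 (coord j \o c) s) (derive1 (coord j \o c') t) != 0].

Definition curve_chain m (c : 'I_m -> R -> S) :=
  [/\ forall i, simple_closed_curve (c i),
      forall i j : 'I_m, (i.+1 < j)%N -> range (c i) `&` range (c j) = set0 &
      forall i j : 'I_m, i.+1 = j :> nat -> meet_transversely_once (c i) (c j)].

Definition open_strip : set (R * R) := [set p | -1 < p.2 < 1].

(* An orientation-preserving embedding of R/Z x ]-1, 1[ in the interior of S,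
   1-periodic in the first variable, with core curve c. *)
Definition annulus_around (c : R -> S) (a : R * R -> S) :=
  [/\ smooth_into open_strip a,
      forall p, open_strip p -> a (p.1 + 1, p.2) = a p,
      forall p q, open_strip p -> open_strip q -> a p = a q ->
        p.2 = q.2 /\ exists m : int, q.1 = p.1 + m%:~R,
      forall j p, open_strip p -> dom j (a p) ->
        0 < (coord j (a p)).1 /\ 0 < jacobian_det (coord j \o a) p &
      forall s, a (s, 0) = c s].

(* The right-handed twist for the orientation of S (an arc crossing c turns
   right).  The definition does not depend on the orientation of c: reversing
   it replaces (s, t) by (- s, - t) and chi t by 1 - chi (- t). *)
Definition dehn_twist (c : R -> S) (T : diffeo S) :=
  exists (a : R * R -> S) (chi : R -> R),
  [/\ annulus_around c a,
      [/\ smooth_on setT chi, forall t, t <= - 2^-1 -> chi t = 0 &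
          forall t, 2^-1 <= t -> chi t = 1],
      forall p, open_strip p -> T (a p) = a (p.1 + chi p.2, p.2) &
      forall x, ~ (a @` open_strip) x -> T x = x].

(* Compact, connected, with one boundary circle, of genus g.  For such a surface
   the first homology group is free abelian of rank 2g, g being the genus. *)
Definition surface_g1 (g : nat) :=
  [/\ hausdorff_space S, compact [set: S], connected [set: S],
      exists2 beta, simple_closed_curve beta & range beta = boundary_points S &
      exists e : {additive 'rV[int]_(2 * g) -> H1}, bijective e].

Definition birman_hilden g (c : 'I_(2 * g) -> R -> S)
    (phi : braid_group (2 * g).+1 -> mapping_class_group) :=
  (forall x y, phi (x * y)%g = class_mul (phi x) (phi y)) /\
  (forall i : 'I_(2 * g), exists2 T : diffeo S, dehn_twist (c i) T &
     phi (@sigma (2 * g).+1 i) = class_of T).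

End MappingClasses.

(* Main.v *)
(* The braid z = (sigma_1 ... sigma_2g)^(2g+1) is central and acts on H_1 by -1.
   Inserting z at all places of a bar chain, with alternating signs, is a chain
   homotopy between z^-1 and the identity, so that -2 annihilates the homology.

   That z acts by -1 comes down to the Picard-Lefschetz formula
   T_* x = x + w(x) [c].  Intersection theory is replaced by the map f : S -> R/Z
   that collapses the complement of an annulus around c: w is the degree along f,
   and flowing a path gamma inside the annulus for the time given by a real lift
   of f o gamma deforms gamma to T o gamma.  A curve crossing c once has
   w = 1 or -1.  The braid relations on H_1 then force the form k_j(c_i) to be,
   up to the signs of the c_i, that of the A_2g chain, and since H_1 has rank 2g
   the c_i span it rationally, where the powers of the Coxeter element are
   explicit. *)
From HB Require Import structures.
Require Import Defs.
From mathcomp Require Import all_boot all_order all_algebra.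
From mathcomp Require Import generic_quotient ring_quotient finmap.
From mathcomp Require Import -(notations) monalg.
From mathcomp Require Import boolp classical_sets functions reals topology.
From mathcomp Require Import prodnormedzmodule.
From mathcomp Require Import normedtype landau derive.
From mathcomp Require Import zify ring lra.
Set Implicit Arguments.
Unset Strict Implicit.
Unset Printing Implicit Defensive.
Import Order.TTheory GRing.Theory Num.Theory.
Import numFieldNormedType.Exports ProdNormedZmodule.Exports.
Local Open Scope classical_set_scope.
Local Open Scope ring_scope.
Local Open Scope quotient_scope.

(** * Central elements and the bar complex *)

(** Signs of intersection numbers are never computed. A transverse crossing is only shown to have
    nonzero degree; the braid relation of two neighbouring twists then forces the product of their
    two degrees to be -1, and since the chain is a path, the remaining signs can be absorbed into
    the classes c_i. With n = 2g, the Coxeter element then satisfies x^n - x^(n-1) + ... + 1 = 0,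
    and this polynomial is (x^(n+1) + 1)/(x + 1). The parity of n enters here and in the
    nondegeneracy of the form. The flow moves the end points of the simplices of a cycle, so the
    deformation of gamma to T o gamma is computed among 1-chains modulo boundaries, where open paths
    have classes; the end point terms form a coboundary, which vanishes on cycles. The flow may be
    discontinuous at the frontier of the annulus. The deformation is therefore made on pieces so
    short that the lift takes a single integer value off the annulus, and the pieces are summed by
    telescoping. The exponent 4 comes from the exponent 2 by doubling. *)

Section CentralHomotopy.
Context {V : zmodType}.

(* D i j and E i j stand for face i of the tuple with z inserted at place j, and
   for the insertion at place j in face i. *)
Lemma alternating_sum_cancel n (D E : nat -> nat -> V) :
  (forall i j, (i < j <= n)%N -> D i j = E i j.-1) ->
  (forall j, (0 < j <= n)%N -> D j j = D j j.-1) ->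
  (forall i j, (j.+1 < i <= n.+1)%N -> D i j = E i.-1 j) ->
  \sum_(0 <= j < n.+1) \sum_(0 <= i < n.+2) D i j *~ ((-1) ^+ i * (-1) ^+ j) +
  \sum_(0 <= j < n) \sum_(0 <= i < n.+1) E i j *~ ((-1) ^+ i * (-1) ^+ j) =
  D 0 0 - D n.+1 n.
Proof.
move=> Dlt Deq Dgt.
(* For fixed [j], faces [j] and [j.+1] are the two that touch z. [low] and [high] collect the faces
   before and after them and cancel against the [E] terms; the two touching faces telescope over
   [j]. *)
pose low j := \sum_(0 <= i < j) D i j *~ ((-1) ^+ i * (-1) ^+ j).
pose high j := \sum_(j.+2 <= i < n.+2) D i j *~ ((-1) ^+ i * (-1) ^+ j).
have split4 j : (j < n.+1)%N ->
    \sum_(0 <= i < n.+2) D i j *~ ((-1) ^+ i * (-1) ^+ j) =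
    (low j + high j) + (D j j - D j.+1 j).
  move=> jn; rewrite (@big_cat_nat _ _ _ j 0 n.+2) //=; last lia.
  have [jn1 jn2] : (j < n.+2 /\ j.+1 < n.+2)%N by lia.
  rewrite (big_ltn jn1) (big_ltn jn2) -/(low j) -/(high j).
  have sgn1 : (-1) ^+ j * (-1) ^+ j = 1 :> int by rewrite -exprMn mulrNN mul1r expr1n.
  have sgn2 : (-1) ^+ j.+1 * (-1) ^+ j = -1 :> int by rewrite exprS -mulrA sgn1 mulr1.
  rewrite sgn1 sgn2 mulr1z mulrN1z.
  by rewrite -[RHS]addrA; congr (_ + _); rewrite addrA addrC.
rewrite (eq_big_nat _ _ (fun j jn => split4 j (proj2 (andP jn)))).
rewrite big_split [X in X + _ + _]big_split /=.
have -> : \sum_(0 <= j < n.+1) low j =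
    - \sum_(0 <= j < n) \sum_(0 <= i < j.+1) E i j *~ ((-1) ^+ i * (-1) ^+ j).
  rewrite big_nat_recl // [low 0]big_geq // add0r -sumrN.
  apply: eq_big_nat => j jn; rewrite /low -sumrN; apply: eq_big_nat => i ij.
  rewrite Dlt /=; last lia.
  by rewrite exprS mulN1r mulrN mulrNz.
have -> : \sum_(0 <= j < n.+1) high j =
    - \sum_(0 <= j < n) \sum_(j.+1 <= i < n.+1)
        E i j *~ ((-1) ^+ i * (-1) ^+ j).
  rewrite big_nat_recr //= [high n]big_geq // addr0 -sumrN.
  apply: eq_big_nat => j jn; rewrite /high [LHS]big_add1 -sumrN /=.
  apply: eq_big_nat => i ij; rewrite Dgt /=; last lia.
  by rewrite exprS mulN1r mulNr mulrNz.
have -> : \sum_(0 <= j < n) \sum_(0 <= i < n.+1)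
      E i j *~ ((-1) ^+ i * (-1) ^+ j) =
    \sum_(0 <= j < n) \sum_(0 <= i < j.+1) E i j *~ ((-1) ^+ i * (-1) ^+ j) +
    \sum_(0 <= j < n) \sum_(j.+1 <= i < n.+1)
        E i j *~ ((-1) ^+ i * (-1) ^+ j).
  by rewrite -big_split /=; apply: eq_big_nat => j jn; rewrite -big_cat_nat //=; lia.
have -> : \sum_(0 <= j < n.+1) (D j j - D j.+1 j) = D 0 0 - D n.+1 n.
  rewrite (eq_big_nat _ _ (F2 := fun j => - D j.+1 j - - D j j.-1)).
    by rewrite (telescope_sumr (fun j => - D j j.-1)) //= opprK addrC.
  move=> j jn; rewrite opprK addrC; congr (_ + _).
  by case: j jn => // j jn; apply: Deq; lia.
set a := \sum_(_ <= _ < _) _; set b := \sum_(_ <= _ < _) _.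
by rewrite -opprD addrAC addNr add0r.
Qed.
End CentralHomotopy.

Section HomologyClass.
Context {C : nat -> zmodType} {d : forall n, {additive C n.+1 -> C n}}.

Definition homology_class n : {additive cycles d n -> homology d n} :=
  \pi_(Quotient.quot (@is_boundary C d n)).

Lemma homology_class_eq0 n (x : cycles d n) :
  homology_class n x = 0 <-> exists w, d n w = val x.
Proof.
rewrite -(raddf0 (homology_class n)).
have E : (homology_class n x == homology_class n 0) = (x \in @is_boundary C d n).
  by rewrite -[in RHS](subr0 x) Quotient.idealrBE.
split=> [/eqP|xb]; first by rewrite E unfold_in => /asboolP.
by apply/eqP; rewrite E unfold_in; apply/asboolP.
Qed.

Lemma homology_class_repr n (a : homology d n) : homology_class n (repr a) = a.
Proof. exact: reprK. Qed.
End HomologyClass.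

Section CentralElement.
Variables (G : groupType) (M : zmodType) (rho : G -> {additive M -> M}) (z : G).
Hypothesis zC : forall g : G, (g * z = z * g)%g.

(* Junk value 1 out of range. *)
Definition entry n (g : {ffun 'I_n -> G}) (k : nat) : G :=
  if insub k is Some i then g i else 1%g.

Lemma entryE n (g : {ffun 'I_n -> G}) (i : 'I_n) : entry g i = g i.
Proof. by rewrite /entry insubT //= => p; congr (g _); apply: val_inj. Qed.

Lemma eq_entry n (g h : {ffun 'I_n -> G}) :
  (forall k, (k < n)%N -> entry g k = entry h k) -> g = h.
Proof. by move=> gh; apply/ffunP => i; rewrite -!entryE gh. Qed.

Definition insert_at n (j : nat) (g : {ffun 'I_n -> G}) : {ffun 'I_n.+1 -> G} :=
  [ffun k : 'I_n.+1 => if (k < j)%N then entry g k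
                       else if k == j :> nat then z else entry g k.-1].

Lemma entry_out n (g : {ffun 'I_n -> G}) k : (n <= k)%N -> entry g k = 1%g.
Proof. by move=> nk; rewrite /entry insubF // ltnNge nk. Qed.

Lemma entry_insert_at n j (g : {ffun 'I_n -> G}) k :
  entry (insert_at j g) k = if (n < k)%N then 1%g
    else if (k < j)%N then entry g k
    else if k == j :> nat then z else entry g k.-1.
Proof.
case: (ltnP n k) => kn; first exact: entry_out.
by rewrite -[k]/(nat_of_ord (Ordinal (kn : (k < n.+1)%N))) entryE ffunE.
Qed.

Lemma entry_bar_face n (i : 'I_n.+2) (g : {ffun 'I_n.+1 -> G}) k :
  entry (bar_face i g) k = if (n <= k)%N then 1%g
    else if (k.+1 < i)%N then entry g k
    else if k.+1 == i :> nat then (entry g k * entry g k.+1)%g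
    else entry g k.+1.
Proof.
case: (leqP n k) => kn; first exact: entry_out.
rewrite -[in LHS](_ : nat_of_ord (Ordinal kn) = k) // entryE ffunE /=.
have -> : entry g k = g (widen_ord (leqnSn n) (Ordinal kn)) by rewrite -entryE.
by have -> : entry g k.+1 = g (lift ord0 (Ordinal kn)) by rewrite -entryE.
Qed.

Definition insertion n :
    {additive chains {ffun 'I_n -> G} M -> chains {ffun 'I_n.+1 -> G} M} :=
  alternating_sum
    (fun j : 'I_n.+1 => chains_map (@insert_at n j) (fun=> idfun)).

Lemma insertionU n g m : insertion n (monalg.mkmalgU g m) =
  \sum_(0 <= j < n.+1) monalg.mkmalgU (insert_at j g) m *~ (-1) ^+ j.
Proof.
by rewrite big_mkord; apply: eq_bigr => j _; rewrite /= chains_mapU.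
Qed.

Lemma bar_diffU n g m : bar_diff rho n (monalg.mkmalgU g m) =
  \sum_(0 <= i < n.+2)
    monalg.mkmalgU (bar_face (inord i) g) (bar_coef rho (inord i) g m)
      *~ (-1) ^+ i.
Proof.
rewrite big_mkord; apply: eq_bigr => j _ /=; rewrite chains_mapU.
by rewrite inord_val.
Qed.

Ltac if_lia := repeat (case: ifP => ?; try lia); try done;
  try (congr (entry _ _); lia).

(** The two surviving terms are the extreme faces: face 0 with z in front contributes the action of
    z^-1, and the last face with z at the end deletes z again. [E] is zero in degree 0, where there
    is no face to take. *)
Lemma insertion_cancel n (g : {ffun 'I_n -> G}) m
    (E := fun (i j : nat) => match n return {ffun 'I_n -> G} -> chains {ffun 'I_n -> G} M with
      0 => fun=> 0
    | p.+1 => fun g => monalg.mkmalgU (insert_at j (bar_face (inord i) g))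
        (bar_coef rho (inord i) g m) end g) :
  bar_diff rho n (insertion n (monalg.mkmalgU g m)) +
  \sum_(0 <= j < n) \sum_(0 <= i < n.+1) E i j *~ ((-1) ^+ i * (-1) ^+ j) =
  monalg.mkmalgU g (rho (z^-1)%g m) - monalg.mkmalgU g m.
Proof.
pose D i j := monalg.mkmalgU (bar_face (inord i) (insert_at j g))
  (bar_coef rho (inord i) (insert_at j g) m) : chains {ffun 'I_n -> G} M.
have -> : bar_diff rho n (insertion n (monalg.mkmalgU g m)) =
  \sum_(0 <= j < n.+1) \sum_(0 <= i < n.+2) D i j *~ ((-1) ^+ i * (-1) ^+ j).
  rewrite insertionU raddf_sum; apply: eq_bigr => j _.
  rewrite raddfMz bar_diffU mulrz_suml; apply: eq_bigr => i _.
  by rewrite mulrzA.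
have inordE (i : nat) : (i < n.+2)%N -> (inord i : 'I_n.+2) = i :> nat by move=> h; rewrite inordK.
have coef0 (i : nat) p (h : {ffun 'I_p.+1 -> G}) : (i < p.+2)%N ->
    bar_coef rho (inord i) h = if i == 0%N then rho (entry h 0)^-1%g else idfun.
  move=> ip; rewrite /bar_coef -val_eqE /= inordK //.
  by rewrite -[X in entry h X]/(nat_of_ord (@ord0 p)) entryE.
have entries := (entry_bar_face, entry_insert_at).
rewrite alternating_sum_cancel.
- rewrite /D !coef0 //= entry_insert_at //=; congr (_ - _);
    congr (monalg.mkmalgU _ _); apply: eq_entry => k kn;
    rewrite entry_bar_face inordE // !entry_insert_at.
    by if_lia.
  by if_lia.
- move=> i j ij; rewrite /D /E.
  case: n g @E @D inordE ij => [|n] g E D inordE ij; first lia.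
  rewrite !coef0; try lia.
  congr (monalg.mkmalgU _ _).
    apply: eq_entry => k kn; rewrite !entries inordE ?inordK; try lia.
    by if_lia.
  case: eqP => // i0. rewrite entry_insert_at. by if_lia.
(* Both sides merge z with the same entry, once from the right and once from the left; centrality is
   used here. *)
- move=> j jn; rewrite /D !coef0; try lia.
  have -> : (j == 0%N) = false by lia.
  congr (monalg.mkmalgU _ _).
  apply: eq_entry => k kn; rewrite !entries inordE; last lia.
  by if_lia.
- move=> i j ij; rewrite /D /E.
  case: n g @E @D inordE ij => [|n] g E D inordE ij; first lia.
  rewrite !coef0; try lia.
  congr (monalg.mkmalgU _ _).
    apply: eq_entry => k kn; rewrite !entries inordE ?inordK; try lia.
    by if_lia; congr (_ * entry _ _)%g; lia.
  have -> : (i == 0%N) = false by lia.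
  by have -> : (i.-1 == 0%N) = false by lia.
Qed.

Lemma insertion_homotopy n (x : chains {ffun 'I_n.+1 -> G} M) :
  bar_diff rho n.+1 (insertion n.+1 x) + insertion n (bar_diff rho n x) =
  chains_map id (fun=> rho (z^-1)%g) x - x.
Proof.
pose F : {additive _ -> _} := (bar_diff rho n.+1 \o @insertion n.+1)
  \+ (@insertion n \o bar_diff rho n).
pose H : {additive _ -> _} := chains_map (id : {ffun 'I_n.+1 -> G} -> _)
  (fun=> rho (z^-1)%g) \- idfun.
apply: (@chains_eq _ M _ F H) => g m; rewrite /F /H /= chains_mapU.
rewrite -insertion_cancel; congr (_ + _).
rewrite bar_diffU raddf_sum [RHS]exchange_big; apply: eq_bigr => i _.
rewrite raddfMz insertionU mulrz_suml; apply: eq_bigr => j _.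
by rewrite mulrC mulrzA.
Qed.

Lemma insertion_homotopy0 (x : chains {ffun 'I_0 -> G} M) :
  bar_diff rho 0 (insertion 0 x) = chains_map id (fun=> rho (z^-1)%g) x - x.
Proof.
pose F : {additive _ -> _} := bar_diff rho 0 \o @insertion 0.
pose H : {additive _ -> _} := chains_map (id : {ffun 'I_0 -> G} -> _)
  (fun=> rho (z^-1)%g) \- idfun.
apply: (@chains_eq _ M _ F H) => g m; rewrite /F /H /= chains_mapU.
by rewrite -insertion_cancel big_geq // addr0.
Qed.

(** On a cycle x the homotopy formula reads d (insertion x) = -2x, so minus the insertion bounds 2x.
    Degree 0 is separate because no differential leaves it. *)
Lemma central_opp_homology n (a : group_homology rho n) :
  (forall m, rho (z^-1)%g m = - m) -> a *+ 2 = 0.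
Proof.
move=> rhoz; rewrite -[a]homology_class_repr; set x := repr a.
rewrite -raddfMn; apply/homology_class_eq0; rewrite mulr2n.
have mapN p (y : chains {ffun 'I_p -> G} M) :
    chains_map id (fun=> rho (z^-1)%g) y = - y.
  apply: (@chains_eq _ M _ (chains_map id (fun=> rho (z^-1)%g)) (-%R \o idfun)).
  by move=> g m /=; rewrite chains_mapU /= rhoz raddfN.
case: n a @x => [|n] a x.
  exists (- insertion 0 (val x)).
  by rewrite raddfN insertion_homotopy0 mapN -opprD opprK.
exists (- insertion n.+1 (val x)).
have := insertion_homotopy (val x).
have /eqP -> : bar_diff rho n (val x) == 0 by exact: (valP x).
by rewrite raddf0 addr0 raddfN => ->; rewrite mapN -opprD opprK.
Qed.
End CentralElement.

(** * The center of the braid group *)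

Section BraidCenter.
Variables (G : groupType) (n : nat) (s : nat -> G).
Hypothesis s_comm : forall i j, (i.+1 < j < n)%N -> (s i * s j = s j * s i)%g.
Hypothesis s_braid : forall i, (i.+1 < n)%N ->
  (s i * s i.+1 * s i = s i.+1 * s i * s i.+1)%g.

Fixpoint coxeter m : G := if m is m'.+1 then (coxeter m' * s m')%g else 1%g.
Local Notation D := coxeter.

Lemma coxeter_comm m j : (m < j < n)%N -> (D m * s j = s j * D m)%g.
Proof.
elim: m => [|m IH] mj /=; first by rewrite mulg1 mul1g.
by rewrite -mulgA s_comm // mulgA IH ?mulgA //; lia.
Qed.

Lemma coxeter_shift m i : (i.+1 < m <= n)%N -> (D m * s i = s i.+1 * D m)%g.
Proof.
elim: m => // m IH im /=; have [im' | im'] : (i.+1 < m)%N \/ m = i.+1 by lia.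
  by rewrite -mulgA -s_comm ?mulgA ?IH ?mulgA //; lia.
rewrite im' /= -!mulgA (mulgA (s i)) s_braid; last lia.
by rewrite !mulgA coxeter_comm //; lia.
Qed.

(** Conjugation by [D n] shifts the generators up by one, which leaves out the last one; this is the
    wrap-around. The auxiliary [H] slides the prefix [D m] through [D n] by means of the shift and
    is used at m = n - 1. *)
Lemma coxeter_square : (0 < n)%N -> (D n ^+ 2 * s n.-1 = s 0 * D n ^+ 2)%g.
Proof.
move=> n0; have H m : (m < n)%N -> (s 0 * D n * D m = D m.+1 * D n)%g.
  elim: m => [|m IH] mn /=; first by rewrite mulg1 mul1g.
  rewrite mulgA IH; last lia.
  rewrite -mulgA (@coxeter_shift n); last lia.
  by rewrite mulgA.
have := H n.-1; rewrite prednK // => /(_ (leqnn n)) Hn.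
rewrite expgS expg1 -[in LHS]Hn.
have DS : D n = (D n.-1 * s n.-1)%g by rewrite -[in LHS](prednK n0).
by rewrite -!mulgA -DS.
Qed.

Lemma coxeter_expn_shift k i : (i + k < n)%N ->
  (D n ^+ k * s i = s (i + k) * D n ^+ k)%g.
Proof.
elim: k => [|k IH] ik; first by rewrite !expg0 addn0 mulg1 mul1g.
rewrite expgS -mulgA IH; last lia.
by rewrite mulgA (@coxeter_shift n) ?addnS ?mulgA //; lia.
Qed.

Lemma coxeter_central i : (i < n)%N ->
  (D n ^+ n.+1 * s i = s i * D n ^+ n.+1)%g.
Proof.
(* Conjugating [s i] by these powers in turn: n-1-i shifts lead to [s n.-1], the square wraps around
   to [s 0], and i more shifts return to [s i]. *)
move=> ni; have -> : n.+1 = (i + (2 + (n.-1 - i)))%N by lia.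
rewrite !expgnDr -!mulgA coxeter_expn_shift; last lia.
have -> : (i + (n.-1 - i) = n.-1)%N by lia.
have := coxeter_square (leq_ltn_trans (leq0n i) ni).
rewrite expgS expg1 => sq.
rewrite (mulgA (D n) (D n)) (mulgA (D n * D n)%g) sq.
by rewrite !mulgA -[i in LHS]add0n coxeter_expn_shift ?add0n.
Qed.
End BraidCenter.

Section BraidGenerators.
Variable m : nat.

(** Indexed by all naturals, with 1 out of range, to match the sequence [s : nat -> G] used for the
    center. *)
Definition generator (i : nat) : braid_group m.+1 :=
  if insub i is Some j then sigma (n := m.+1) j else 1%g.

Lemma generatorE (i : 'I_m) : generator i = sigma (n := m.+1) i.
Proof.
by rewrite /generator insubT //= => p; congr (sigma _); apply: val_inj.
Qed.

Lemma braid_class_cat w w' :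
  braid_class (w ++ w') = (braid_class w * braid_class w')%g :> braid_group m.+1.
Proof. by rewrite -braid_classM. Qed.

Lemma braid_relationE w w' : braid_relation w w' ->
  braid_class w = braid_class w' :> braid_group m.+1.
Proof.
move=> h; apply/braid_classP; have := @braid_step m.+1 [::] [::] _ _ h.
by rewrite !cats0.
Qed.

Lemma generator_comm i j : (i.+1 < j < m)%N ->
  (generator i * generator j = generator j * generator i)%g.
Proof.
move=> /andP[ij jm]; have im : (i < m)%N by lia.
rewrite -[i]/(nat_of_ord (Ordinal im)) -[j]/(nat_of_ord (Ordinal jm)) !generatorE.
rewrite -!braid_class_cat; apply: braid_relationE.
exact: (@braid_commute m.+1 (Ordinal im) (Ordinal jm)).
Qed.

Lemma generator_braid i : (i.+1 < m)%N ->
  (generator i * generator i.+1 * generator i =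
   generator i.+1 * generator i * generator i.+1)%g.
Proof.
move=> jm; have im : (i < m)%N by lia.
rewrite -[i in LHS]/(nat_of_ord (Ordinal im)).
rewrite -[i.+1]/(nat_of_ord (Ordinal jm)).
rewrite -[i]/(nat_of_ord (Ordinal im)) !generatorE.
rewrite /sigma -!braid_class_cat -!catA; apply: braid_relationE.
exact: (@braid_yang_baxter m.+1 (Ordinal im) (Ordinal jm)).
Qed.

Lemma generator_centralizer (z : braid_group m.+1) :
  (forall i, (i < m)%N -> (z * generator i = generator i * z)%g) ->
  forall g, (g * z = z * g)%g.
Proof.
move=> zs g; rewrite -[g]braid_reprK; elim: (repr g) => [|[i b] w IH].
  by rewrite -[braid_class [::]]/(1%g : braid_group m.+1) mulg1 mul1g.
rewrite -cat1s braid_class_cat -mulgA IH !mulgA; congr (_ * _)%g.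
have zi : (z * sigma (n := m.+1) i = sigma (n := m.+1) i * z)%g.
  by rewrite -generatorE zs.
case: b; first by rewrite -/(sigma (n := m.+1) i) zi.
have -> : braid_class [:: (i, false)] = (sigma (n := m.+1) i)^-1%g.
  apply: (mulgI (sigma (n := m.+1) i)); rewrite mulgV /sigma -braid_class_cat.
  exact/braid_relationE/(@braid_cancel m.+1 i true).
by rewrite -[in LHS](mulgK (sigma (n := m.+1) i) z) zi !mulgA mulVg mul1g.
Qed.
End BraidGenerators.

(** * Braid representations by transvections *)

Section Transvections.
Variables (H : zmodType) (n : nat) (c : nat -> H) (k : nat -> {additive H -> int}).

Definition transvection i (x : H) : H := x + c i *~ k i x.

Lemma transvection_additive i : zmod_morphism (transvection i).
Proof. by move=> x y; rewrite /transvection raddfB mulrzBr opprD addrACA. Qed.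
HB.instance Definition _ i := GRing.isZmodMorphism.Build H H (transvection i)
  (@transvection_additive i).

Fixpoint coxeter_map m (x : H) : H :=
  if m is m'.+1 then coxeter_map m' (transvection m' x) else x.
Local Notation D := coxeter_map.

Lemma coxeter_map_additive m : zmod_morphism (D m).
Proof. by elim: m => [|m IH] x y //=; rewrite raddfB IH. Qed.
HB.instance Definition _ m := GRing.isZmodMorphism.Build H H (D m)
  (@coxeter_map_additive m).

(* In this normal form the Coxeter element sends c_j to c_(j+1) and
   c_(n-1) to \sum_j (-1)^(n-1-j) c_j. *)
Hypothesis gram : forall i j, (i < n)%N -> (j < n)%N ->
  k j (c i) = (i.+1 == j)%:Z - (i == j.+1)%:Z.

Lemma transvection_fix i j : (i < n)%N -> (j < n)%N ->
  (j.+1 == i) = false -> (j == i.+1) = false -> transvection i (c j) = c j.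
Proof.
by move=> ni nj ij ji; rewrite /transvection gram // ij ji subrr mulr0z addr0.
Qed.

Lemma transvection_succ j : (j.+1 < n)%N ->
  transvection j.+1 (c j) = c j + c j.+1.
Proof.
move=> jn; rewrite /transvection gram //; last lia.
rewrite eqxx (_ : (j == j.+2) = false); last lia.
by rewrite subr0 mulr1z.
Qed.

Lemma transvection_pred j : (j.+1 < n)%N ->
  transvection j (c j.+1) = c j.+1 - c j.
Proof.
move=> jn; rewrite /transvection gram //; last lia.
rewrite eqxx (_ : (j.+2 == j) = false); last lia.
by rewrite sub0r mulrN1z.
Qed.

Lemma coxeter_map_fix m j : (m < j < n)%N -> D m (c j) = c j.
Proof. by elim: m => [|m IH] mj //=; rewrite transvection_fix ?IH //; lia. Qed.

Lemma coxeter_map_shift m j : (j.+1 < m <= n)%N -> D m (c j) = c j.+1.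
Proof.
elim: m => // m IH jm /=; have [jm' | ->] : (j.+1 < m)%N \/ m = j.+1 by lia.
  by rewrite transvection_fix ?IH //; lia.
rewrite transvection_succ /=; last lia.
rewrite (raddfD (transvection j)) /= transvection_pred; last lia.
rewrite transvection_fix; try lia.
by rewrite addrC subrK coxeter_map_fix //; lia.
Qed.

Fixpoint alternating m : H :=
  if m is m'.+1 then c m'.+1 - alternating m' else c 0%N.

Lemma coxeter_map_last m : (m < n)%N -> D m (c m) = alternating m.
Proof.
elim: m => [|m IH] mn //=.
by rewrite transvection_pred // coxeter_map_additive IH ?coxeter_map_fix //; lia.
Qed.

(** Shifting every index of [alternating m] by one gives [alternating m.+1] without its last term,
    the one in c_0. *)
Lemma coxeter_map_alternating m : (m.+1 < n)%N ->
  D n (alternating m) = alternating m.+1 - c 0%N *~ (-1) ^+ m.+1.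
Proof.
elim: m => [|m IH] mn.
  rewrite /= coxeter_map_shift; last lia.
  by rewrite expr1 mulrN1z opprK subrK.
rewrite [alternating m.+1]/= coxeter_map_additive -/(alternating m.+1) IH; last lia.
rewrite coxeter_map_shift; last lia.
by rewrite [in RHS]exprS mulN1r mulrNz opprB opprK addrA addrAC.
Qed.

Hypotheses (n0 : (0 < n)%N) (n_even : ~~ odd n).

Lemma iter_coxeter_map j : (j < n)%N -> iter j (D n) (c 0%N) = c j.
Proof.
elim: j => [|j IH] jn //; rewrite iterS IH; last lia.
by rewrite coxeter_map_shift //; lia.
Qed.

(** All c_j lie on the orbit of c_0, so c_0 suffices. There D^n c_0 is the full alternating sum, and
    one more application of [D n] leaves only c_0, with sign (-1)^(n-1) = -1 as n is even. *)
Lemma iter_coxeter_map_opp j : (j < n)%N -> iter n.+1 (D n) (c j) = - c j.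
Proof.
move=> jn; have [m nE] : exists m, n = m.+2 by exists n.-2; lia.
have top : D n (c m.+1) = alternating m.+1.
  rewrite [n in D n]nE -[LHS]/(D m.+1 (transvection m.+1 (c m.+1))) transvection_fix; try lia.
  by rewrite (@coxeter_map_last m.+1) //; lia.
have alt : D n (alternating m.+1) = - c 0%N.
  rewrite [alternating _]/= coxeter_map_additive coxeter_map_alternating ?nE //.
  rewrite -nE top opprB addrC subrK.
  by rewrite -signr_odd (_ : odd m.+1) ?mulrN1z //; lia.
have base : iter n.+1 (D n) (c 0%N) = - c 0%N.
  by rewrite [n in iter n.+1]nE 2!iterS iter_coxeter_map ?top // nE.
rewrite -(iter_coxeter_map jn) -iterD addnC iterD base.
by elim: j {jn} => //= j ->; rewrite raddfN.
Qed.

Variable e : {additive 'rV[int]_n -> H}.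
Hypothesis e_bij : bijective e.

Lemma torsion_free (x : H) (d : int) : d != 0 -> x *~ d = 0 -> x = 0.
Proof.
case: e_bij => f fe ef d0; rewrite -[x]ef -raddfMz => /eqP.
rewrite -(raddf0 e) (inj_eq (can_inj fe)) -scaler_int intz scalemx_eq0.
by rewrite (negPf d0) => /eqP fx0; congr (e _).
Qed.

Definition combination (v : 'rV[int]_n) : H := \sum_(i < n) c i *~ v ord0 i.

Lemma gram_combination v j : (j < n)%N ->
  k j (combination v) = \sum_(i < n) v ord0 i * ((i.+1 == j)%:Z - (i == j.+1 :> nat)%:Z).
Proof.
move=> jn; rewrite raddf_sum; apply: eq_bigr => i _.
by rewrite raddfMz gram // mulrzz mulrC.
Qed.

(** With [w] the extension of v by zero, the equations say w_1 = 0 and w_(j-1) = w_(j+1). The odd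
    entries vanish starting from the left end, and the even ones starting from w_n = 0 at the right
    end, because n is even. *)
Lemma gram_nondegenerate v :
  (forall j, (j < n)%N -> k j (combination v) = 0) -> v = 0.
Proof.
move=> kv; pose w i := if insub i is Some i' then v ord0 (i' : 'I_n) else 0.
have wE (i : 'I_n) : v ord0 i = w i.
  by rewrite /w insubT //= => p; congr (v _ _); apply: val_inj.
have w_out i : (n <= i)%N -> w i = 0.
  by move=> ni; rewrite /w insubF // ltnNge ni.
have delta i : \sum_(l < n) v ord0 l * (l == i :> nat)%:Z = w i.
  have [ni | ni] := leqP n i.
    rewrite w_out // big1 // => l _; rewrite (_ : (l == i :> nat) = false) ?mulr0 //.
    by have := ltn_ord l; lia.
  rewrite (bigD1 (Ordinal ni)) //= eqxx mulr1 wE big1 ?addr0 // => l li.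
  by rewrite -val_eqE in li; rewrite (negPf li) mulr0.
have w1 : w 1%N = 0.
  have := kv 0%N n0; rewrite gram_combination //.
  rewrite (eq_bigr (fun l : 'I_n => - (v ord0 l * (l == 1 :> nat)%:Z))).
    by rewrite sumrN delta => /eqP; rewrite oppr_eq0 => /eqP.
  by move=> l _; rewrite sub0r mulrN.
have wS j : (j.+1 < n)%N -> w j = w j.+2.
  move=> jn; have := kv j.+1 jn; rewrite gram_combination //.
  under eq_bigr do rewrite mulrBr eqSS.
  by rewrite sumrB !delta => /eqP; rewrite subr_eq0 => /eqP.
have w_odd j : w j.*2.+1 = 0.
  elim: j => [|j IH] //; have [jn | jn] := leqP n j.+1.*2.+1; first exact: w_out.
  by rewrite doubleS -wS // -?doubleS; lia.
have w_even j : (j.*2 <= n)%N -> w (n - j.*2)%N = 0.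
  elim: j => [|j IH] jn; first by rewrite subn0 w_out.
  rewrite wS; last lia.
  by rewrite -[RHS]IH; [congr w | ]; lia.
apply/rowP => i; rewrite mxE wE; case: (boolP (odd i)) => oi.
  by rewrite -(odd_double_half i) oi w_odd.
have ni := ltn_ord i.
have -> : i = (n - (n - i)./2.*2)%N :> nat.
  by rewrite halfK oddB ?(negPf n_even) ?(negPf oi) //=; lia.
by apply: w_even; rewrite halfK; lia.
Qed.

(** Cramer's rule. There are as many c_i as the rank of H, so their coordinates form a square matrix
    [C]; a vector in its left kernel is annihilated by the form, hence zero. The multiple d is det
    C, and v comes from the adjugate. *)
Lemma combination_full : exists2 d : int, d != 0 &
  forall x, exists v, x *~ d = combination v.
Proof.
case: e_bij => f fe ef.
pose C : 'M[int]_n := \matrix_i f (c i).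
have CE v : combination v = e (v *m C).
  apply: (can_inj ef); rewrite fe mulmx_sum_row /combination.
  have -> : \sum_(i < n) c i *~ v ord0 i = e (\sum_(i < n) v ord0 i *: row i C).
    rewrite raddf_sum; apply: eq_bigr => i _.
    by rewrite -[v ord0 i in RHS]intz scaler_int raddfMz rowK ef.
  by rewrite fe.
exists (\det C).
  apply/negP => /det0P[v v0 vC]; case/negP: v0; apply/eqP.
  by apply: gram_nondegenerate => j jn; rewrite CE vC !raddf0.
move=> x; exists (f x *m \adj C); rewrite CE -mulmxA mul_adj_mx mul_mx_scalar.
by rewrite -[X in X *: _]intz scaler_int raddfMz ef.
Qed.

(** Two additive maps that agree on the c_i agree on a nonzero multiple of every x, and H is torsion
    free. *)
Lemma iter_coxeter_map_oppE x : iter n.+1 (D n) x = - x.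
Proof.
have [d d0 full] := combination_full; have [v vE] := full x.
pose F := iter n.+1 (D n).
have FB : zmod_morphism F.
  rewrite /F; elim: n.+1 => [|p IH] y z //=.
  by rewrite IH coxeter_map_additive.
pose A : {additive H -> H} := HB.pack F (GRing.isZmodMorphism.Build H H F FB).
have AE y : iter n.+1 (D n) y = A y by [].
apply/eqP; rewrite -subr_eq0 opprK AE; apply/eqP/(torsion_free d0).
rewrite mulrzDl -raddfMz vE -AE; apply/eqP; rewrite addr_eq0 AE /combination.
rewrite raddf_sum -sumrN; apply/eqP/eq_bigr => i _.
by rewrite raddfMz -AE iter_coxeter_map_opp // mulNrz.
Qed.
End Transvections.

Section BraidTransvections.
Variables (H : zmodType) (n : nat) (c : nat -> H) (k : nat -> {additive H -> int}).
Variables (e : {additive 'rV[int]_n -> H}) (e_bij : bijective e).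
Variable rho : braid_group n.+1 -> {additive H -> H}.
Hypotheses (n_even : ~~ odd n).
Hypothesis rhoM : forall a b x, rho (a * b)%g x = rho a (rho b x).
Hypothesis rho1 : forall x, rho 1%g x = x.
Hypothesis rho_generator : forall i x, (i < n)%N ->
  rho (generator n i) x = transvection c k i x.
Hypothesis k_self : forall i, (i < n)%N -> k i (c i) = 0.
Hypothesis k_far : forall i j, (i < n)%N -> (j < n)%N ->
  (i.+1 < j)%N \/ (j.+1 < i)%N -> k i (c j) = 0.
Hypothesis k_succ : forall i, (i.+1 < n)%N -> k i (c i.+1) != 0.
Hypothesis k_pred : forall i, (i.+1 < n)%N -> k i.+1 (c i) != 0.

(* The braid relation evaluated at c_i reads (1 + a b) b c_(i+1) = 0. *)
Lemma gram_adjacent i : (i.+1 < n)%N -> k i (c i.+1) * k i.+1 (c i) = -1.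
Proof.
move=> ni; have ni' : (i < n)%N by lia.
set a := k i (c i.+1); set b := k i.+1 (c i).
have ti : transvection c k i (c i) = c i.
  by rewrite /transvection k_self // mulr0z addr0.
have tS : transvection c k i.+1 (c i.+1) = c i.+1.
  by rewrite /transvection k_self // mulr0z addr0.
have tiS : transvection c k i (c i.+1) = c i.+1 + c i *~ a by [].
have tSi : transvection c k i.+1 (c i) = c i + c i.+1 *~ b by [].
have := congr1 (fun h => rho h (c i)) (generator_braid ni).
rewrite /= !rhoM !rho_generator // ti tSi.
rewrite (raddfD (transvection c k i)) raddfMz /= ti tiS.
rewrite (raddfD (transvection c k i.+1)) raddfMz /= raddfD raddfMz /= tS tSi.
rewrite !mulrzDl -!mulrzA !addrA => /eqP.
rewrite eq_sym -subr_eq0 => /eqP E.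
have c0 : c i.+1 != 0.
  by apply: contraNneq (k_succ ni) => ->; rewrite raddf0.
have Z : c i.+1 *~ (b * (1 + a * b)) = 0.
  by rewrite mulrDr mulr1 mulrzDr -[RHS]E [X in X - _](ACl (2*5*(1*3*4))) addrK.
have := torsion_free e_bij _ Z.
case: (eqVneq (b * (1 + a * b)) 0) => [/eqP|nz /(_ isT) c0'].
  by rewrite mulf_eq0 (negPf (k_pred ni)) /= addrC addr_eq0 => /eqP ->.
by rewrite c0' eqxx in c0.
Qed.

(** Chosen so that the form takes the value 1 on (c_i, c_(i+1)) after rescaling. The diagram A_n has
    no cycle, so the signs can be prescribed one edge at a time. *)
Fixpoint sign i : int := if i is i'.+1 then sign i' * k i'.+1 (c i') else 1.

Lemma gram_square i : (i.+1 < n)%N -> k i.+1 (c i) * k i.+1 (c i) = 1.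
Proof.
move=> /gram_adjacent ab; have := congr1 absz ab.
rewrite abszM => /eqP; rewrite muln_eq1 => /andP[_ /eqP b1].
by have [->|->] : k i.+1 (c i) = 1 \/ k i.+1 (c i) = -1 by lia.
Qed.

Lemma sign_square i : (i < n)%N -> sign i * sign i = 1.
Proof.
elim: i => [|i IH] ni /=; first by rewrite mulr1.
by rewrite mulrACA gram_square // IH ?mulr1 //; lia.
Qed.

Definition signed_vector i := c i *~ sign i.
Definition signed_form i (x : H) : int := k i x * sign i.
Lemma signed_form_additive i : zmod_morphism (signed_form i).
Proof. by move=> x y; rewrite /signed_form raddfB mulrBl. Qed.
HB.instance Definition _ i := GRing.isZmodMorphism.Build H int (signed_form i)
  (@signed_form_additive i).

Lemma signed_transvection i x : (i < n)%N ->
  transvection signed_vector signed_form i x = transvection c k i x.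
Proof.
move=> ni; rewrite /transvection /= /signed_vector /signed_form -mulrzA.
by rewrite (mulrC (k i x)) mulrA sign_square // mul1r.
Qed.

Lemma signed_gram i j : (i < n)%N -> (j < n)%N ->
  signed_form j (signed_vector i) = (i.+1 == j)%:Z - (i == j.+1)%:Z.
Proof.
move=> ni nj; rewrite /= /signed_form /signed_vector raddfMz mulrzz.
case: (ltngtP i j) => [ij | ji | <-].
- have f1 : (i == j.+1) = false by lia.
  case: (eqVneq i.+1 j) => [ji | ij'].
    rewrite f1 subr0; rewrite -ji in nj *.
    by rewrite /= mulrA -(mulrA (k _ _)) sign_square // mulr1 gram_square.
  have far : k j (c i) = 0 by apply: k_far => //; right; lia.
  by rewrite far !mul0r f1 subrr.
- have f1 : (i.+1 == j) = false by lia.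
  rewrite f1 sub0r; case: (eqVneq i j.+1) => [ij | ji'].
    rewrite ij in ni *.
    by rewrite /= -mulrA (mulrAC (sign j)) sign_square // mul1r gram_adjacent.
  have far : k j (c i) = 0 by apply: k_far => //; left; lia.
  by rewrite far !mul0r oppr0.
- have [f1 f2] : (i.+1 == i) = false /\ (i == i.+1) = false by split; lia.
  by rewrite k_self // !mul0r f1 f2.
Qed.

Lemma rho_coxeter m x : (m <= n)%N -> rho (coxeter (generator n) m) x =
  coxeter_map signed_vector signed_form m x.
Proof.
elim: m x => [|m IH] x mn /=; first exact: rho1.
rewrite rhoM rho_generator // -signed_transvection // IH //; lia.
Qed.

Lemma central_opp :
  exists2 z : braid_group n.+1, (forall g, g * z = z * g)%g &
    forall x, rho z^-1%g x = - x.
Proof.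
pose z := (coxeter (generator n) n ^+ n.+1)%g.
have zC g : (g * z = z * g)%g.
  apply: generator_centralizer => i ni.
  by apply: coxeter_central => //; [exact: generator_comm | exact: generator_braid].
(* For n = 0 the module has rank 0, and -x = x holds trivially. *)
exists z => // x; case: (posnP n) => [n0 | n0].
  case: e_bij => f fe ef; rewrite -[LHS]ef -[RHS]ef; congr (e _).
  by apply/rowP => i; have := ltn_ord i; rewrite {2}n0.
have iterE p y : rho (coxeter (generator n) n ^+ p)%g y =
    iter p (coxeter_map signed_vector signed_form n) y.
  elim: p => [|p IH]; first by rewrite expg0 rho1.
  by rewrite expgS rhoM IH iterS rho_coxeter.
have rz y : rho z y = - y.
  by rewrite /z iterE (iter_coxeter_map_oppE signed_gram n0 n_even e_bij).
by have := rhoM z^-1%g z x; rewrite mulVg rho1 rz raddfN => {2}->; rewrite opprK.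
Qed.
End BraidTransvections.

(** * Homology classes of paths *)

Lemma continuous_pair (T U V : topologicalType) (f : T -> U) (g : T -> V) x :
  {for x, continuous f} -> {for x, continuous g} ->
  {for x, continuous (fun y => (f y, g y))}.
Proof.
move=> cf cg.
exact: (@cvg_pair _ _ _ (nbhs x) (nbhs (f x)) (nbhs (g x)) _ _ _ f g cf cg).
Qed.

Section ChainsSum.
Context {K : choiceType} {V : zmodType}.

Definition chains_sum (w : K -> V) (c : chains K int) : V :=
  \sum_(k <- monalg.msupp c) w k *~ monalg.mcoeff k c.

Lemma chains_sum_additive w : zmod_morphism (chains_sum w).
Proof.
have wide (s : {fset K}) (c : chains K int) : (monalg.msupp c `<=` s)%fset ->
    chains_sum w c = \sum_(k <- s) w k *~ monalg.mcoeff k c.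
  move=> cs; rewrite /chains_sum (big_fset_incl _ cs) // => k _ kNc.
  by rewrite monalg.mcoeff_outdom // mulr0z.
move=> c c'; pose s := (monalg.msupp c `|` monalg.msupp c')%fset.
rewrite (wide s) ?monalg.msuppB_le // (wide s c) ?fsubsetUl //.
rewrite (wide s c') ?fsubsetUr // -sumrB; apply: eq_bigr => k _.
by rewrite raddfB mulrzBr.
Qed.
HB.instance Definition _ w := GRing.isZmodMorphism.Build (chains K int) V
  (chains_sum w) (chains_sum_additive w).

Lemma chains_sumU w k : chains_sum w (monalg.mkmalgU k 1) = w k.
Proof.
rewrite /chains_sum (big_fset_incl _ (@monalg.msuppU_le _ _ k 1)) //.
  by rewrite big_seq_fset1 monalg.mcoeffUU.
by move=> l _ /monalg.mcoeff_outdom ->; rewrite mulr0z.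
Qed.

Lemma chains_eq1 (F G : {additive chains K int -> V}) :
  (forall k, F (monalg.mkmalgU k 1) = G (monalg.mkmalgU k 1)) -> F =1 G.
Proof.
move=> FG; apply: chains_eq => k x.
have -> : monalg.mkmalgU k x = monalg.mkmalgU k 1 *~ x :> chains K int.
  by rewrite -raddfMz intz.
by rewrite !raddfMz FG.
Qed.
End ChainsSum.

Section Paths.
Context {R : realType}.

(** Paths and homotopies are functions on the whole line or plane of which only the part over [0, 1]
    counts. Clamping extends data from the interval to continuous functions everywhere. *)
Definition clamp (t : R) : R := Num.min (Num.max t 0) 1.

Lemma clamp_ge0 t : 0 <= clamp t.
Proof. by rewrite /clamp le_min ler01 le_max lexx orbT. Qed.
Lemma clamp_le1 t : clamp t <= 1.
Proof. by rewrite /clamp ge_min lexx orbT. Qed.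
Lemma clampE t : 0 <= t <= 1 -> clamp t = t.
Proof. by case/andP => t0 t1; rewrite /clamp (max_idPl t0) (min_idPl t1). Qed.
Lemma clamp_continuous : continuous clamp.
Proof.
move=> t; apply: (@continuous_min R R (fun t => Num.max t 0) (fun=> 1) t).
  by apply: (@continuous_max R R id (fun=> 0) t); [exact: cvg_id | exact: cvg_cst].
exact: cvg_cst.
Qed.

Definition edge_point (t : R) : 'rV[R]_2 :=
  \row_j (if j == ord0 then 1 - clamp t else clamp t).

Lemma edge_point_simplex t : simplex (R := R) (n := 1) (edge_point t).
Proof.
split=> [j|]; first by rewrite mxE; case: ifP => _; rewrite ?subr_ge0 ?clamp_le1 ?clamp_ge0.
by rewrite big_ord_recl big_ord1 !mxE /= subrK.
Qed.

Definition edge (t : R) : simplex (R := R) (n := 1) :=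
  exist _ (edge_point t) (mem_set (edge_point_simplex t)).

Definition simplex_coord n (j : 'I_n.+1) (x : simplex (R := R) (n := n)) : R :=
  (\val x) ord0 j.

Lemma simplex_coord_continuous n (j : 'I_n.+1) : continuous (@simplex_coord n j).
Proof.
move=> x; apply: (@continuous_comp _ _ _
  (fun y : simplex (R := R) (n := n) => set_val y)
  (fun M : 'rV[R]_n.+1 => M ord0 j)).
  exact: initial_continuous.
exact: coord_continuous.
Qed.

Lemma continuous_to_simplex n (T : topologicalType)
    (g : T -> simplex (R := R) (n := n)) :
  (forall j, continuous (fun t => simplex_coord j (g t))) -> continuous g.
Proof.
move=> cg; apply: continuous_comp_initial => t N [P tP PN].
have cl (i : 'I_1) (j : 'I_n.+1) : \forall s \near t, P i j ((\val (g s)) i j).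
  by have := tP i j; rewrite (ord1 i) => Pj; exact: (cg j t _ Pj).
have : \forall s \near t, forall i j, P i j ((\val (g s)) i j).
  by apply: (filter_forall (F := nbhs t)) => i;
    apply: (filter_forall (F := nbhs t)) => j; exact: cl.
by apply: filterS => s h; apply: PN => i j; exact: h.
Qed.

Lemma edge_continuous : continuous edge.
Proof.
apply: continuous_to_simplex => j t.
have -> : (fun t => simplex_coord j (edge t)) =
    (fun s => if j == ord0 then 1 - clamp s else clamp s).
  by apply/funext => s; rewrite /simplex_coord /= mxE.
case: (boolP (j == ord0)) => _; last exact: clamp_continuous.
by apply: cvgB; [exact: cvg_cst | exact: clamp_continuous].
Qed.

Lemma simplex1_coord (x : simplex (R := R) (n := 1)) :
  simplex_coord ord0 x = 1 - simplex_coord ord_max x.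
Proof.
have [_] := set_mem (valP x); rewrite big_ord_recl big_ord1 => <-.
by rewrite (_ : lift ord0 ord0 = ord_max) ?addrK //; apply: val_inj.
Qed.

Lemma simplex_coord_ge0 n j (x : simplex (R := R) (n := n)) : 0 <= simplex_coord j x.
Proof. by have [+ _] := set_mem (valP x); exact. Qed.

Lemma simplex_coord_le1 (x : simplex (R := R) (n := 1)) : simplex_coord ord_max x <= 1.
Proof. by have := simplex_coord_ge0 ord0 x; rewrite simplex1_coord subr_ge0. Qed.

Lemma simplex_eq n (x y : simplex (R := R) (n := n)) :
  (forall j, simplex_coord j x = simplex_coord j y) -> x = y.
Proof. by move=> xy; apply: val_inj; apply/rowP => j; exact: xy. Qed.

Lemma edgeK (x : simplex (R := R) (n := 1)) : edge (simplex_coord ord_max x) = x.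
Proof.
have cl : clamp (simplex_coord ord_max x) = simplex_coord ord_max x.
  by rewrite clampE // simplex_coord_ge0 simplex_coord_le1.
apply: simplex_eq => j; rewrite {1}/simplex_coord /= mxE cl.
have [-> | ->] : j = ord0 \/ j = ord_max.
  by case: j => [[|[|j]] //= lj]; [left | right]; apply: val_inj.
  by rewrite eqxx simplex1_coord.
by [].
Qed.

Lemma edge_coord t : 0 <= t <= 1 -> simplex_coord ord_max (edge t) = t.
Proof. by move=> t01; rewrite /simplex_coord /= mxE /= clampE. Qed.
End Paths.

Section ChainClasses.
Context {R : realType} {X : topologicalType}.

Definition boundaries1 : {pred singular_chains R X 1} :=
  fun x => `[< exists w, singular_diff R X 1 w = x >].

Lemma boundaries1_zmod : zmod_closed boundaries1.
Proof.
split=> [|x y]; rewrite !unfold_in.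
  by apply/asboolP; exists 0; rewrite raddf0.
move=> /asboolP[v dv] /asboolP[w dw]; apply/asboolP; exists (v - w).
by rewrite raddfB dv dw.
Qed.
HB.instance Definition _ := GRing.isZmodClosed.Build (singular_chains R X 1)
  boundaries1 boundaries1_zmod.

(* Working modulo boundaries on all 1-chains, not only on cycles, gives classes
   to open paths. *)
Definition chain_classes := Quotient.quot boundaries1.
HB.instance Definition _ := GRing.Zmodule.on chain_classes.

Definition chain_class : {additive singular_chains R X 1 -> chain_classes} :=
  \pi_(Quotient.quot boundaries1).

Lemma chain_class_eq0 x :
  chain_class x = 0 <-> exists w, singular_diff R X 1 w = x.
Proof.
rewrite -(raddf0 chain_class).
have E : (chain_class x == chain_class 0) = (x \in boundaries1).
  by rewrite -[in RHS](subr0 x) Quotient.idealrBE.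
split=> [/eqP|xb]; first by rewrite E unfold_in => /asboolP.
by apply/eqP; rewrite E unfold_in; apply/asboolP.
Qed.

Lemma chain_class_boundary w : chain_class (singular_diff R X 1 w) = 0.
Proof. by apply/chain_class_eq0; exists w. Qed.

Lemma on_edge_continuous (gamma : R -> X) : continuous gamma ->
  continuous (fun x : simplex (R := R) (n := 1) => gamma (simplex_coord ord_max x)).
Proof.
move=> cg x; apply: (@continuous_comp _ _ _ (simplex_coord ord_max) gamma).
  exact: simplex_coord_continuous.
exact: cg.
Qed.

Definition path_simplex (gamma : R -> X) (cg : continuous gamma) :
  singular_simplex R X 1 := mkcts (on_edge_continuous cg).

(** Total, with value 0 on discontinuous maps, so that a path can be rewritten without transporting
    a continuity proof. *)
Definition path_class (gamma : R -> X) : chain_classes :=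
  if pselect (continuous gamma) is left cg
  then chain_class (monalg.mkmalgU (path_simplex cg) 1) else 0.

Lemma path_classE gamma (cg : continuous gamma) :
  path_class gamma = chain_class (monalg.mkmalgU (path_simplex cg) 1).
Proof.
rewrite /path_class; case: pselect => // cg'; congr (chain_class (monalg.mkmalgU _ 1)).
exact/continuousEP.
Qed.

Lemma eq_path_class (gamma delta : R -> X) : continuous gamma -> continuous delta ->
  (forall t, 0 <= t <= 1 -> gamma t = delta t) ->
  path_class gamma = path_class delta.
Proof.
move=> cg cd gd; rewrite (path_classE cg) (path_classE cd).
congr (chain_class (monalg.mkmalgU _ 1)); apply/continuousEP => x.
by apply: gd; rewrite simplex_coord_ge0 simplex_coord_le1.
Qed.

Definition segment_path (A B : R * R) (t : R) : R * R := (1 - t) *: A + t *: B.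

Lemma segment_path_continuous A B : continuous (segment_path A B).
Proof.
move=> t; apply: cvgD; apply: cvgZr_tmp; last exact: cvg_id.
by apply: cvgB; [exact: cvg_cst | exact: cvg_id].
Qed.

Section Triangle.
Variables (h : R * R -> X) (ch : continuous h) (P : 'I_3 -> R * R).

Definition triangle_map (x : simplex (R := R) (n := 2)) : X :=
  h (\sum_j simplex_coord j x *: P j).

Lemma triangle_map_continuous : continuous triangle_map.
Proof.
move=> x; apply: (@continuous_comp _ _ _
  (fun x : simplex (R := R) (n := 2) => \sum_j simplex_coord j x *: P j) h);
  last exact: ch.
apply: (@continuous_big _ _ _ _ _ add_continuous) => j _ y; apply: cvgZr_tmp.
  exact: (@nbhs_filter (simplex (R := R) (n := 2)) y).
exact: simplex_coord_continuous.
Qed.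

Let tau : singular_simplex R X 2 := mkcts triangle_map_continuous.

Lemma triangle_face (i : 'I_3) :
  chain_class (monalg.mkmalgU (singular_face i tau) 1) =
  path_class (h \o segment_path (P (lift i ord0)) (P (lift i ord_max))).
Proof.
have cg : continuous (h \o segment_path (P (lift i ord0)) (P (lift i ord_max))).
  move=> t; apply: continuous_comp; [exact: segment_path_continuous|exact: ch].
rewrite (path_classE cg); congr (chain_class (monalg.mkmalgU _ 1)).
apply/continuousEP => x /=; rewrite /triangle_map /segment_path; congr (h _).
rewrite (bigD1_ord i) //= {1}/simplex_coord /= mxE unlift_none scale0r add0r.
rewrite big_ord_recl big_ord1 /simplex_coord /= !mxE !liftK.
have := simplex1_coord x; rewrite /simplex_coord => <-.
by rewrite (_ : lift ord0 ord0 = ord_max) //; exact: val_inj.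
Qed.

Lemma triangle_class :
  path_class (h \o segment_path (P ord0) (P (lift ord0 ord0))) +
  path_class (h \o segment_path (P (lift ord0 ord0)) (P ord_max)) =
  path_class (h \o segment_path (P ord0) (P ord_max)).
Proof.
have := chain_class_boundary (monalg.mkmalgU tau 1).
rewrite raddf_sum /= !big_ord_recl big_ord0 addr0 !raddfMz.
rewrite !chains_mapU /= expr0 mulr1z expr1 mulrN1z expr2 mulrNN mulr1 mulr1z.
rewrite !triangle_face.
have [E0 E1] : lift ord0 (ord_max : 'I_2) = ord_max :> 'I_3 /\
  lift (lift ord0 (ord0 : 'I_2)) ord_max = ord_max :> 'I_3 by split; apply: val_inj.
have [E2 E3] : lift (lift ord0 (lift ord0 ord0)) (ord0 : 'I_2) = ord0 :> 'I_3 /\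
  lift (lift ord0 (lift ord0 ord0)) (ord_max : 'I_2) = lift ord0 ord0 :> 'I_3.
  by split; apply: val_inj.
have E4 : lift (lift ord0 (ord0 : 'I_2)) (ord0 : 'I_2) = ord0 :> 'I_3 by apply: val_inj.
rewrite E0 E1 E2 E3 E4 => /eqP; rewrite addrCA addrC subr_eq0 => /eqP <-.
by rewrite addrC.
Qed.
End Triangle.
End ChainClasses.

Section PathCalculus.
Context {R : realType} {X : topologicalType}.
Implicit Types (gamma : R -> X) (h : R * R -> X).

Lemma path_class_triangle h (A B C : R * R) : continuous h ->
  path_class (h \o segment_path A B) + path_class (h \o segment_path B C) =
  path_class (h \o segment_path A C).
Proof.
move=> ch.
by have := triangle_class ch (fun i : 'I_3 => if i == 0%N :> nat then A
  else if i == 1%N :> nat then B else C).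
Qed.

Lemma path_class_const (x : X) : path_class (fun=> x : X) = 0 :> @chain_classes R X.
Proof.
have E := @path_class_triangle (fun=> x) 0 0 0 (fun y => cvg_cst x).
by apply: (@addrI _ (path_class (fun=> x))); rewrite addr0; exact: E.
Qed.

(** Both sides are the class of the diagonal, by two triangles. Every homotopy below enters through
    this identity, which keeps the traces of the end points. *)
Lemma path_class_square h : continuous h ->
  path_class (fun t => h (0, t)) + path_class (fun u => h (u, 1)) =
  path_class (fun u => h (u, 0)) + path_class (fun t => h (1, t)).
Proof.
move=> ch.
have E00 : (fun t => h (0, t)) = h \o segment_path (0, 0) (0, 1).
  by apply/funext => t /=; congr (h (_, _)) => /=; rewrite /GRing.scale /=; ring.
have E01 : (fun t => h (t, 1)) = h \o segment_path (0, 1) (1, 1).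
  by apply/funext => t /=; congr (h (_, _)) => /=; rewrite /GRing.scale /=; ring.
have E10 : (fun t => h (t, 0)) = h \o segment_path (0, 0) (1, 0).
  by apply/funext => t /=; congr (h (_, _)) => /=; rewrite /GRing.scale /=; ring.
have E11 : (fun t => h (1, t)) = h \o segment_path (1, 0) (1, 1).
  by apply/funext => t /=; congr (h (_, _)) => /=; rewrite /GRing.scale /=; ring.
by rewrite E00 E01 E10 E11 !path_class_triangle.
Qed.

Definition subpath gamma (a b t : R) : X := gamma (a + (b - a) * t).

Lemma subpath_continuous gamma a b : continuous gamma ->
  continuous (subpath gamma a b).
Proof.
move=> cg t; apply: (@continuous_comp _ _ _ (fun t : R => a + (b - a) * t)).
  by apply: cvgD; [exact: cvg_cst | apply: cvgMl_tmp; exact: cvg_id].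
exact: cg.
Qed.

Lemma subpath01 gamma : subpath gamma 0 1 = gamma.
Proof. by apply/funext => t; rewrite /subpath subr0 mul1r add0r. Qed.

(** A degenerate triangle, with its three vertices on one line. *)
Lemma path_class_cat gamma a b c : continuous gamma ->
  path_class (subpath gamma a b) + path_class (subpath gamma b c) =
  path_class (subpath gamma a c).
Proof.
move=> cg; have E x y : subpath gamma x y =
    (gamma \o fst) \o segment_path (x, 0) (y, 0).
  by apply/funext => t; congr gamma => /=; rewrite /GRing.scale /=; ring.
rewrite !E path_class_triangle // => p.
by apply: continuous_comp; [exact: cvg_fst | exact: cg].
Qed.

Lemma path_class_sum gamma (N : nat) : continuous gamma -> (0 < N)%N ->
  path_class gamma =
  \sum_(0 <= i < N) path_class (subpath gamma (i%:R / N%:R) (i.+1%:R / N%:R)).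
Proof.
move=> cg N0.
have H m : \sum_(0 <= i < m)
      path_class (subpath gamma (i%:R / N%:R) (i.+1%:R / N%:R)) =
    path_class (subpath gamma 0 (m%:R / N%:R)).
  elim: m => [|m IH]; last by rewrite big_nat_recr //= IH path_class_cat.
  rewrite big_geq // mul0r -[LHS](path_class_const (gamma 0)).
  by congr path_class; apply/funext => t; rewrite /subpath subrr mul0r addr0.
by rewrite H divff ?subpath01 // pnatr_eq0 -lt0n.
Qed.

Definition simplex_path (s : singular_simplex R X 1) : R -> X := s \o edge.

Lemma simplex_path_continuous s : continuous (simplex_path s).
Proof.
move=> t; apply: continuous_comp; first exact: edge_continuous.
exact: cts_fun.
Qed.

Lemma chain_class_simplex (s : singular_simplex R X 1) :
  chain_class (monalg.mkmalgU s 1) = path_class (simplex_path s).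
Proof.
rewrite (path_classE (@simplex_path_continuous s)).
congr (chain_class (monalg.mkmalgU _ 1)); apply/continuousEP => x.
exact: (congr1 s (esym (edgeK x))).
Qed.

Lemma path_simplexK gamma (cg : continuous gamma) t : 0 <= t <= 1 ->
  simplex_path (path_simplex cg) t = gamma t.
Proof. by move=> t01; exact: (congr1 gamma (edge_coord t01)). Qed.

(** The difference of F and G is the coboundary of [theta], so it factors through the differential.
    This allows homomorphisms on H_1 to be compared one open path at a time. *)
Lemma eq_on_cycles (V : zmodType) (F G : {additive singular_chains R X 1 -> V})
    (theta : X -> V) :
  (forall s, F (monalg.mkmalgU s 1) - G (monalg.mkmalgU s 1) =
     theta (simplex_path s 1) - theta (simplex_path s 0)) ->
  forall x, singular_diff R X 0 x = 0 -> F x = G x.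
Proof.
move=> FG x dx.
have ones : simplex (R := R) (n := 0) (const_mx 1).
  by split=> [j|]; rewrite ?big_ord1 mxE ?ler01.
pose vertex : simplex (R := R) (n := 0) := exist _ (const_mx 1) (mem_set ones).
pose Th : {additive singular_chains R X 0 -> V} :=
  chains_sum (fun s : singular_simplex R X 0 => theta (s vertex)).
apply/eqP; rewrite -subr_eq0; apply/eqP.
pose FG' : {additive singular_chains R X 1 -> V} := F \- G.
rewrite -[LHS]/(FG' x) (@chains_eq1 _ V FG' (Th \o singular_diff R X 0)) => [|s].
  by rewrite /= dx raddf0.
(* Face 0 omits the initial vertex, so it is the end point t = 1, and face 1 is t = 0. *)
have E (i : 'I_2) : edge (i == ord0)%:R = face_inclusion i vertex.
  apply: simplex_eq => j; rewrite /simplex_coord /= !mxE clampE; last first.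
    by case: (i == ord0); rewrite lexx ler01.
  case: unliftP => [l|] ->; rewrite ?mxE ?(ord1 l);
    by case: i => [[|[|i]] //= li]; rewrite /= ?subrr ?subr0.
have D : singular_diff R X 0 (monalg.mkmalgU s 1) =
    monalg.mkmalgU (singular_face ord0 s) 1 -
    monalg.mkmalgU (singular_face (lift ord0 ord0) s) 1.
  rewrite /= /alternating_sum /= !big_ord_recl big_ord0 addr0.
  by rewrite !chains_mapU /= expr0 mulr1z expr1 mulrN1z.
rewrite [LHS]FG [RHS]/= D raddfB /= !chains_sumU /simplex_path.
by congr (theta _ - theta _); [have := E ord0 | have := E (lift ord0 ord0)];
  rewrite /= => ->.
Qed.
End PathCalculus.

Section H1Classes.
Context {R : realType} {X : topologicalType}.

Definition H1_chain_class (a : singular_homology R X 1) : @chain_classes R X :=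
  chain_class (val (repr a)).

Lemma H1_chain_classE (z : cycles (singular_diff R X) 1) :
  H1_chain_class (homology_class 1 z) = chain_class (val z).
Proof.
apply/eqP; rewrite -subr_eq0 -raddfB; apply/eqP/chain_class_eq0.
have /homology_class_eq0[w dw] : homology_class 1
    (repr (homology_class 1 z : homology (singular_diff R X) 1) - z) = 0.
  by rewrite raddfB homology_class_repr subrr.
by exists w; rewrite dw raddfB.
Qed.

Lemma H1_chain_class_additive : zmod_morphism H1_chain_class.
Proof.
move=> x y; rewrite -[x]homology_class_repr -[y]homology_class_repr -raddfB.
by rewrite !H1_chain_classE raddfB.
Qed.
HB.instance Definition _ := GRing.isZmodMorphism.Build
  (singular_homology R X 1) (@chain_classes R X) H1_chain_class H1_chain_class_additive.

(** Identities in H_1 can thus be proved among classes of chains that need not be cycles. *)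
Lemma H1_chain_class_inj : injective H1_chain_class.
Proof.
move=> x y xy; apply/eqP; rewrite -subr_eq0 -[x]homology_class_repr -[y]homology_class_repr.
rewrite -raddfB; apply/eqP/homology_class_eq0/chain_class_eq0.
rewrite -[val _]/(val (repr x) - val (repr y)) raddfB; apply/eqP.
by rewrite subr_eq0; apply/eqP.
Qed.

Lemma cycle_diff (z : cycles (singular_diff R X) 1) : singular_diff R X 0 (val z) = 0.
Proof. by apply/eqP; exact: (valP z). Qed.

Section Loop.
Variables (gamma : R -> X) (cg : continuous gamma) (loop : gamma 0 = gamma 1).

Lemma loop_is_cycle :
  monalg.mkmalgU (path_simplex cg) 1 \in @is_cycle _ (singular_diff R X) 1.
Proof.
rewrite unfold_in; apply/eqP; rewrite /= /alternating_sum /= !big_ord_recl big_ord0.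
rewrite addr0 !chains_mapU /= expr0 mulr1z expr1 mulrN1z; apply/eqP.
rewrite subr_eq0; apply/eqP; congr (monalg.mkmalgU _ _); apply/continuousEP => x.
have x1 : (\val x) ord0 ord0 = 1.
  by have [_] := set_mem (valP x); rewrite big_ord1.
rewrite -[LHS]/(gamma (insert0 ord0 (\val x) ord0 ord_max)).
rewrite -[RHS]/(gamma (insert0 (lift ord0 ord0) (\val x) ord0 ord_max)).
rewrite !mxE (_ : ord_max = lift ord0 ord0); last exact: val_inj.
by rewrite liftK unlift_none x1 loop.
Qed.

Definition loop_class : singular_homology R X 1 :=
  homology_class 1 (exist (fun c => c \in @is_cycle _ (singular_diff R X) 1) _ loop_is_cycle).

Lemma H1_loop_class : H1_chain_class loop_class = path_class gamma.
Proof. by rewrite H1_chain_classE (path_classE cg). Qed.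
End Loop.
End H1Classes.

Section Pushforward.
Context {R : realType} {X Y : topologicalType}.

Lemma H1_pushforwardE (f : continuousType X Y) (z : cycles (singular_diff R X) 1) :
  H1_chain_class (homology_pushforward R f 1 (homology_class 1 z)) =
  chain_class (chain_pushforward R f 1 (val z)).
Proof.
have -> : homology_pushforward R f 1 (homology_class 1 z) = homology_class 1
    (Defs.cycle_map (@chain_pushforward_diff R X Y f) z).
  exact: homology_map_pi.
by rewrite H1_chain_classE.
Qed.

Lemma chain_pushforward_simplex (f : continuousType X Y) (s : singular_simplex R X 1) :
  chain_class (chain_pushforward R f 1 (monalg.mkmalgU s 1)) =
  path_class (f \o simplex_path s).
Proof. by rewrite /= chains_mapU chain_class_simplex. Qed.

(** On a simplex s the square (u, t) -> h (u, s t) expresses the difference of the two images by the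
    tracks of the end points of s under h, which cancel on cycles. *)
Lemma homotopic_pushforward (f g : continuousType X Y) (h : R * X -> Y) :
  continuous h -> (forall x, h (0, x) = f x) -> (forall x, h (1, x) = g x) ->
  homology_pushforward R f 1 =1 homology_pushforward R g 1.
Proof.
move=> ch h0 h1 a; apply: H1_chain_class_inj; rewrite -[a]homology_class_repr.
rewrite !H1_pushforwardE.
apply: (@eq_on_cycles R X _ (chain_class \o chain_pushforward R f 1)
  (chain_class \o chain_pushforward R g 1)
  (fun x => - path_class (fun u => h (u, x)))); last exact: cycle_diff.
move=> s /=; rewrite !chain_pushforward_simplex.
have ch' : continuous (fun p : R * R => h (p.1, simplex_path s p.2)).
  move=> p; apply: (@continuous_comp _ _ _ (fun p : R * R => (p.1, simplex_path s p.2)) h);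
    last exact: ch.
  apply: continuous_pair; first exact: cvg_fst.
  apply: (@continuous_comp _ _ _ snd (simplex_path s)); first exact: cvg_snd.
  exact: simplex_path_continuous.
have := path_class_square ch' => /=.
under [in X in path_class X + _]eq_fun do rewrite h0.
under [in X in _ = _ + path_class X]eq_fun do rewrite h1.
move=> /(canRL (addrK _)) ->.
by rewrite opprK addrAC addrK addrC.
Qed.
End Pushforward.

(** * Degrees of maps to the circle *)

Section CircleValued.
Context {R : realType}.
Local Notation int_num := (@Num.int R).

(* Continuity of the class of f in R/Z. *)
Definition circle_continuous (T : topologicalType) (f : T -> R) :=
  forall x e, 0 < e -> \forall y \near x,
    exists2 m : R, m \is a Num.int & `|f y - f x - m| < e.

Lemma circle_continuous_comp (T U : topologicalType) (f : U -> R) (p : T -> U) :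
  circle_continuous f -> continuous p -> circle_continuous (f \o p).
Proof. by move=> cf cp x e e0; exact: cp x _ (cf (p x) e e0). Qed.

Lemma circle_continuousB (T : topologicalType) (f g : T -> R) :
  circle_continuous f -> circle_continuous g -> circle_continuous (f \- g).
Proof.
move=> cf cg x e e0; have e2 : 0 < e / 2 by rewrite divr_gt0.
apply: filterS2 (cf x _ e2) (cg x _ e2) => y [m mi fm] [n ni gn].
exists (m - n); first exact: rpredB.
rewrite /= (_ : _ - _ - _ = (f y - f x - m) - (g y - g x - n)); last by ring.
by rewrite (le_lt_trans (ler_normB _ _)) // (splitr e) ltrD.
Qed.

Definition centered_frac (u : R) : R := u - (Num.floor (u + 2^-1))%:~R.

Lemma centered_frac_int u : centered_frac u - u \is a Num.int.
Proof. by rewrite /centered_frac addrAC subrr add0r rpredN; apply/intrP; eexists. Qed.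

Lemma centered_fracE u m : m \is a Num.int -> `|u - m| < 2^-1 ->
  centered_frac u = u - m.
Proof.
case/intrP => n ->; rewrite ltr_norml => /andP[l r].
rewrite /centered_frac (@floor_def _ _ n) // rmorphD /=; apply/andP; split; lra.
Qed.

(** The jumps of [centered_frac] are at the half-integers. [G] stays within 1/4 of the integers, and
    moving it by less than 1/4 more does not reach a jump. *)
Lemma centered_frac_continuous (T : topologicalType) (G : T -> R) :
  circle_continuous G ->
  (forall x, exists2 m : R, m \is a Num.int & `|G x - m| < 4^-1) ->
  continuous (centered_frac \o G).
Proof.
move=> cG G4 x; apply/cvgrPdist_lt => e e0 /=; have [m mi Gm] := G4 x.
have e4 : 0 < Num.min e 4^-1 by rewrite lt_min e0 invr_gt0 ltr0n.
apply: filterS (cG x _ e4) => y [n ni]; rewrite lt_min => /andP[Gn1 Gn2].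
rewrite (centered_fracE mi); last by apply: (lt_trans Gm); lra.
rewrite (@centered_fracE _ (m + n)) ?rpredD //; last first.
  rewrite (_ : _ - _ = (G y - G x - n) + (G x - m)); last by ring.
  by apply: (le_lt_trans (ler_normD _ _)); lra.
by rewrite (_ : _ - _ = - (G y - G x - n)) ?normrN //; ring.
Qed.

Definition unit_square : set (R * R) := `[0, 1] `*` `[0, 1].

Lemma lebesgue_number (M : pseudoMetricType R) (K : set M) (U : M -> set M) :
  compact K -> (forall x, K x -> nbhs x (U x)) ->
  exists2 d : R, 0 < d & forall x, K x -> exists z, ball x d `<=` U z.
Proof.
move=> cK nU; pose P (d : R) x := exists z, ball x d `<=` U z.
have H : \forall d \near 0^'+, K `<=` P d.
  move/compact_near_coveringP : cK; apply => x Kx.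
  have /nbhs_ballP[r /= r0 xr] := nU x Kx.
  have r2 : 0 < r / 2 by rewrite divr_gt0.
  exists (ball x (r / 2), [set d : R | d < r / 2]).
    by split; [exact: nbhsx_ballx | exact: nbhs_right_lt].
  move=> [x' d] /= [xx' dr]; exists x => y x'y; apply: xr.
  by apply: (ball_split xx'); apply: le_ball x'y; exact: ltW.
have [d [d0 Pd]] : exists d, 0 < d /\ K `<=` P d.
  near (0 : R)^'+ => d; exists d; split; first by near: d; exact: nbhs_right_gt.
  by near: d.
by exists d.
Unshelve. all: by end_near.
Qed.

Lemma circle_uniform (F : R * R -> R) : circle_continuous F ->
  exists2 d, 0 < d & forall x y, unit_square x -> ball x d y ->
    exists2 m : R, m \is a Num.int & `|F y - F x - m| < 4^-1.
Proof.
move=> cF; have K : compact unit_square.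
  by apply: compact_setX; exact: segment_compact.
have e8 : 0 < 8^-1 :> R by rewrite invr_gt0 ltr0n.
have [d d0 dU] := lebesgue_number K (fun x _ => cF x _ e8).
exists d => // x y /dU[z zU] xy.
have [m mi xm] := zU _ (ballxx x d0); have [n ni yn] := zU _ xy.
exists (n - m); first exact: rpredB.
rewrite (_ : _ - _ - _ = (F y - F z - n) - (F x - F z - m)); last by ring.
by rewrite (le_lt_trans (ler_normB _ _)) //; lra.
Qed.

Lemma segment_uniform (L : R -> R) (e : R) : continuous L -> 0 < e ->
  exists2 d, 0 < d & forall t t', 0 <= t <= 1 -> `|t - t'| < d -> `|L t - L t'| < e.
Proof.
move=> cL e0; have e2 : 0 < e / 2 by rewrite divr_gt0.
have nU (x : R) : [set` `[0, 1]] x -> nbhs x [set y | `|L x - L y| < e / 2].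
  by move=> _; have /cvgrPdist_lt := cL x; apply.
have [d d0 dU] := lebesgue_number (@segment_compact R 0 1) nU.
exists d => // t t' t01 tt'; have [|z zU] := dU t; first by rewrite /= in_itv.
have /= zt := zU _ (ballxx t d0); have /= zt' := zU t' tt'.
rewrite (_ : _ - _ = (L z - L t') - (L z - L t)); last by ring.
by rewrite (le_lt_trans (ler_normB _ _)) // (splitr e) ltrD.
Qed.

Definition clamp2 (x : R * R) : R * R := (clamp x.1, clamp x.2).

Lemma clamp2_continuous : continuous clamp2.
Proof.
move=> x; apply: (@continuous_pair _ _ _ (clamp \o fst) (clamp \o snd)).
  by apply: (@continuous_comp _ _ _ fst clamp); [exact: cvg_fst | exact: clamp_continuous].
by apply: (@continuous_comp _ _ _ snd clamp); [exact: cvg_snd | exact: clamp_continuous].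
Qed.

Lemma clamp2E x : unit_square x -> clamp2 x = x.
Proof.
by case: x => a b [] /=; rewrite !in_itv /= => a01 b01; rewrite /clamp2 /= !clampE.
Qed.

(* The lift is x |-> \sum_i r (F ((i+1)/N x) - F (i/N x)) with r the
   representative of a class of R/Z near 0 and N large. *)
Lemma circle_lift (F : R * R -> R) : circle_continuous F ->
  exists2 L : R * R -> R, continuous L &
    forall x, unit_square x -> L x - F x \is a Num.int.
Proof.
move=> cF; have [d d0 unif] := circle_uniform cF.
pose N := (Num.truncn d^-1).+1; have N0 : 0 < N%:R :> R by rewrite ltr0n.
have Nd : N%:R^-1 < d.
  by rewrite -[d]invrK ltf_pV2 ?posrE ?invr_gt0 //; exact: truncnS_gt.
(* Subdivision points of the segment from 0 to x. Since N > 1/d, consecutive ones are at distance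
   less than d once x is clamped to the square, which also makes the lift continuous on the whole
   plane. *)
pose p i x : R * R := (i%:R / N%:R : R) *: clamp2 x.
have cp i : continuous (p i).
  by move=> x; apply: cvgZl_tmp; exact: clamp2_continuous.
pose G i x := F (p i.+1 x) - F (p i x).
have cG i : circle_continuous (G i).
  by apply: circle_continuousB; apply: circle_continuous_comp.
have G4 i x : (i < N)%N -> exists2 m : R, m \is a Num.int & `|G i x - m| < 4^-1.
  move=> iN; apply: unif; rewrite /p.
    have i01 : 0 <= (i%:R / N%:R : R) <= 1.
      by rewrite divr_ge0 //= ler_pdivrMr // mul1r ler_nat ltnW.
    case/andP: i01 => i0 i1.
    by split; rewrite /= in_itv /=; apply/andP; split;
      (apply: mulr_ge0 || apply: mulr_ile1); rewrite ?clamp_ge0 ?clamp_le1.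
  have B (c : R) : 0 <= c <= 1 ->
      ball (i%:R / N%:R * c : R) d (i.+1%:R / N%:R * c : R).
    move=> /andP[c0 c1]; rewrite /ball /= -natr1 -mulrBl -mulrBl opprD addNKr.
    rewrite mulN1r mulNr normrN ger0_norm; last by rewrite mulr_ge0 // invr_ge0 ltW.
    by apply: le_lt_trans Nd; rewrite ler_piMr // invr_ge0 ltW.
  by split; apply: B; rewrite clamp_ge0 clamp_le1.
exists (fun x => \sum_(0 <= i < N) centered_frac (G i x) + F 0).
  move=> x; apply: cvgD; last exact: cvg_cst.
  rewrite big_mkord; under eq_cvg do rewrite big_mkord.
  apply: (cvg_big add_continuous) => i _.
  by apply: centered_frac_continuous => // y; exact: G4.
move=> x /clamp2E xE.
have -> : F x = \sum_(0 <= i < N) G i x + F 0.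
  rewrite (telescope_sumr (fun i => F (p i x))) // /p divff ?gt_eqF // scale1r xE.
  by rewrite mul0r scale0r subrK.
rewrite opprD addrACA subrr addr0 -sumrB; apply: rpred_sum => i _.
exact: centered_frac_int.
Qed.
End CircleValued.

Section Winding.
Context {R : realType}.

(** Otherwise the intermediate value theorem would produce a value in 1/2 + Z. *)
Lemma int_valued_constant (D : R -> R) : {within `[0, 1], continuous D} ->
  (forall t, 0 <= t <= 1 -> D t \is a Num.int) -> D 1 = D 0.
Proof.
move=> cD iD; have half_int (m n : R) : m \is a Num.int -> n \is a Num.int ->
    m = n + 2^-1 -> False.
  case/intrP => a -> /intrP[b ->] E.
  have /intr_inj : ((a * 2)%:~R = (b * 2 + 1)%:~R :> R).
    by rewrite rmorphD !rmorphM /= E; lra.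
  lia.
have D0 : D 0 \is a Num.int by apply: iD; rewrite lexx ler01.
have D1 : D 1 \is a Num.int by apply: iD; rewrite lexx ler01.
have step (a b : R) : a \is a Num.int -> b \is a Num.int -> a < b -> a + 1 <= b.
  move=> /intrP[m ->] /intrP[n ->]; rewrite ltr_int => mn.
  by rewrite -[1]/(1%:~R) -rmorphD ler_int; lia.
case: (ltgtP (D 0) (D 1)) => // lt01; exfalso.
- have := step _ _ D0 D1 lt01 => le1.
  have [|c] := IVT (ler01) cD (v := D 0 + 2^-1).
    by rewrite ge_min le_max; apply/andP; split; apply/orP; [left | right]; lra.
  by rewrite in_itv /= => c01 /half_int; apply => //; exact: iD.
- have := step _ _ D1 D0 lt01 => le1.
  have [|c] := IVT (ler01) cD (v := D 1 + 2^-1).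
    by rewrite ge_min le_max; apply/andP; split; apply/orP; [right | left]; lra.
  by rewrite in_itv /= => c01 /half_int; apply => //; exact: iD.
Qed.

Context {X : topologicalType} (f : X -> R) (cf : circle_continuous f).

(** Continuity is required only within the interval: the explicit lift in [wind_crossing] jumps at
    both ends when seen on the whole line. *)
Definition is_lift (gamma : R -> X) (L : R -> R) :=
  {within `[0, 1], continuous L} /\
  forall t, 0 <= t <= 1 -> L t - f (gamma t) \is a Num.int.

Lemma lift_exists gamma : continuous gamma ->
  exists2 L : R -> R, continuous L & is_lift gamma L.
Proof.
move=> cg; have cF : circle_continuous (fun p : R * R => f (gamma p.1)).
  apply: (circle_continuous_comp cf) => p.
  by apply: (@continuous_comp _ _ _ fst); [exact: cvg_fst | exact: cg].
have [L cL iL] := circle_lift cF.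
have cL0 : continuous (fun t => L (t, 0)).
  move=> t; apply: (@continuous_comp _ _ _ (fun t : R => (t, 0 : R)) L); last exact: cL.
  by apply: (@continuous_pair _ _ _ id (fun=> 0 : R)); [exact: cvg_id | exact: cvg_cst].
exists (fun t => L (t, 0)) => //; split; first exact: continuous_subspaceT.
by move=> t t01; apply: (iL (t, 0)); split; rewrite /= in_itv //= lexx ler01.
Qed.

(* The variation of a lift of f along gamma, corrected by the values of f at
   the end points so as to be an integer also on open paths. *)
Definition wind (gamma : R -> X) : int :=
  if pselect (exists L, is_lift gamma L) is left h
  then let L := projT1 (cid h) in
    Num.floor ((L 1 - L 0) - (f (gamma 1) - f (gamma 0)))
  else 0.

Lemma wind_lift gamma L : is_lift gamma L ->
  (wind gamma)%:~R = (L 1 - L 0) - (f (gamma 1) - f (gamma 0)).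
Proof.
move=> [cL iL]; rewrite /wind; case: pselect => [h|[]]; last by exists L.
case: (cid h) => K [cK iK] /=.
have -> : K 1 - K 0 = L 1 - L 0.
  have : (K \- L) 1 = (K \- L) 0.
    apply: int_valued_constant => [|t t01].
      by move=> t; apply: cvgB; [exact: cK | exact: cL].
    rewrite /= (_ : _ - _ = (K t - f (gamma t)) - (L t - f (gamma t))); last by ring.
    by rewrite rpredB ?iK ?iL.
  by rewrite /= => /eqP; rewrite subr_eq => /eqP ->; ring.
rewrite floorK // (_ : _ - _ = (L 1 - f (gamma 1)) - (L 0 - f (gamma 0))); last by ring.
by apply: rpredB; apply: iL; rewrite lexx ler01.
Qed.

Lemma eq_wind (gamma delta : R -> X) : continuous gamma ->
  (forall t, 0 <= t <= 1 -> gamma t = delta t) -> wind gamma = wind delta.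
Proof.
move=> cg gd; have [L _ lL] := lift_exists cg.
have lL' : is_lift delta L.
  by case: lL => cL iL; split=> // t t01; rewrite -gd ?iL.
apply: (@intr_inj R); rewrite (wind_lift lL) (wind_lift lL').
by rewrite !gd ?lexx ?ler01.
Qed.

Definition wind_chain : {additive singular_chains R X 1 -> int} :=
  chains_sum (fun s => wind (simplex_path s)).

Lemma wind_chainU s : wind_chain (monalg.mkmalgU s 1) = wind (simplex_path s).
Proof. exact: chains_sumU. Qed.

Section Triangle.

(** The square mapped onto the triangle with the side u = 0 collapsed to vertex 0, so that lifts
    over the square serve for 2-simplices. The other three sides become the three faces. *)
Definition triangle_row (p : R * R) : 'rV[R]_3 :=
  let u := clamp p.1 in let v := clamp p.2 in
  \row_j (if j == 0%N :> nat then 1 - u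
          else if j == 1%N :> nat then u * (1 - v) else u * v).

Lemma triangle_row_simplex p : simplex (R := R) (n := 2) (triangle_row p).
Proof.
have [u0 u1 v0 v1] := And4 (clamp_ge0 p.1) (clamp_le1 p.1) (clamp_ge0 p.2) (clamp_le1 p.2).
split=> [j|]; last by rewrite !big_ord_recl big_ord0 !mxE /=; ring.
by rewrite mxE; case: ifP => _; last case: ifP => _; rewrite ?mulr_ge0 ?subr_ge0.
Qed.

Definition triangle_point (p : R * R) : simplex (R := R) (n := 2) :=
  exist _ (triangle_row p) (mem_set (triangle_row_simplex p)).

Lemma triangle_point_continuous : continuous triangle_point.
Proof.
have c1 : continuous (fun p : R * R => clamp p.1).
  move=> p; apply: (@continuous_comp _ _ _ fst clamp); first exact: cvg_fst.
  exact: clamp_continuous.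
have c2 : continuous (fun p : R * R => clamp p.2).
  move=> p; apply: (@continuous_comp _ _ _ snd clamp); first exact: cvg_snd.
  exact: clamp_continuous.
apply: continuous_to_simplex => j p.
have -> : (fun p => simplex_coord j (triangle_point p)) = (fun p =>
   if j == 0%N :> nat then 1 - clamp p.1
   else if j == 1%N :> nat then clamp p.1 * (1 - clamp p.2) else clamp p.1 * clamp p.2).
  by apply/funext => q; rewrite /simplex_coord /= mxE.
case: (boolP (j == 0%N :> nat)) => _; first by apply: cvgB; [exact: cvg_cst | exact: c1].
case: (boolP (j == 1%N :> nat)) => _; apply: cvgM; [exact: c1 | | exact: c1 | exact: c2].
by apply: cvgB; [exact: cvg_cst | exact: c2].
Qed.

Lemma face_edge t : 0 <= t <= 1 ->
  [/\ face_inclusion (ord0 : 'I_3) (edge t) = triangle_point (1, t),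
      face_inclusion (lift ord0 ord0 : 'I_3) (edge t) = triangle_point (t, 1) &
      face_inclusion (ord_max : 'I_3) (edge t) = triangle_point (t, 0)].
Proof.
move=> t01; have [c0 c1] : clamp (0 : R) = 0 /\ clamp (1 : R) = 1.
  by split; apply: clampE; rewrite lexx ler01.
split; apply: simplex_eq => j; rewrite /simplex_coord /= !mxE /= ?c0 ?c1 clampE //;
  case: j => [[|[|[|j]]] //= lj];
  case: unliftP => [[[|[|k]] //= lk] /(congr1 val) //= _|/(congr1 val) //= _];
  rewrite ?mxE ?clampE //=; ring.
Qed.
End Triangle.

(** A lift of f over the whole 2-simplex restricts to lifts along the three faces, whose variations
    cancel in the boundary; so do the corrections by f at the vertices. *)
Lemma wind_chain_boundary w : wind_chain (singular_diff R X 1 w) = 0.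
Proof.
apply: (@chains_eq1 _ _ (wind_chain \o singular_diff R X 1) \0) => tau /=.
have D : singular_diff R X 1 (monalg.mkmalgU tau 1) =
    monalg.mkmalgU (singular_face ord0 tau) 1 -
    monalg.mkmalgU (singular_face (lift ord0 ord0) tau) 1 +
    monalg.mkmalgU (singular_face ord_max tau) 1.
  rewrite /= /alternating_sum /= !big_ord_recl big_ord0 addr0 !chains_mapU /=.
  rewrite expr0 mulr1z expr1 mulrN1z expr2 mulrNN mulr1 mulr1z addrA.
  by rewrite (_ : lift ord0 (lift ord0 ord0) = ord_max) //; exact: val_inj.
rewrite D raddfD raddfB !wind_chainU.
have cF : circle_continuous (fun p => f (tau (triangle_point p))).
  apply: (circle_continuous_comp cf) => p.
  apply: (@continuous_comp _ _ _ triangle_point tau); last exact: cts_fun.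
  exact: triangle_point_continuous.
have [L cL iL] := circle_lift cF.
have lift_face (i : 'I_3) (q : R -> R * R) : continuous q ->
    (forall t, 0 <= t <= 1 -> unit_square (q t) /\
       face_inclusion i (edge t) = triangle_point (q t)) ->
    is_lift (simplex_path (singular_face i tau)) (L \o q).
  move=> cq qi; split.
    apply: continuous_subspaceT => t.
    by apply: continuous_comp; [exact: cq | exact: cL].
  move=> t /qi[qs qE]; have := iL _ qs; congr (_ - f _ \is a Num.int).
  by rewrite /simplex_path /= -qE.
have in1 (t : R) : 0 <= t <= 1 -> t \in `[0, 1] by rewrite in_itv.
have [z01 o01] : (0 : R) \in `[0, 1] /\ (1 : R) \in `[0, 1] by rewrite !in_itv /= !lexx !ler01.
have cpair (a b : R -> R) : continuous a -> continuous b -> continuous (fun t => (a t, b t)).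
  by move=> ca cb t; apply: continuous_pair; [exact: ca | exact: cb].
have cid : continuous (fun t : R => t) by move=> t; exact: cvg_id.
have ccst (x : R) : continuous (fun t : R => x) by move=> t; exact: cvg_cst.
have l0 := lift_face ord0 (fun t => (1, t)) (cpair _ _ (ccst _) cid)
  (fun t t01 => conj (conj o01 (in1 _ t01)) (let: And3 h _ _ := face_edge t01 in h)).
have l1 := lift_face (lift ord0 ord0) (fun t => (t, 1)) (cpair _ _ cid (ccst _))
  (fun t t01 => conj (conj (in1 _ t01) o01) (let: And3 _ h _ := face_edge t01 in h)).
have l2 := lift_face ord_max (fun t => (t, 0)) (cpair _ _ cid (ccst _))
  (fun t t01 => conj (conj (in1 _ t01) z01) (let: And3 _ _ h := face_edge t01 in h)).
(* On the collapsed side L lifts a constant, so it is itself constant. *)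
have const : L (0, 1) = L (0, 0).
  have v0 v : triangle_point (0, v) = triangle_point (0, 0).
    apply: simplex_eq => j; rewrite /simplex_coord /= !mxE /=.
    by rewrite (clampE (_ : 0 <= (0 : R) <= 1)) ?lexx ?ler01 // !mul0r.
  have := @int_valued_constant (fun v => L (0, v) - f (tau (triangle_point (0, 0)))).
  move=> /(_ _ _)/addIr; apply.
    apply: continuous_subspaceT => t; apply: cvgB; last exact: cvg_cst.
    by apply: (@continuous_comp _ _ _ (fun v : R => (0 : R, v)) L); [exact: cpair | exact: cL].
  by move=> t t01; rewrite -(v0 t); apply: (iL (0, t)); split => //; exact: in1.
apply: (@intr_inj R); rewrite rmorphD rmorphB /= (wind_lift l0) (wind_lift l1) (wind_lift l2).
rewrite /= const /simplex_path /=.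
have [] := face_edge (_ : 0 <= (0 : R) <= 1); first by rewrite lexx ler01.
move=> -> -> ->.
have [] := face_edge (_ : 0 <= (1 : R) <= 1); first by rewrite lexx ler01.
move=> -> -> ->.
have -> : triangle_point (0, 1) = triangle_point (0, 0).
  apply: simplex_eq => j; rewrite /simplex_coord /= !mxE /=.
  by rewrite (clampE (_ : 0 <= (0 : R) <= 1)) ?lexx ?ler01 // !mul0r.
ring.
Qed.

Definition wind_class (a : singular_homology R X 1) : int := wind_chain (val (repr a)).

Lemma wind_classE (z : cycles (singular_diff R X) 1) :
  wind_class (homology_class 1 z) = wind_chain (val z).
Proof.
apply/eqP; rewrite -subr_eq0 -raddfB; apply/eqP.
have /homology_class_eq0[w dw] : homology_class 1
    (repr (homology_class 1 z : homology (singular_diff R X) 1) - z) = 0.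
  by rewrite raddfB homology_class_repr subrr.
by rewrite -[X in wind_chain X]dw wind_chain_boundary.
Qed.

Lemma wind_class_additive : zmod_morphism wind_class.
Proof.
move=> x y; rewrite -[x]homology_class_repr -[y]homology_class_repr -raddfB.
by rewrite !wind_classE raddfB.
Qed.
HB.instance Definition _ := GRing.isZmodMorphism.Build
  (singular_homology R X 1) int wind_class wind_class_additive.

Lemma wind_loop (gamma : R -> X) (cg : continuous gamma) (loop : gamma 0 = gamma 1) :
  wind_class (loop_class cg loop) = wind gamma.
Proof.
rewrite wind_classE wind_chainU; apply/esym/eq_wind => // t t01.
by rewrite path_simplexK.
Qed.
End Winding.

(** * Annuli in a surface *)

Section LocalSurjectivity.
Context {R : realType}.
Implicit Types (F : R * R -> R * R) (p q x y z : R * R).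

(** The norm of [R * R] is the maximum norm, which is not differentiable; the minimisation below
    needs the Euclidean square. *)
Definition sqnorm y : R := y.1 * y.1 + y.2 * y.2.

Lemma sqnorm_continuous : continuous sqnorm.
Proof.
by move=> y; apply: cvgD; apply: cvgM;
  [exact: cvg_fst | exact: cvg_fst | exact: cvg_snd | exact: cvg_snd].
Qed.

Lemma sqnorm_gt0 y : y != 0 -> 0 < sqnorm y.
Proof.
case: y => a b; rewrite -pair_eqE negb_and /sqnorm /= => /orP[a0 | b0].
  by rewrite ltr_pwDl // -?expr2 ?exprn_even_gt0 ?sqr_ge0.
by rewrite ltr_wpDl // -?expr2 ?exprn_even_gt0 ?sqr_ge0.
Qed.

Lemma sqnormB y z : sqnorm (y - z) = sqnorm (z - y).
Proof. by rewrite /sqnorm /=; ring. Qed.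

Lemma sqnorm_triangle x y z :
  sqnorm (x - z) <= 2 * sqnorm (x - y) + 2 * sqnorm (y - z).
Proof.
rewrite /sqnorm /=; have := sqr_ge0 ((x.1 - y.1) - (y.1 - z.1)).
by have := sqr_ge0 ((x.2 - y.2) - (y.2 - z.2)); nra.
Qed.

Lemma sqnorm_lt y (e : R) : 0 < e -> `|y| < e -> sqnorm y < 2 * (e * e).
Proof.
move=> e0; rewrite prod_normE gt_max /sqnorm => /andP[y1 y2].
have H (x : R) : `|x| < e -> x * x < e * e.
  by move=> xe; rewrite -expr2 -real_normK ?num_real // expr2 ltr_pM.
by rewrite mulr_natl mulr2n ltrD ?H.
Qed.

Definition closed_square p (r : R) : set (R * R) := [set q | `|q - p| <= r].

Lemma closed_square_closed p r : closed (closed_square p r).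
Proof.
have -> : closed_square p r = (fun q => `|q - p|) @^-1` [set x : R | x <= r] by [].
apply: closed_comp => [q _|]; last exact: closed_le.
by apply: cvg_norm; apply: cvgB; [exact: cvg_id | exact: cvg_cst].
Qed.

Lemma closed_square_compact p r : compact (closed_square p r).
Proof.
apply: (@subclosed_compact _ _ (`[p.1 - r, p.1 + r] `*` `[p.2 - r, p.2 + r])).
- exact: closed_square_closed.
- by apply: compact_setX; exact: segment_compact.
move=> q; rewrite /closed_square /= prod_normE ge_max /= => /andP[q1 q2].
by split; rewrite /= in_itv /= -ler_distl.
Qed.

Lemma derive_at_min (G : R * R -> R) p v (r : R) : 0 < r ->
  (forall q, `|q - p| < r -> differentiable G q) ->
  (forall q, `|q - p| < r -> G p <= G q) -> 'D_v G p = 0.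
Proof.
move=> r0 dG minG; pose phi (t : R) := G (t *: v + p).
have [e e0 near_p] : exists2 e : R, 0 < e & forall t, -e < t < e -> `|t *: v + p - p| < r.
  exists (r / (`|v| + 1)); first by rewrite divr_gt0 // ltr_wpDl.
  move=> t; rewrite -ltr_norml addrK normrZ ltr_pdivlMr ?ltr_wpDl //.
  by apply: le_lt_trans; rewrite ler_wpM2l // lerDl.
have : is_derive (0 : R) 1 phi 0.
  apply: (@derive1_at_min _ phi (- e) e 0).
  - by rewrite ge0_cp // ltW.
  - move=> t; rewrite in_itv /= => te; apply: diff_derivable.
    apply: (@differentiable_comp _ _ _ _ (fun t : R => t *: v + p) G);
      last by apply: dG; exact: near_p.
    by apply: (@differentiableD _ _ _ (fun t : R => t *: v) (cst p)).
  - by rewrite in_itv /= oppr_lt0 e0.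
  - move=> t; rewrite in_itv /= => te; rewrite {1}/phi scale0r add0r.
    by apply: (minG (t *: v + p)); exact: near_p.
move=> [_ <-]; rewrite /derive.
have -> // : (fun h : R => h^-1 *: ((G \o shift p) (h *: v) - G p)) =
  (fun h : R => h^-1 *: ((phi \o shift 0) (h *: 1) - phi 0)).
apply/funext => h; rewrite /phi /= scale0r add0r addr0.
by rewrite [h *: 1]/GRing.scale /= mulr1.
Qed.

Lemma derive_sqnorm F p y v : differentiable F p ->
  'D_v (fun q => sqnorm (F q - y)) p =
  2 * ((F p - y).1 * ('D_v F p).1 + (F p - y).2 * ('D_v F p).2).
Proof.
move=> dF.
have cfst : continuous (fst : R * R -> R) by move=> ?; exact: cvg_fst.
have csnd : continuous (snd : R * R -> R) by move=> ?; exact: cvg_snd.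
have d1 : differentiable (fst \o F) p.
  by apply: differentiable_comp => //; exact: linear_differentiable.
have d2 : differentiable (snd \o F) p.
  by apply: differentiable_comp => //; exact: linear_differentiable.
have D1 : 'D_v (fst \o F) p = ('D_v F p).1.
  by rewrite !deriveE // diff_comp //=; [rewrite diff_lin | exact: linear_differentiable].
have D2 : 'D_v (snd \o F) p = ('D_v F p).2.
  by rewrite !deriveE // diff_comp //=; [rewrite diff_lin | exact: linear_differentiable].
pose u : R * R -> R := (fst \o F) - cst y.1; pose w : R * R -> R := (snd \o F) - cst y.2.
have du : derivable u p v by apply: derivableB; [exact: diff_derivable | exact: derivable_cst].
have dw : derivable w p v by apply: derivableB; [exact: diff_derivable | exact: derivable_cst].
have -> : (fun q => sqnorm (F q - y)) = u * u + w * w by [].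
rewrite deriveD; [|exact: derivableM|exact: derivableM].
rewrite !deriveM //.
have -> : 'D_v u p = ('D_v F p).1.
  by rewrite deriveB ?D1 ?derive_cst ?subr0 //; exact: diff_derivable.
have -> : 'D_v w p = ('D_v F p).2.
  by rewrite deriveB ?D2 ?derive_cst ?subr0 //; exact: diff_derivable.
rewrite -[u p]/((F p - y).1) -[w p]/((F p - y).2) /GRing.scale /=; ring.
Qed.

(* Minimise |F - y|^2 on the square: by injectivity the minimum is interior, and
   there the invertible differential kills F - y. *)
Lemma local_surjection F p0 r : 0 < r ->
  (forall p, closed_square p0 r p -> differentiable F p /\ jacobian_det F p != 0) ->
  (forall p q, closed_square p0 r p -> closed_square p0 r q -> F p = F q -> p = q) ->
  exists2 eta, 0 < eta &
    forall y, `|y - F p0| < eta -> exists2 p, closed_square p0 r p & F p = y.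
Proof.
move=> r0 dF injF; pose Q := closed_square p0 r.
have cF p : Q p -> {for p, continuous F}.
  by move=> /dF[dFp _]; exact: differentiable_continuous.
have cQ : compact Q by exact: closed_square_compact.
(* The frame of the square. By injectivity F stays away from F p0 on it, and the minimum [m] of the
   squared distance there decides how close y has to be. *)
pose B := Q `&` [set p | r <= `|p - p0|].
have cB : compact B.
  apply: compact_closedI => //.
  have -> : [set p | r <= `|p - p0|] = (fun q => `|q - p0|) @^-1` [set x : R | r <= x] by [].
  apply: closed_comp => [q _|]; last exact: closed_ge.
  by apply: cvg_norm; apply: cvgB; [exact: cvg_id | exact: cvg_cst].
have Q0 : Q p0 by rewrite /Q /closed_square /= subrr normr0 ltW.
have B0 : B !=set0.
  exists (p0.1 + r, p0.2); have N : `|(p0.1 + r, p0.2) - p0| = r.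
    by rewrite prod_normE /= addrAC subrr add0r subrr normr0 gtr0_norm // max_l // ltW.
  by split; rewrite /Q /closed_square /= N.
have cs y p : Q p -> {for p, continuous (fun q => sqnorm (F q - y))}.
  move=> Qp; apply: (@continuous_comp _ _ _ (fun q => F q - y) sqnorm).
    by apply: cvgB; [exact: cF | exact: cvg_cst].
  exact: sqnorm_continuous.
have within_of (A : set (R * R)) (h : R * R -> R) :
    (forall p, A p -> {for p, continuous h}) -> {within A, continuous h}.
  by move=> ch; apply: continuous_in_subspaceT => p /set_mem; exact: ch.
have [b bB bmin] := compact_EVT_min B0 cB (within_of _ _ (fun p Bp => cs (F p0) p (proj1 Bp))).
pose m := sqnorm (F b - F p0).
have m0 : 0 < m.
  apply: sqnorm_gt0; rewrite subr_eq0; apply/eqP => E.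
  have [Qb rb] := set_mem bB; have bp := injF _ _ Qb Q0 E.
  by move: rb; rewrite /= bp subrr normr0 leNgt r0.
(* With eta at most 1 and at most m/8, the squared distance of y to F p0 is below 2 eta^2 <= m/4. A
   minimum on the frame would contradict this through [sqnorm_triangle], whose two factors 2 account
   for the 4. *)
have e0 : 0 < Num.min 1 (m / 8) by rewrite lt_min ltr01 divr_gt0.
exists (Num.min 1 (m / 8)) => // y /(sqnorm_lt e0) ys.
have {ys} ys : 4 * sqnorm (y - F p0) < m.
  have [e1 e2] : Num.min 1 (m / 8) <= 1 /\ Num.min 1 (m / 8) <= m / 8.
    by rewrite !ge_min !lexx orbT.
  by nra.
have Qn : Q !=set0 by exists p0.
have [p /set_mem Qp pmin] := compact_EVT_min Qn cQ (within_of _ _ (cs y)).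
exists p => //.
have pr : `|p - p0| < r.
  rewrite ltNge; apply/negP => rp.
  have pB : p \in B by apply/mem_set.
  have := bmin _ pB; rewrite -/m; have := pmin _ (mem_set Q0).
  have := sqnorm_triangle (F p) y (F p0); rewrite (sqnormB (F p0)).
  by move: ys; lra.
have near_p q : `|q - p| < r - `|p - p0| -> Q q.
  move=> qp; rewrite /Q /closed_square /= -(subrKA p) (le_trans (ler_normD _ _)) //.
  by rewrite -lerBrDr ltW.
have rp0 : 0 < r - `|p - p0| by rewrite subr_gt0.
have D v : 'D_v (fun q => sqnorm (F q - y)) p = 0.
  apply: (@derive_at_min (fun q => sqnorm (F q - y)) p v _ rp0) => q /near_p Qq;
    last by apply: pmin; exact/mem_set.
  have [dFq _] := dF _ Qq.
  have cfst : continuous (fst : R * R -> R) by move=> ?; exact: cvg_fst.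
  have csnd : continuous (snd : R * R -> R) by move=> ?; exact: cvg_snd.
  have d1 : differentiable (fun q => (F q - y).1) q.
    apply: (@differentiable_comp _ _ _ _ (fun q => F q - y) fst).
      by apply: differentiableB.
    exact: linear_differentiable.
  have d2 : differentiable (fun q => (F q - y).2) q.
    apply: (@differentiable_comp _ _ _ _ (fun q => F q - y) snd).
      by apply: differentiableB.
    exact: linear_differentiable.
  by apply: differentiableD; apply: differentiableM.
have [dFp] := dF _ Qp; rewrite /jacobian_det /det2.
move: (D (1, 0)) (D (0, 1)); rewrite !derive_sqnorm //.
move: ('D_(1, 0) F p) ('D_(0, 1) F p) => [a1 a2] [b1 b2] /=.
case: (F p) => f1 f2; case: (y) => y1 y2 /= E1 E2 J.
have {}E1 : (f1 - y1) * a1 + (f2 - y2) * a2 = 0 by lra.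
have {}E2 : (f1 - y1) * b1 + (f2 - y2) * b2 = 0 by lra.
have z1 : f1 - y1 = 0.
  apply: (mulfI J); rewrite mulr0.
  transitivity (b2 * ((f1 - y1) * a1 + (f2 - y2) * a2)
    - a2 * ((f1 - y1) * b1 + (f2 - y2) * b2)); first by ring.
  by rewrite E1 E2 !mulr0 subr0.
have z2 : f2 - y2 = 0.
  apply: (mulfI J); rewrite mulr0.
  transitivity (a1 * ((f1 - y1) * b1 + (f2 - y2) * b2)
    - b1 * ((f1 - y1) * a1 + (f2 - y2) * a2)); first by ring.
  by rewrite E1 E2 !mulr0 subr0.
by congr (_, _); apply/eqP; rewrite -subr_eq0 ?z1 ?z2.
Qed.
End LocalSurjectivity.

Section Annulus.
Context {R : realType} (S : oriented_surface R).
Variables (c : R -> S) (a : R * R -> S).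
Hypothesis annulus_a : annulus_around c a.

Lemma open_strip_open : open (@open_strip R).
Proof.
have -> : @open_strip R = snd @^-1` [set x : R | -1 < x] `&` snd @^-1` [set x : R | x < 1].
  by apply/seteqP; split=> p /=; rewrite /open_strip /=; [move=> /andP[] | move=> [-> ->]].
have csnd : continuous (snd : R * R -> R) by move=> ?; exact: cvg_snd.
by apply: openI; apply: open_comp => [p _|];
  [exact: csnd|exact: open_gt|exact: csnd|exact: open_lt].
Qed.

Lemma annulus_continuous p : open_strip p -> {for p, continuous a}.
Proof.
have [[ca _] _ _ _ _] := annulus_a => sp.
move=> N /(within_continuous_near ca sp) H.
have sn : nbhs p (@open_strip R).
  by apply: open_nbhs_nbhs; split => //; exact: open_strip_open.
by apply: filterS2 sn H => q sq; apply.
Qed.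

Lemma annulus_preimage_open (j : chart S) : open (@open_strip R `&` a @^-1` dom j).
Proof.
rewrite openE => p [sp jp]; apply: filterI.
  by apply: open_nbhs_nbhs; split => //; exact: open_strip_open.
apply: (annulus_continuous sp); apply: open_nbhs_nbhs; split => //.
exact: dom_open.
Qed.

Lemma annulus_differentiable (j : chart S) p : open_strip p -> dom j (a p) ->
  differentiable (Defs.coord j \o a) p.
Proof.
move=> sp jp; have [[_ sa] _ _ _ _] := annulus_a.
have [U [g [oU Up sg fg]]] := sa j p sp jp.
apply: near_eq_differentiable (sg [::] p Up).
have : nbhs p (U `&` (@open_strip R `&` a @^-1` dom j)).
  apply: open_nbhs_nbhs; split => //; apply: openI => //.
  exact: annulus_preimage_open.
by apply: filterS => q [Uq [sq jq]]; rewrite /= -fg.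
Qed.

Lemma annulus_shift p (m : R) : m \is a Num.int -> open_strip p ->
  a (p.1 + m, p.2) = a p.
Proof.
have [_ per _ _ _] := annulus_a.
have pern (q : R * R) (n : nat) : open_strip q -> a (q.1 + n%:R, q.2) = a q.
  elim: n => [|n IH] sq; first by rewrite addr0; case: q sq.
  by rewrite -natr1 addrA (per (q.1 + n%:R, q.2)) // IH.
move=> /intrP[[n|n] ->] sp; first exact: pern.
have := pern (p.1 - n.+1%:R, p.2) n.+1 sp; rewrite /= subrK NegzE mulrNz => <-.
by case: p sp.
Qed.

Lemma annulus_inj p q : open_strip p -> open_strip q -> a p = a q ->
  p.2 = q.2 /\ q.1 - p.1 \is a Num.int.
Proof.
have [_ _ inj _ _] := annulus_a => sp sq /(inj _ _ sp sq)[-> [m ->]].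
by split=> //; rewrite addrAC subrr add0r; apply/intrP; exists m.
Qed.

(** [a] is open: in a chart it is injective on small squares with nonzero Jacobian, so local
    surjectivity applies. Continuity of maps defined through preimages under [a] rests on this. *)
Lemma annulus_image_nbhs p N : open_strip p -> nbhs p N -> nbhs (a p) (a @` N).
Proof.
move=> sp Np; have [j jp] := dom_cover (a p).
have [_ _ _ jac _] := annulus_a.
have : nbhs p (N `&` (@open_strip R `&` a @^-1` dom j)).
  apply: filterI => //; apply: open_nbhs_nbhs; split => //.
  exact: annulus_preimage_open.
rewrite -nbhs_ballE => -[r /= r0 rN].
(* The bound 1/4 keeps the first coordinates of two points of the square less than 1 apart, so that
   periodicity does not spoil injectivity. *)
pose r' := Num.min (r / 2) 4^-1.
have r'0 : 0 < r' by rewrite lt_min divr_gt0 //= invr_gt0 ltr0n.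
have sqN q : closed_square p r' q -> N q /\ (open_strip q /\ dom j (a q)).
  move=> qr; suff /rN : ball p r q by [].
  rewrite ball_prod_normE /ball_ /= distrC (le_lt_trans qr) //.
  by rewrite gt_min; apply/orP; left; lra.
have [||eta eta0 surj] := @local_surjection R (Defs.coord j \o a) p r' r'0.
- move=> q /sqN[_ [sq jq]]; split; first exact: annulus_differentiable.
  by have [_ /lt0r_neq0] := jac j q sq jq.
- move=> q q' qr q'r E; have [_ [sq jq]] := sqN _ qr; have [_ [sq' jq']] := sqN _ q'r.
  have aE : a q = a q' by rewrite -(coordK jq) -(coordK jq'); congr (Defs.param j _).
  have [E2 E1] := annulus_inj sq sq' aE.
  have d1 : `|q'.1 - q.1| < 1.
    have H (x : R * R) : closed_square p r' x -> `|x.1 - p.1| <= 4^-1.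
      rewrite /closed_square /= prod_normE ge_max => /andP[+ _].
      by move/le_trans; apply; rewrite ge_min lexx orbT.
    rewrite (_ : _ - _ = (q'.1 - p.1) - (q.1 - p.1)); last by ring.
    by rewrite (le_lt_trans (ler_normB _ _)) // (le_lt_trans (lerD (H _ q'r) (H _ qr))) //; lra.
  have /eqP : q'.1 - q.1 = 0.
    case/intrP: E1 d1 => m ->; rewrite -intr_norm -[1]/(1%:~R) ltr_int => m1.
    by have -> : m = 0 by lia.
  by rewrite subr_eq0 => /eqP E0; rewrite [q]surjective_pairing [q']surjective_pairing E0 E2.
have near_y : \forall y \near a p, dom j y /\ `|Defs.coord j y - Defs.coord j (a p)| < eta.
  have := within_continuous_near (@Defs.coord_continuous R S j) jp.
  move=> /(_ (ball (Defs.coord j (a p)) eta) (nbhsx_ballx _ _ eta0)) H.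
  have jn : nbhs (a p) (dom j) by apply: open_nbhs_nbhs; split => //; exact: dom_open.
  apply: filterS2 jn H => y jy; move/(_ jy) => /=.
  by rewrite ball_prod_normE /ball_ /= distrC.
apply: filterS near_y => y [jy /surj[q qr qE]].
have [Nq [sq jq]] := sqN _ qr; exists q => //.
by rewrite -(coordK jq) -(coordK jy); congr (Defs.param j _).
Qed.
End Annulus.

(** * Dehn twists on the first homology *)

Section MulrzAdditive.
Variables (V : zmodType) (v : V).
Definition int_multiple (n : int) : V := v *~ n.
Lemma int_multiple_additive : zmod_morphism int_multiple.
Proof. by move=> m n; exact: mulrzBr. Qed.
HB.instance Definition _ := GRing.isZmodMorphism.Build int V int_multiple
  int_multiple_additive.
End MulrzAdditive.

Section Twist.
Context {R : realType} (S : oriented_surface R).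
Variables (c : R -> S) (a : R * R -> S) (chi : R -> R).
Hypothesis hausS : hausdorff_space S.
Hypothesis annulus_a : annulus_around c a.
Hypotheses (chi_cont : continuous chi) (chi_lo : forall t : R, t <= - 2^-1 -> chi t = 0)
  (chi_hi : forall t : R, 2^-1 <= t -> chi t = 1).

Definition in_annulus : set S := a @` (@open_strip R).

(** A choice of preimage: only the second coordinate and the class of the first modulo Z have a
    meaning. *)
Definition annulus_coord (y : S) : R * R :=
  if pselect (in_annulus y) is left h then projT1 (cid2 h) else 0.

Lemma annulus_coordP y : in_annulus y ->
  open_strip (annulus_coord y) /\ a (annulus_coord y) = y.
Proof.
move=> ay; rewrite /annulus_coord; case: pselect => // h.
by have [p1 p2] := projT2 (cid2 h).
Qed.

Lemma annulus_coordE p : open_strip p ->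
  (annulus_coord (a p)).2 = p.2 /\ (annulus_coord (a p)).1 - p.1 \is a Num.int.
Proof.
move=> sp; have [sq aq] := annulus_coordP (ex_intro2 _ _ p sp erefl).
by have [-> i] := annulus_inj annulus_a sp sq (esym aq).
Qed.

(* The map S -> R/Z that collapses the complement of the annulus to 0. *)
Definition annulus_height (y : S) : R :=
  if pselect (in_annulus y) then chi (annulus_coord y).2 else 0.

Lemma annulus_heightE p : open_strip p -> annulus_height (a p) = chi p.2.
Proof.
move=> sp; rewrite /annulus_height; case: pselect => [ay|[]]; last by exists p.
by have [-> _] := annulus_coordE sp.
Qed.

Lemma annulus_height_out y : ~ in_annulus y -> annulus_height y = 0.
Proof. by rewrite /annulus_height; case: pselect. Qed.

(** On the rest of the annulus [chi] is 0 or 1. This set is closed, being compact in a Hausdorff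
    space, so a point off the open annulus has a neighbourhood where the height is an integer. *)
Definition core_annulus : set S := a @` (`[0, 1] `*` `[- 2^-1, 2^-1]).

Lemma core_annulus_closed : closed core_annulus.
Proof.
apply: compact_closed => //; apply: continuous_compact; last first.
  by apply: compact_setX; exact: segment_compact.
apply: continuous_in_subspaceT => p /set_mem[_ /=]; rewrite in_itv /= => /andP[p1 p2].
by apply: (annulus_continuous annulus_a); rewrite /open_strip /=; lra.
Qed.

Lemma in_core_annulus p : `|p.2| <= 2^-1 -> core_annulus (a p).
Proof.
rewrite ler_norml => /andP[p1 p2].
have sp : open_strip p by rewrite /open_strip /=; lra.
have fl := floor_itv p.1; rewrite rmorphD /= in fl.
exists (p.1 - (Num.floor p.1)%:~R, p.2).
  by split; rewrite /= in_itv /=; [lra | rewrite p1 p2].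
rewrite (annulus_shift annulus_a) // rpredN; apply/intrP; by eexists.
Qed.

Lemma core_annulus_sub y : core_annulus y -> in_annulus y.
Proof.
move=> [p [_ /=]]; rewrite in_itv /= => /andP[p1 p2] <-; exists p => //.
by rewrite /open_strip /=; lra.
Qed.

Lemma near_out y : ~ core_annulus y -> \forall z \near y, ~ core_annulus z.
Proof.
move=> ny; apply: open_nbhs_nbhs; split => //; apply: closed_openC.
exact: core_annulus_closed.
Qed.

Lemma chi_out t : ~ `|t| <= 2^-1 -> chi t \is a Num.int.
Proof.
move=> /negP; rewrite -ltNge ltr_normr => /orP[t1 | t1].
  by rewrite chi_hi ?rpred1 //; exact: ltW.
by rewrite chi_lo ?rpred0 //; lra.
Qed.

Lemma annulus_height_core y : ~ core_annulus y -> annulus_height y \is a Num.int.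
Proof.
move=> ny; case: (pselect (in_annulus y)) => [[p sp py]|/annulus_height_out ->];
  last exact: rpred0.
rewrite -py annulus_heightE //; apply: chi_out => p2; apply: ny.
by rewrite -py; exact: in_core_annulus.
Qed.

Lemma near_annulus p (P : set S) : open_strip p ->
  (\forall q \near p, P (a q)) -> \forall y \near a p, P y.
Proof.
move=> sp /(annulus_image_nbhs annulus_a sp).
by apply: filterS => y [q Pq <-].
Qed.

Lemma near_strip (p : R * R) : open_strip p -> \forall q \near p, open_strip q.
Proof. by move=> sp; apply: open_nbhs_nbhs; split => //; exact: open_strip_open. Qed.

Lemma annulus_height_continuous : circle_continuous (annulus_height : S -> R).
Proof.
move=> y e e0; case: (pselect (in_annulus y)) => [[p sp <-]|ny].
  apply: near_annulus => //.
  have chip : \forall q \near p, `|chi p.2 - chi q.2| < e.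
    have : {for p, continuous (chi \o snd)}.
      by apply: continuous_comp; [exact: cvg_snd | exact: chi_cont].
    by move=> /cvgrPdist_lt; apply.
  apply: filterS2 (near_strip sp) chip => q sq chiq; exists 0; first exact: rpred0.
  by rewrite !annulus_heightE // subr0 distrC.
have nyc : ~ core_annulus y by move=> /core_annulus_sub.
apply: filterS (near_out nyc) => z nz; exists (annulus_height z).
  exact: annulus_height_core.
by rewrite (annulus_height_out ny) subr0 subrr normr0.
Qed.

(** Rotation of the annulus by r, extended by the identity. It is continuous on the annulus but can
    fail to be so across its frontier; run for the time given by the height, it is the twist. *)
Definition flow (r : R) (y : S) : S :=
  if pselect (in_annulus y)
  then a ((annulus_coord y).1 + r, (annulus_coord y).2) else y.

Lemma flowE r p : open_strip p -> flow r (a p) = a (p.1 + r, p.2).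
Proof.
move=> sp; rewrite /flow; case: pselect => [ay|[]] /=; last by exists p.
have [E2 E1] := annulus_coordE sp; rewrite E2.
rewrite -(@annulus_shift _ _ _ _ annulus_a (p.1 + r, p.2) _ E1) //=.
by congr (a (_, _)); ring.
Qed.

Lemma flow_out r y : ~ in_annulus y -> flow r y = y.
Proof. by rewrite /flow; case: pselect. Qed.

Lemma flow0 y : flow 0 y = y.
Proof.
case: (pselect (in_annulus y)) => [[p sp <-]|/flow_out //].
by rewrite flowE // addr0; case: p sp.
Qed.

Lemma flow_shift r r' y : r' - r \is a Num.int -> flow r' y = flow r y.
Proof.
move=> ri; case: (pselect (in_annulus y)) => [[p sp <-]|ny]; last by rewrite !flow_out.
rewrite !flowE // -(@annulus_shift _ _ _ _ annulus_a (p.1 + r, p.2) _ ri) //=.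
by congr (a (_, _)); ring.
Qed.

Lemma flow_continuous r0 p : open_strip p ->
  {for (r0, a p), continuous (fun x : R * S => flow x.1 x.2)}.
Proof.
move=> sp N; rewrite /= flowE // => aN.
have ca : {for (r0, p), continuous (fun x : R * (R * R) => a (x.2.1 + x.1, x.2.2))}.
  apply: (@continuous_comp _ _ _ (fun x : R * (R * R) => (x.2.1 + x.1, x.2.2)) a);
    last exact: (annulus_continuous annulus_a).
  have c1 : continuous (fun x : R * (R * R) => x.2.1).
    by move=> x; apply: (@continuous_comp _ _ _ snd fst); [exact: cvg_snd | exact: cvg_fst].
  have c2 : continuous (fun x : R * (R * R) => x.2.2).
    by move=> x; apply: (@continuous_comp _ _ _ snd snd); [exact: cvg_snd | exact: cvg_snd].
  apply: (@continuous_pair _ _ _ (fun x : R * (R * R) => x.2.1 + x.1)); last exact: c2.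
  by apply: cvgD; [exact: c1 | exact: cvg_fst].
have [[A M] /= [r0A pM] AMN] := ca N aN.
exists (A, a @` (M `&` @open_strip R)).
  split => //; apply: (annulus_image_nbhs annulus_a sp).
  by apply: filterI => //; exact: near_strip.
move=> [r y] /= [Ar [q [Mq sq] <-]]; rewrite flowE //.
by apply: (AMN (r, q)).
Qed.

Section Homotopy.
Variables (gamma : R -> S) (L : R -> R).
Hypotheses (cg : continuous gamma) (cL : continuous L).
Hypothesis iL : forall t, L t - annulus_height (gamma t) \is a Num.int.
Hypothesis small : forall t, `|L t - L 0| < 2^-1.

Let m : int := Num.floor (L 0 + 2^-1).
(* The end points of this homotopy are gamma and T \o gamma.  It is continuous at
   points outside the annulus because there L = m, so that the flow stops. *)
Definition twist_homotopy (x : R * R) : S := flow (x.1 * (L x.2 - m%:~R)) (gamma x.2).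

(** Off the core annulus L is an integer; being within 1/2 of L 0, it is the integer [m] to which L
    0 rounds, the same for all such t. *)
Lemma lift_out t : ~ core_annulus (gamma t) -> L t = m%:~R.
Proof.
move=> /annulus_height_core hi.
have /intrP[n nE] : L t \is a Num.int by rewrite -[L t](subrK (annulus_height (gamma t))) rpredD.
rewrite nE /m (@floor_def _ _ n) // rmorphD /=.
by have := small t; rewrite nE ltr_norml => /andP[]; lra.
Qed.

Lemma twist_homotopy_continuous : continuous twist_homotopy.
Proof.
move=> [u t]; have cr : continuous (fun x : R * R => x.1 * (L x.2 - m%:~R)).
  move=> x; apply: cvgM; first exact: cvg_fst.
  apply: cvgB; last exact: cvg_cst.
  by apply: (@continuous_comp _ _ _ snd L); [exact: cvg_snd | exact: cL].
have cg2 : continuous (fun x : R * R => gamma x.2).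
  by move=> x; apply: (@continuous_comp _ _ _ snd gamma); [exact: cvg_snd | exact: cg].
case: (pselect (in_annulus (gamma t))) => [[p sp pE]|ny].
  apply: (@continuous_comp _ _ _ (fun x : R * R => (x.1 * (L x.2 - m%:~R), gamma x.2))
    (fun x : R * S => flow x.1 x.2)).
    by apply: continuous_pair; [exact: cr | exact: cg2].
  by rewrite /= -pE; exact: flow_continuous.
have nyc : ~ core_annulus (gamma t) by move=> /core_annulus_sub.
have nx : \forall x \near (u, t), ~ core_annulus (gamma x.2).
  exact: (cg2 (u, t) _ (near_out nyc)).
have E x : ~ core_annulus (gamma x.2) -> twist_homotopy x = gamma x.2.
  by move=> /lift_out Lx; rewrite /twist_homotopy Lx subrr mulr0 flow0.
move=> N; rewrite E // => /(cg2 (u, t)) /= gN.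
by apply: filterS2 nx gN => x nxx gx /=; rewrite E.
Qed.
End Homotopy.

Lemma core_curve t : a (t, 0) = c t.
Proof. by have [_ _ _ _ ->] := annulus_a. Qed.

Lemma strip0 t : open_strip (t, 0 : R).
Proof. by rewrite /open_strip /= ltrN10 ltr01. Qed.

Lemma core_curve_continuous : continuous c.
Proof.
have -> : c = a \o (fun t => (t, 0)) by apply/funext => t; rewrite /= core_curve.
move=> t; apply: continuous_comp; last exact: (annulus_continuous annulus_a (strip0 t)).
by apply: (@continuous_pair _ _ _ id (fun=> 0 : R)); [exact: cvg_id | exact: cvg_cst].
Qed.

Definition orbit (p : R * R) (v : R) : S := a (p.1 + v, p.2).

Lemma orbit_continuous p : open_strip p -> continuous (orbit p).
Proof.
move=> sp v; apply: (@continuous_comp _ _ _ (fun v : R => (p.1 + v, p.2)) a);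
  last exact: (annulus_continuous annulus_a).
apply: (@continuous_pair _ _ _ (fun v : R => p.1 + v) (fun=> p.2)); last exact: cvg_cst.
by apply: cvgD; [exact: cvg_cst | exact: cvg_id].
Qed.

(** The square slides the orbit onto the core curve; its two sides are the same path by periodicity
    and cancel. *)
Lemma path_class_orbit p x : open_strip p ->
  path_class (subpath (orbit p) x (x + 1)) = path_class c.
Proof.
move=> sp.
pose h (q : R * R) := a (clamp q.1 * (p.1 + x) + q.2, clamp q.1 * p.2).
have sh q : open_strip (clamp q.1 * (p.1 + x) + q.2, clamp q.1 * p.2).
  rewrite /open_strip /=; have := clamp_ge0 q.1; have := clamp_le1 q.1.
  by move: sp; rewrite /open_strip /=; nra.
have cc : continuous (fun q : R * R => clamp q.1).
  move=> q; apply: (@continuous_comp _ _ _ fst clamp); first exact: cvg_fst.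
  exact: clamp_continuous.
have ch : continuous h.
  move=> q; apply: (@continuous_comp _ _ _ (fun q : R * R =>
    (clamp q.1 * (p.1 + x) + q.2, clamp q.1 * p.2)) a);
    last exact: (annulus_continuous annulus_a).
  apply: (@continuous_pair _ _ _ (fun q : R * R => clamp q.1 * (p.1 + x) + q.2)
    (fun q => clamp q.1 * p.2)).
    by apply: cvgD; [apply: cvgM; [exact: cc | exact: cvg_cst] | exact: cvg_snd].
  by apply: cvgM; [exact: cc | exact: cvg_cst].
have := path_class_square ch.
have -> : (fun t => h (0, t)) = c.
  by apply/funext => t; rewrite /h /= clampE ?lexx ?ler01 // !mul0r add0r core_curve.
have -> : (fun t => h (1, t)) = subpath (orbit p) x (x + 1).
  apply/funext => t; rewrite /h /= clampE ?lexx ?ler01 // !mul1r /subpath /orbit.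
  by congr (a (_, _)); ring.
have -> : (fun u => h (u, 1)) = (fun u => h (u, 0)).
  apply/funext => u; have := sh (u, 0); rewrite /h /= addr0 => su.
  by rewrite -(annulus_shift annulus_a (rpred1 _) su).
by rewrite addrC => /addrI ->.
Qed.

Lemma path_class_orbit_int p x (n : int) : open_strip p ->
  path_class (subpath (orbit p) x (x + n%:~R)) = path_class c *~ n.
Proof.
move=> sp; have co := orbit_continuous sp.
have nat_case (k : nat) y : path_class (subpath (orbit p) y (y + k%:R)) = path_class c *+ k.
  elim: k => [|k IH].
    rewrite addr0 mulr0n -(path_class_const (orbit p y)); congr path_class.
    by apply/funext => t; rewrite /subpath subrr mul0r addr0.
  rewrite -natr1 addrA -(path_class_cat y (y + k%:R)) // IH path_class_orbit //.
  by rewrite mulrS addrC.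
case: n => k; first exact: nat_case.
rewrite NegzE !mulrNz.
have := path_class_cat (x - k.+1%:R) x (x - k.+1%:R) co.
have := nat_case k.+1 (x - k.+1%:R); rewrite subrK => ->.
have := nat_case 0%N (x - k.+1%:R); rewrite addr0 mulr0n => ->.
by move=> /eqP; rewrite addrC addr_eq0 => /eqP.
Qed.

(** The class of the track of y under the flow for time l. Off the annulus that track is constant,
    and the multiple of c is put in so that [flow_class_shift] holds at every y. *)
Definition flow_class (y : S) (l : R) : @chain_classes R S :=
  if pselect (in_annulus y) then path_class (fun u => flow (u * l) y)
  else path_class c *~ Num.floor l.

Lemma flow_orbit p l : open_strip p ->
  (fun u => flow (u * l) (a p)) = subpath (orbit p) 0 (0 + l).
Proof.
move=> sp; apply/funext => u; rewrite flowE // /subpath /orbit.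
by congr (a (_, _)); ring.
Qed.

Lemma flow_class_shift y l (n : int) :
  flow_class y (l + n%:~R) = flow_class y l + path_class c *~ n.
Proof.
rewrite /flow_class; case: pselect => [ay|ny] /=; last first.
  by rewrite floorDrz ?mulrzDr ?intrKfloor //; apply/intrP; exists n.
have [p sp <-] := ay.
rewrite !flow_orbit // addrA -(path_class_cat 0 (0 + l)); last exact: orbit_continuous.
by rewrite path_class_orbit_int.
Qed.

Variable T : S -> S.
Hypotheses (T_cont : continuous T)
  (T_in : forall p, open_strip p -> T (a p) = a (p.1 + chi p.2, p.2))
  (T_out : forall y, ~ in_annulus y -> T y = y).

Lemma twist_flow y r : r - annulus_height y \is a Num.int -> flow r y = T y.
Proof.
move=> ri; rewrite (flow_shift y ri).
case: (pselect (in_annulus y)) => [[p sp <-]|ny]; last by rewrite flow_out ?T_out.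
by rewrite flowE // annulus_heightE // T_in.
Qed.

(** This is the square of [twist_homotopy]. Its sides flow for the time L - m instead of L, which
    changes both flow classes by the same multiple of c. *)
Lemma twist_short_path (gamma : R -> S) (L : R -> R) : continuous gamma -> continuous L ->
  (forall t, L t - annulus_height (gamma t) \is a Num.int) ->
  (forall t, `|L t - L 0| < 2^-1) ->
  path_class (T \o gamma) - path_class gamma =
  flow_class (gamma 1) (L 1) - flow_class (gamma 0) (L 0).
Proof.
move=> cg cL iL small.
have := path_class_square (twist_homotopy_continuous cg cL iL small).
pose m := Num.floor (L 0 + 2^-1).
have -> : (fun t => twist_homotopy gamma L (0, t)) = gamma.
  by apply/funext => t; rewrite /twist_homotopy mul0r flow0.
have -> : (fun t => twist_homotopy gamma L (1, t)) = T \o gamma.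
  apply/funext => t; rewrite /twist_homotopy mul1r twist_flow //=.
  rewrite addrAC rpredB //; apply/intrP; by eexists.
have side t : path_class (fun u => twist_homotopy gamma L (u, t)) =
    flow_class (gamma t) (L t) - path_class c *~ m.
  rewrite -[L t in RHS](subrK m%:~R) flow_class_shift addrK /flow_class.
  case: pselect => [//|ny].
  have Lt : L t = m%:~R.
    by apply: (lift_out iL small) => /core_annulus_sub.
  rewrite Lt subrr floor0 mulr0z -(path_class_const (gamma t)); congr path_class.
  by apply/funext => u; rewrite /twist_homotopy /= flow_out.
rewrite !side => E; rewrite -(addKr (flow_class (gamma 0) (L 0) - path_class c *~ m)
  (path_class (T \o gamma))) -E (addrC (path_class gamma)) addrA addrK.
by rewrite opprB addrC addrA subrK.
Qed.

(** Uniform continuity of L gives a subdivision on whose pieces L varies by less than 1/2; the short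
    case telescopes. *)
Lemma twist_path (gamma : R -> S) (L : R -> R) : continuous gamma -> continuous L ->
  (forall t, 0 <= t <= 1 -> L t - annulus_height (gamma t) \is a Num.int) ->
  path_class (T \o gamma) - path_class gamma =
  flow_class (gamma 1) (L 1) - flow_class (gamma 0) (L 0).
Proof.
move=> cg cL iL; have cT : continuous (T \o gamma).
  by move=> t; apply: continuous_comp; [exact: cg | exact: T_cont].
have half0 : 0 < 2^-1 :> R by rewrite invr_gt0 ltr0n.
have [d d0 unif] := segment_uniform cL half0.
pose N := (Num.truncn d^-1).+1; have N0 : 0 < N%:R :> R by rewrite ltr0n.
have Nd : N%:R^-1 < d.
  by rewrite -[d]invrK ltf_pV2 ?posrE ?invr_gt0 //; exact: truncnS_gt.
rewrite !(@path_class_sum _ _ _ N) // -sumrB.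
pose F i := flow_class (gamma (i%:R / N%:R)) (L (i%:R / N%:R)).
rewrite (eq_big_nat _ _ (F2 := fun i => F i.+1 - F i)).
  by rewrite telescope_sumr // /F divff ?gt_eqF // mul0r.
move=> i /andP[_ iN].
(* The clamped reparametrisation never leaves the i-th piece, so the hypotheses of the short case
   hold for all real s, not only on [0, 1]. *)
pose q (s : R) : R := i%:R / N%:R + (i.+1%:R / N%:R - i%:R / N%:R) * clamp s.
have qE s : q s = (i%:R + clamp s) / N%:R.
  by rewrite /q -natr1; field; exact: lt0r_neq0.
have cq : continuous q.
  by move=> s; apply: cvgD; [exact: cvg_cst | apply: cvgMl_tmp; exact: clamp_continuous].
have q01 s : 0 <= q s <= 1.
  rewrite qE divr_ge0 ?addr_ge0 ?clamp_ge0 //= ler_pdivrMr // mul1r.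
  rewrite (@le_trans _ _ (i%:R + 1)) ?lerD2l ?clamp_le1 //.
  by rewrite natr1 ler_nat.
have q0 : q 0 = i%:R / N%:R by rewrite qE clampE ?lexx ?ler01 // addr0.
have q1 : q 1 = i.+1%:R / N%:R by rewrite qE clampE ?lexx ?ler01 // natr1.
have cgq : continuous (gamma \o q).
  by move=> s; apply: continuous_comp; [exact: cq | exact: cg].
have cLq : continuous (L \o q).
  by move=> s; apply: continuous_comp; [exact: cq | exact: cL].
have := twist_short_path cgq cLq (fun s => iL _ (q01 s)).
rewrite /= q0 q1 -/(F i) -/(F i.+1) => <-; last first.
  move=> s; rewrite distrC; apply: unif; first by rewrite -q0.
  rewrite qE -mulrBl opprD addNKr mulNr normrN ger0_norm.
    by apply: le_lt_trans Nd; rewrite ler_piMl ?clamp_le1 // invr_ge0 ltW.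
  by rewrite divr_ge0 ?clamp_ge0 // ltW.
congr (_ - _); apply: eq_path_class.
- exact: (subpath_continuous cT).
- by move=> s; apply: continuous_comp; [exact: cgq | exact: T_cont].
- by move=> s s01; rewrite /subpath /= /q clampE.
- exact: (subpath_continuous cg).
- exact: cgq.
- by move=> s s01; rewrite /subpath /= /q clampE.
Qed.

Lemma core_curve_loop : c 0 = c 1.
Proof.
have := annulus_shift annulus_a (rpred1 _) (strip0 0).
by rewrite /= add0r !core_curve.
Qed.

(* The Picard-Lefschetz formula, the intersection number with c being computed
   as the degree of the collapse onto the circle. *)
Lemma twist_homology (x : singular_homology R S 1) :
  homology_pushforward R (mkcts T_cont) 1 x =
  x + loop_class core_curve_continuous core_curve_loop *~
      wind_class (annulus_height : S -> R) x.
Proof.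
have ch := annulus_height_continuous.
have E n : H1_chain_class (x + loop_class core_curve_continuous core_curve_loop *~ n) =
    H1_chain_class x + path_class c *~ n.
  by rewrite raddfD raddfMz /= H1_loop_class.
apply: H1_chain_class_inj; rewrite {}E.
rewrite -[x]homology_class_repr H1_pushforwardE (wind_classE ch) !H1_chain_classE.
apply: (@eq_on_cycles R S _ (chain_class \o chain_pushforward R (mkcts T_cont) 1)
  (chain_class \+ (int_multiple (path_class c) \o wind_chain (annulus_height : S -> R)))
  (fun y => flow_class y (annulus_height y))); last exact: cycle_diff.
move=> s; rewrite [X in X - _]chain_pushforward_simplex.
rewrite -[X in _ - X]/(chain_class _ + path_class c *~ wind_chain _ _).
rewrite chain_class_simplex wind_chainU.
have cs := @simplex_path_continuous R S s; set gamma := simplex_path s in cs *.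
have [L cL lL] := lift_exists ch cs.
have [_ iL] := lL.
rewrite opprD addrA (twist_path cs cL iL).
(* At the end points the lift is replaced by the height, which depends on the point alone and so
   defines the coboundary; the integers dropped in this way leave n1 - n0 = [wind gamma] copies of
   c. *)
have shift t : 0 <= t <= 1 -> exists2 n : int, n%:~R = L t - annulus_height (gamma t) &
    flow_class (gamma t) (L t) =
      flow_class (gamma t) (annulus_height (gamma t)) + path_class c *~ n.
  move=> /iL/intrP[n nE]; exists n => //.
  by rewrite -flow_class_shift -nE addrC subrK.
have [|n0 n0E ->] := shift 0; first by rewrite lexx ler01.
have [|n1 n1E ->] := shift 1; first by rewrite lexx ler01.
have -> : wind (annulus_height : S -> R) gamma = n1 - n0.
  by apply: (@intr_inj R); rewrite (wind_lift lL) rmorphB /= n0E n1E; ring.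
by rewrite mulrzBr opprD addrACA -mulrzBr addrK.
Qed.
End Twist.

(** * Transverse crossings *)

Section TransverseCrossing.
Context {R : realType}.

Lemma diff_approx (V W : normedModType R) (f : V -> W) x (e : R) :
  differentiable f x -> 0 < e ->
  exists2 d : R, 0 < d &
    forall y, `|y - x| < d -> `|f y - f x - 'd f x (y - x)| <= e * `|y - x|.
Proof.
move=> /diff_locallyP[_ /eqaddoP df] e0; have := df e e0.
move=> /nbhs_ballP[d /= d0 dB]; exists d => // y yx.
have := dB (y - x); rewrite -ball_normE /ball_ /= sub0r normrN => /(_ yx).
rewrite -[X in `|X| <= _]/(f (y - x + x) - (f x + 'd f x (y - x))).
by rewrite subrK opprD addrA.
Qed.

Lemma det2_le (u v : R * R) : `|det2 u v| <= 2 * (`|u| * `|v|).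
Proof.
rewrite /det2 !prod_normE (le_trans (ler_normB _ _)) // !normrM mulr_natl mulr2n.
by apply: lerD; apply: ler_pM => //; rewrite le_max lexx ?orbT.
Qed.

Lemma det2D (u v w : R * R) : det2 u (v + w) = det2 u v + det2 u w.
Proof. by rewrite /det2 /=; ring. Qed.
Lemma det2Z (k : R) (u v : R * R) : det2 u (k *: v) = k * det2 u v.
Proof. by rewrite /det2 /= /GRing.scale /=; ring. Qed.
Lemma det2C (u v : R * R) : det2 u v = - det2 v u.
Proof. by rewrite /det2; ring. Qed.
Lemma det2v (u : R * R) : det2 u u = 0.
Proof. by rewrite /det2; ring. Qed.

(** Here f1, f2 are the partial derivatives of the annulus, e' is the tangent of the curve, and r,
    r' are remainders. Pairing the equation with f1 gives J v_2 = D tau up to an error, so v_2 has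
    the sign of D tau once the error is below |D tau|. To bound it, pairing with f1 and f2 gives |v|
    <= K |tau|, where 4 M e <= J absorbs the error terms in |v|. *)
Lemma crossing_estimate (J D M e K : R) (v r r' f1 f2 e' : R * R) (tau : R) :
  0 < J -> 0 < e -> 0 < M -> D != 0 -> tau != 0 ->
  det2 f1 f2 = J -> det2 f1 e' = D ->
  `|f1| <= M -> `|f2| <= M -> `|e'| <= M ->
  v.1 *: f1 + v.2 *: f2 + r = tau *: e' + r' ->
  `|r| <= e * `|v| -> `|r'| <= e * `|tau| ->
  4 * (M * e) <= J -> K = 4 * (M * M) / J + 1 ->
  2 * (M * e) * (K + 1) < `|D| ->
  0 < v.2 * (D * tau).
Proof.
move=> J0 e0 M0 D0 t0 JE DE f1M f2M eM E rv rt eJ KE eD.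
have bound u w x : `|u| <= M -> `|w| <= e * x -> `|det2 u w| <= 2 * (M * e) * x.
  move=> uM wx; apply: (le_trans (det2_le _ _)).
  by rewrite -!mulrA ler_pM2l ?ltr0n // ler_pM.
have E2 : J * v.2 + det2 f1 r = D * tau + det2 f1 r'.
  have := congr1 (det2 f1) E; rewrite !det2D !det2Z det2v JE DE.
  by move=> H; lra.
have E1 : J * v.1 - det2 f2 r = - (tau * det2 f2 e') - det2 f2 r'.
  have := congr1 (det2 f2) E; rewrite !det2D !det2Z det2v (det2C f2 f1) JE.
  by move=> H; lra.
have b1 := bound _ _ _ f1M rv; have b2 := bound _ _ _ f1M rt.
have b3 := bound _ _ _ f2M rv; have b4 := bound _ _ _ f2M rt.
have M2 u w : `|u| <= M -> `|w| <= M -> `|det2 u w| <= 2 * (M * M).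
  move=> uM wM; apply: (le_trans (det2_le _ _)).
  by rewrite ler_pM2l ?ltr0n // ler_pM.
have Jabs x : J * `|x| = `|J * x| by rewrite normrM (gtr0_norm J0).
have t0' : 0 < `|tau| by rewrite normr_gt0.
have H2 : J * `|v.2| <= 2 * (M * M) * `|tau| + 2 * (M * e) * (`|v| + `|tau|).
  have -> : J * `|v.2| = `|D * tau + det2 f1 r' - det2 f1 r|.
    by rewrite Jabs -E2 addrK.
  have : `|D * tau| <= 2 * (M * M) * `|tau|.
    by rewrite normrM ler_wpM2r // -DE M2.
  have := ler_normB (D * tau + det2 f1 r') (det2 f1 r).
  by have := ler_normD (D * tau) (det2 f1 r'); lra.
have H1 : J * `|v.1| <= 2 * (M * M) * `|tau| + 2 * (M * e) * (`|v| + `|tau|).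
  have -> : J * `|v.1| = `|- (tau * det2 f2 e') - det2 f2 r' + det2 f2 r|.
    by rewrite Jabs -E1 subrK.
  have : `|- (tau * det2 f2 e')| <= 2 * (M * M) * `|tau|.
    by rewrite normrN normrM mulrC ler_wpM2r // M2.
  have := ler_normD (- (tau * det2 f2 e') - det2 f2 r') (det2 f2 r).
  by have := ler_normB (- (tau * det2 f2 e')) (det2 f2 r'); lra.
have H : J * `|v| <= 2 * (M * M) * `|tau| + 2 * (M * e) * (`|v| + `|tau|).
  have [vE | vE] : `|v| = `|v.1| \/ `|v| = `|v.2|.
    by rewrite prod_normE; case: (leP `|v.1| `|v.2|); [right | left].
  - by rewrite {1}vE.
  - by rewrite {1}vE.
have vK : `|v| <= K * `|tau|.
  have v0 := normr_ge0 v; rewrite -(ler_pM2l J0) KE mulrDl mul1r mulrDr.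
  have -> : J * (4 * (M * M) / J * `|tau|) = 4 * (M * M) * `|tau|.
    by field; exact: lt0r_neq0.
  have : 4 * (M * e) * `|v| <= J * `|v| by rewrite ler_wpM2r.
  have : 4 * (M * e) * `|tau| <= J * `|tau| by rewrite ler_wpM2r.
  lra.
have Me0 : 0 < 2 * (M * e) by rewrite mulr_gt0 ?mulr_gt0.
have err : `|det2 f1 r' - det2 f1 r| < `|D| * `|tau|.
  apply: (@le_lt_trans _ _ (2 * (M * e) * (K + 1) * `|tau|)); last by rewrite ltr_pM2r.
  have : 2 * (M * e) * `|v| <= 2 * (M * e) * (K * `|tau|) by rewrite ler_pM2l.
  by have := ler_normB (det2 f1 r') (det2 f1 r); lra.
have E3 : J * v.2 = D * tau + (det2 f1 r' - det2 f1 r) by lra.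
rewrite -(pmulr_rgt0 (v.2 * (D * tau)) J0) (mulrA J) E3 mulrDl.
move: err; set x := det2 f1 r' - det2 f1 r; rewrite -normrM => xD.
have Dt : D * tau != 0 by rewrite mulf_neq0.
have : `|x * (D * tau)| < D * tau * (D * tau).
  rewrite normrM -expr2 -real_normK ?num_real // expr2 ltr_pM2r //.
  by rewrite normr_gt0.
by rewrite ltr_norml => /andP[]; lra.
Qed.

(** F is the annulus and E the curve, both read in a chart; the conclusion says on which side of the
    core the curve lies. The remainders of both linear approximations are made small enough for
    [crossing_estimate]. *)
Lemma transverse_crossing (F : R * R -> R * R) p0 (E : R -> R * R) t0 :
  differentiable F p0 -> 0 < jacobian_det F p0 -> derivable E t0 1 ->
  det2 ('D_(1, 0) F p0) (derive1 E t0) != 0 ->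
  exists2 d : R, 0 < d & forall p t, `|p - p0| < d -> `|t - t0| < d -> t != t0 ->
    F p - F p0 = E t - E t0 ->
    0 < (p - p0).2 * (det2 ('D_(1, 0) F p0) (derive1 E t0) * (t - t0)).
Proof.
move=> dF; rewrite /jacobian_det.
have [f1 f1E] : exists u, 'D_(1, 0) F p0 = u by exists ('D_(1, 0) F p0).
have [f2 f2E] : exists u, 'D_(0, 1) F p0 = u by exists ('D_(0, 1) F p0).
have [e' eE] : exists u, derive1 E t0 = u by exists (derive1 E t0).
rewrite f1E f2E eE; have [D DE] : exists x, det2 f1 e' = x by exists (det2 f1 e').
rewrite DE => J0 dE D0.
have [n1 n2 n3] := And3 (normr_ge0 f1) (normr_ge0 f2) (normr_ge0 e').
have [M [M0 M1 M2 M3]] : exists M, [/\ 0 < M, `|f1| <= M, `|f2| <= M & `|e'| <= M].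
  by exists (`|f1| + `|f2| + `|e'| + 1); split; lra.
pose J := det2 f1 f2; pose K := 4 * (M * M) / J + 1.
have K1 : 0 < K + 1.
  have : 0 < 4 * (M * M) / J by rewrite divr_gt0 // !mulr_gt0.
  by rewrite /K; lra.
pose e := Num.min (J / (4 * M)) (`|D| / (4 * M * (K + 1))).
have D0' : 0 < `|D| by rewrite normr_gt0.
have e0 : 0 < e by rewrite lt_min !divr_gt0 ?mulr_gt0.
have eJ : 4 * (M * e) <= J.
  by rewrite mulrA mulrC -ler_pdivlMr ?mulr_gt0 // ge_min lexx.
have eD : 2 * (M * e) * (K + 1) < `|D|.
  have : e * (4 * M * (K + 1)) <= `|D|.
    by rewrite -ler_pdivlMr ?mulr_gt0 // ge_min lexx orbT.
  have : 0 < M * e * (K + 1) by rewrite !mulr_gt0.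
  lra.
have [d1 d10 A1] := diff_approx dF e0.
have dE' : differentiable E t0 by apply/derivable1_diffP.
have [d2 d20 A2] := diff_approx dE' e0.
exists (Num.min d1 d2); first by rewrite lt_min d10.
move=> p t; rewrite !lt_min => /andP[pd1 _] /andP[_ td2] tt0 FE.
apply: (@crossing_estimate J D M e K (p - p0) _ _ f1 f2 e' (t - t0) J0 e0 M0 D0
  _ erefl DE M1 M2 M3 _ (A1 p pd1) (A2 t td2) eJ erefl eD).
  by rewrite subr_eq0.
have -> : (p - p0).1 *: f1 + (p - p0).2 *: f2 = 'd F p0 (p - p0).
  rewrite -f1E -f2E !deriveE // -!linearZ -linearD; congr ('d F p0 _).
  by rewrite [RHS]surjective_pairing; congr (_, _); rewrite /= /GRing.scale /=; ring.
have -> : (t - t0) *: e' = 'd E t0 (t - t0).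
  by rewrite -eE derive1E deriveE // -linearZ; congr ('d E t0 _); rewrite /GRing.scale /= mulr1.
by rewrite !subrKC FE.
Qed.
End TransverseCrossing.

Section Curves.
Context {R : realType} (S : oriented_surface R).
Variables (e : R -> S) (curve_e : simple_closed_curve e).

Lemma curve_continuous : continuous e.
Proof.
have [[ce _] _ _ _] := curve_e => t N eN.
have := within_continuous_near ce (I : setT t) eN.
by rewrite /within /=; apply: filterS => s /(_ I).
Qed.

Lemma curve_loop : e 0 = e 1.
Proof. by have [_ per _ _] := curve_e; rewrite -(per 0) add0r. Qed.

Lemma curve_derivable (j : chart S) t : dom j (e t) ->
  derivable (Defs.coord j \o e) t 1.
Proof.
have [[_ se] _ _ _] := curve_e => jt; have [U [g [oU Ut sg fg]]] := se j t I jt.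
apply/derivable1_diffP; apply: near_eq_differentiable (sg [::] t Ut).
have nU : nbhs t U by exact: open_nbhs_nbhs.
have nj : nbhs t (e @^-1` dom j).
  apply: curve_continuous; apply: open_nbhs_nbhs; split => //; exact: dom_open.
by apply: filterS2 nU nj => s Us js; rewrite /= -fg.
Qed.
End Curves.

Section Crossing.
Context {R : realType} (S : oriented_surface R).
Variables (c : R -> S) (a : R * R -> S) (chi : R -> R).
Hypothesis hausS : hausdorff_space S.
Hypothesis annulus_a : annulus_around c a.
Hypotheses (chi_cont : continuous chi)
  (chi_lo : forall t : R, t <= - 2^-1 -> chi t = 0)
  (chi_hi : forall t : R, 2^-1 <= t -> chi t = 1).
Local Notation height := (annulus_height a chi : S -> R).

(* A real-valued lift of the height on the complement of c. *)
Definition cut_height (y : S) : R :=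
  if pselect (in_annulus a y)
  then chi (annulus_coord a y).2 - (0 < (annulus_coord a y).2)%R%:R else 0.

Lemma cut_heightE p : open_strip p -> cut_height (a p) = chi p.2 - (0 < p.2)%R%:R.
Proof.
move=> sp; rewrite /cut_height; case: pselect => [ay|[]] /=; last by exists p.
by have [-> _] := annulus_coordE annulus_a sp.
Qed.

Lemma cut_height_int y : cut_height y - height y \is a Num.int.
Proof.
rewrite /cut_height /annulus_height; case: pselect => [ay|ny] /=; last by rewrite subrr rpred0.
by rewrite addrAC subrr add0r rpredN; case: (0 < _); rewrite ?rpred0 ?rpred1.
Qed.

Lemma cut_height_out y : ~ core_annulus a y -> cut_height y = 0.
Proof.
move=> ny; case: (pselect (in_annulus a y)) => [[p sp py]|na]; last first.
  by rewrite /cut_height; case: pselect.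
rewrite -py cut_heightE //; have : ~ `|p.2| <= 2^-1.
  by move=> p2; apply: ny; rewrite -py; exact: in_core_annulus annulus_a _ p2.
move=> /negP; rewrite -ltNge ltr_normr => /orP[p2 | p2].
  by rewrite chi_hi ?ltW // (lt_trans _ p2) ?invr_gt0 ?ltr0n // subrr.
rewrite chi_lo; last by lra.
by rewrite (_ : (0 < p.2) = false) ?subrr //; apply/negbTE; rewrite -leNgt; lra.
Qed.

Lemma cut_height_continuous y : ~ range c y -> {for y, continuous cut_height}.
Proof.
move=> ny; case: (pselect (in_annulus a y)) => [[p sp py]|na]; last first.
  have nyc : ~ core_annulus a y by move=> /core_annulus_sub.
  move=> N; rewrite cut_height_out // => /nbhs_singleton N0.
  suff : \forall z \near y, N (cut_height z) by [].
  have := near_out hausS annulus_a nyc; apply: filterS => z nz.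
  by rewrite cut_height_out.
have p2 : p.2 != 0.
  apply/eqP => p20; apply: ny; exists p.1 => //.
  by rewrite -py -(core_curve annulus_a); case: p sp py p20 => p1 p2 /= _ _ ->.
move=> N; rewrite -py cut_heightE // => yN.
suff : \forall z \near a p, N (cut_height z) by [].
apply: (near_annulus annulus_a) => //.
have sgn : \forall q \near p, (0 < q.2) = (0 < p.2).
  have csnd : {for p, continuous (snd : R * R -> R)} by exact: cvg_snd.
  case: (ltgtP p.2 0) p2 => // p2 _.
    have H : \forall x \near p.2, x < 0 by exact: lt_nbhsl.
    have {}H : \forall q \near p, q.2 < 0 by exact: (csnd _ H).
    apply: filterS H => q q2.
    by apply/negbTE; rewrite -leNgt ltW.
  have H : \forall x \near p.2, 0 < x by exact: lt_nbhsr.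
  have {}H : \forall q \near p, 0 < q.2 by exact: (csnd _ H).
  by apply: filterS H => q ->.
have cchi : {for p, continuous (fun q : R * R => chi q.2 - (0 < p.2)%R%:R)}.
  apply: cvgB; last exact: cvg_cst.
  by apply: (@continuous_comp _ _ _ snd chi); [exact: cvg_snd | exact: chi_cont].
have {}cchi : \forall q \near p, N (chi q.2 - (0 < p.2)%R%:R) by exact: (cchi N yN).
have ns := near_strip sp; apply: filterS3 ns sgn cchi => q sq sq2.
by rewrite cut_heightE // sq2.
Qed.

Lemma wind_disjoint (e : R -> S) : continuous e -> e 0 = e 1 ->
  range c `&` range e = set0 -> wind height e = 0.
Proof.
move=> ce le ce0.
have lL : is_lift height e (cut_height \o e).
  split; last by move=> t _; exact: cut_height_int.
  apply: continuous_subspaceT => t; apply: continuous_comp; first exact: ce.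
  apply: cut_height_continuous => ct.
  have : (range c `&` range e) (e t) by split => //; exists t.
  by rewrite ce0.
by apply: (@intr_inj R); rewrite (wind_lift lL) /= le !subrr.
Qed.

Lemma wind_core : wind height c = 0.
Proof.
have lL : is_lift height c (fun=> chi 0).
  split; first by apply: continuous_subspaceT => t; exact: cvg_cst.
  move=> t _; rewrite -(core_curve annulus_a) (annulus_heightE chi annulus_a) ?subrr ?rpred0 //.
  exact: strip0.
apply: (@intr_inj R); rewrite (wind_lift lL) subrr sub0r.
rewrite -!(core_curve annulus_a) !(annulus_heightE chi annulus_a) ?subrr ?oppr0 //; exact: strip0.
Qed.

Variables (e : R -> S) (curve_e : simple_closed_curve e) (s0 t0 : R).
Hypotheses (meet : c s0 = e t0) (meet_only : range c `&` range e = [set c s0])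
  (transverse : forall j, dom j (c s0) ->
    det2 (derive1 (Defs.coord j \o c) s0) (derive1 (Defs.coord j \o e) t0) != 0).

(** As [a] is open, e t has annulus coordinates close to (s0, 0) for t near t0, and the planar
    statement applies to them; D is the determinant of the two tangents in one chart. *)
Lemma crossing_local : exists2 D : R, D != 0 & forall N, nbhs (s0, 0 : R) N ->
  \forall t \near t0, exists p, [/\ N p, open_strip p, a p = e t &
    t != t0 -> 0 < p.2 * (D * (t - t0))].
Proof.
have sp := strip0 s0; have [j jp] := dom_cover (c s0).
have jap : dom j (a (s0, 0)) by rewrite (core_curve annulus_a).
have jet : dom j (e t0) by rewrite -meet.
have [_ _ _ jac _] := annulus_a.
have dF := annulus_differentiable annulus_a sp jap.
have [_ J0] := jac j _ sp jap.
have dE := curve_derivable curve_e jet.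
have D1 : 'D_(1, 0) (Defs.coord j \o a) (s0, 0) = derive1 (Defs.coord j \o c) s0.
  rewrite derive1E /derive.
  have -> // : (fun h : R => h^-1 *: (((Defs.coord j \o a) \o shift (s0, 0)) (h *: (1, 0) : R * R)
      - (Defs.coord j \o a) (s0, 0))) =
    (fun h : R => h^-1 *: (((Defs.coord j \o c) \o shift s0) (h *: 1)
      - (Defs.coord j \o c) s0)).
  apply/funext => h; rewrite /= -!(core_curve annulus_a).
  congr (_ *: (Defs.coord j (a (_, _)) - _)).
  by rewrite -[LHS]/(h * 0 + 0) mulr0 addr0.
have D0 := transverse jp; rewrite -D1 in D0.
have [d d0 Hd] := transverse_crossing dF J0 dE D0.
exists (det2 ('D_(1, 0) (Defs.coord j \o a) (s0, 0)) (derive1 (Defs.coord j \o e) t0)) => // N pN.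
have nb : nbhs (s0, 0 : R) (ball (s0, 0 : R) d) by exact: nbhsx_ballx.
have nM : nbhs (s0, 0 : R) (N `&` (ball (s0, 0 : R) d `&` @open_strip R)).
  by apply: filterI => //; apply: filterI => //; exact: near_strip.
have := annulus_image_nbhs annulus_a sp nM.
rewrite (core_curve annulus_a) meet => et.
have H : \forall t \near t0,
    (a @` (N `&` (ball (s0, 0 : R) d `&` @open_strip R))) (e t).
  exact: (curve_continuous curve_e et).
have nt : \forall t \near t0, `|t - t0| < d.
  have : \forall t \near t0, ball t0 d t by exact: nbhsx_ballx.
  by apply: filterS => t; rewrite /ball /= distrC.
apply: filterS2 H nt => t [p [Np [pd sp']] pt] td; exists p; split => //.
move=> tt0; have := Hd p t _ td tt0; rewrite /= subr0; apply.
  by move: pd; rewrite ball_prod_normE /ball_ /= distrC.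
by rewrite pt (core_curve annulus_a) meet.
Qed.

(** Started at the crossing, e meets c only at its two ends, so [cut_height] is a continuous lift in
    between. Its one-sided limits are taken as the end values: just after t0 the curve is on the
    side given by the sign of D, just before on the other one. Hence the variation is 1 or -1. *)
Lemma wind_crossing : wind height (fun u => e (t0 + u)) != 0.
Proof.
have [D D0 loc] := crossing_local.
have [_ per inj _] := curve_e.
pose L (u : R) : R := if u == 0 then chi 0 - (0 < D)%R%:R
  else if u == 1 then chi 0 - (D < 0)%R%:R else cut_height (e (t0 + u)).
have L0 : L 0 = chi 0 - (0 < D)%R%:R by rewrite /L eqxx.
have L1 : L 1 = chi 0 - (D < 0)%R%:R by rewrite /L oner_eq0 eqxx.
have LE u : 0 < u -> u < 1 -> L u = cut_height (e (t0 + u)).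
  by move=> u0 u1; rewrite /L (gt_eqF u0) (lt_eqF u1).
have near0 (eps y : R) : 0 < eps -> y = t0 -> \forall t \near y,
    (t0 < t -> `|chi 0 - (0 < D)%R%:R - cut_height (e t)| < eps) /\
    (t < t0 -> `|chi 0 - (D < 0)%R%:R - cut_height (e t)| < eps).
  move=> eps0 ->; have cc : {for (s0, 0 : R), continuous (chi \o snd)}.
    by apply: continuous_comp; [exact: cvg_snd | exact: chi_cont].
  have /loc : \forall p \near (s0, 0 : R), `|chi 0 - chi p.2| < eps.
    by move/cvgrPdist_lt : cc; apply.
  apply: filterS => t [p [pe sp <- sgn]]; rewrite cut_heightE //.
  have canc (x z b : R) : x - b - (z - b) = x - z by ring.
  split=> t1; [have := sgn (negbT (gt_eqF t1)) | have := sgn (negbT (lt_eqF t1))] => pos.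
  - suff -> : (0 < p.2) = (0 < D) by rewrite canc.
    have t2 : 0 < t - t0 by rewrite subr_gt0.
    apply/idP/idP => H.
      by move: pos; rewrite pmulr_rgt0 // pmulr_lgt0.
    by move: pos; rewrite pmulr_lgt0 // pmulr_rgt0.
  - suff -> : (0 < p.2) = (D < 0) by rewrite canc.
    have t2 : t - t0 < 0 by rewrite subr_lt0.
    apply/idP/idP => H.
      by move: pos; rewrite pmulr_rgt0 // nmulr_lgt0.
    by move: pos; rewrite pmulr_lgt0 // nmulr_lgt0.
have e_per u : e (t0 + 1 + u) = e (t0 + u) by rewrite addrAC per.
have lL : is_lift height (fun u => e (t0 + u)) L.
  split; last first.
    move=> u _; rewrite /L; case: eqP => [->|_].
      rewrite addr0 -meet -(core_curve annulus_a) (annulus_heightE chi annulus_a (strip0 s0)) /=.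
      by rewrite addrAC subrr add0r rpredN; case: (0 < _); rewrite ?rpred0 ?rpred1.
    case: eqP => [->|_]; last exact: cut_height_int.
    rewrite per -meet -(core_curve annulus_a) (annulus_heightE chi annulus_a (strip0 s0)) /=.
    by rewrite addrAC subrr add0r rpredN; case: (_ < 0); rewrite ?rpred0 ?rpred1.
  apply/continuous_within_itvP; first exact: ltr01.
  split.
  - move=> u; rewrite in_itv /= => /andP[u0 u1].
    have nc : ~ range c (e (t0 + u)).
      move=> cu; have : (range c `&` range e) (e (t0 + u)) by split => //; exists (t0 + u).
      rewrite meet_only /= meet => /inj[m mE].
      have : u = (- m)%:~R by rewrite rmorphN /=; lra.
      move=> uE; move: u0 u1; rewrite uE -[1]/(1%:~R) -[0]/(0%:~R) !ltr_int; lia.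
    have ce : {for u, continuous (fun u => cut_height (e (t0 + u)))}.
      apply: (@continuous_comp _ _ _ (fun u => e (t0 + u)) cut_height);
        last exact: cut_height_continuous.
      apply: (@continuous_comp _ _ _ (fun u : R => t0 + u) e);
        last exact: (curve_continuous curve_e).
      by apply: cvgD; [exact: cvg_cst | exact: cvg_id].
    move=> N; rewrite LE // => uN.
    have H : \forall v \near u, N (cut_height (e (t0 + v))) by exact: (ce _ uN).
    have n0 : \forall v \near u, 0 < v by exact: lt_nbhsr.
    have n1 : \forall v \near u, v < 1 by exact: lt_nbhsl.
    suff : \forall v \near u, N (L v) by [].
    by apply: filterS3 n0 n1 H => v v0 v1; rewrite LE.
  - apply/cvgrPdist_lt => eps eps0; have H := near0 eps _ eps0 (addr0 t0).
    have ct : {for (0 : R), continuous (fun u : R => t0 + u)}.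
      by apply: cvgD; [exact: cvg_cst | exact: cvg_id].
    have {}H : \forall v \near (0 : R)^'+,
        (t0 < t0 + v -> `|chi 0 - (0 < D)%R%:R - cut_height (e (t0 + v))| < eps) /\
        (t0 + v < t0 -> `|chi 0 - (D < 0)%R%:R - cut_height (e (t0 + v))| < eps).
      exact: (cvg_at_right_filter ct H).
    have n0 : \forall v \near (0 : R)^'+, 0 < v by exact: nbhs_right_gt.
    have n1 : \forall v \near (0 : R)^'+, v < 1 by exact: nbhs_right_lt.
    apply: filterS3 n0 n1 H => v v0 v1 [+ _].
    by rewrite ltrDl L0 LE //; apply.
  - apply/cvgrPdist_lt => eps eps0; have H := near0 eps _ eps0 (subrK 1 t0).
    have ct : {for (1 : R), continuous (fun u : R => t0 - 1 + u)}.
      by apply: cvgD; [exact: cvg_cst | exact: cvg_id].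
    have {}H : \forall v \near (1 : R)^'-,
        (t0 < t0 - 1 + v -> `|chi 0 - (0 < D)%R%:R - cut_height (e (t0 - 1 + v))| < eps) /\
        (t0 - 1 + v < t0 -> `|chi 0 - (D < 0)%R%:R - cut_height (e (t0 - 1 + v))| < eps).
      exact: (cvg_at_left_filter ct H).
    have n0 : \forall v \near (1 : R)^'-, 0 < v by exact: nbhs_left_gt.
    have n1 : \forall v \near (1 : R)^'-, v < 1 by exact: nbhs_left_lt.
    apply: filterS3 n0 n1 H => v v0 v1 [_ +].
    rewrite -addrA gtrDl addrC subr_lt0 L1 LE // => /(_ v1).
    by rewrite -(e_per (v - 1)) (_ : t0 + 1 + (v - 1) = t0 + v) //; ring.
apply/eqP => w0; have := wind_lift lL; rewrite w0 L0 L1 per addr0 subrr subr0.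
by case: (ltgtP D 0) D0 => // _ _ /=; rewrite /=; lra.
Qed.

Lemma wind_class_crossing :
  wind_class height (loop_class (curve_continuous curve_e) (curve_loop curve_e)) != 0.
Proof.
have ce := curve_continuous curve_e; have [_ per _ _] := curve_e.
pose e' u := e (t0 + u).
have ce' : continuous e'.
  move=> u; apply: (@continuous_comp _ _ _ (fun u : R => t0 + u) e); last exact: ce.
  by apply: cvgD; [exact: cvg_cst | exact: cvg_id].
have le' : e' 0 = e' 1 by rewrite /e' addr0 per.
have -> : loop_class (curve_continuous curve_e) (curve_loop curve_e) = loop_class ce' le'.
  apply: H1_chain_class_inj; rewrite !H1_loop_class.
  (* The square moves the base point from 0 to t0; its two sides coincide by periodicity. *)
  have ch : continuous (fun q : R * R => e (q.1 * t0 + q.2)).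
    move=> q; apply: (@continuous_comp _ _ _ (fun q : R * R => q.1 * t0 + q.2) e); last exact: ce.
    by apply: cvgD; [apply: cvgMr_tmp; exact: cvg_fst | exact: cvg_snd].
  have := path_class_square ch => /=.
  have -> : (fun t => e (0 * t0 + t)) = e by apply/funext => t; rewrite mul0r add0r.
  have -> : (fun t => e (1 * t0 + t)) = e' by apply/funext => t; rewrite mul1r.
  have -> : (fun u => e (u * t0 + 1)) = (fun u => e (u * t0 + 0)).
    by apply/funext => u; rewrite per addr0.
  by rewrite addrC => /addrI.
rewrite wind_loop; last exact: annulus_height_continuous annulus_a _ _ _.
exact: wind_crossing.
Qed.
End Crossing.

(** * Isotopy invariance of the action *)

Section Isotopy.
Context {R : realType} (S : oriented_surface R).
Hypotheses (hausS : hausdorff_space S) (compS : compact [set: S]).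

Lemma whitney_open (N : set (diffeo S)) : @whitney_subbase R S N -> open N.
Proof.
move=> wN; exists [set N]; last by rewrite bigcup_set1.
move=> _ ->; exists [fset N]%fset.
  by move=> M /fset1P ->; exact/mem_set.
apply/seteqP; split=> f /=; first by apply; exact: fset11.
by move=> Nf M /fset1P ->.
Qed.

Lemma boundary_coord (i : chart S) x : dom i x -> 0 <= (Defs.coord i x).1.
Proof.
move=> ix; have [U _ imU] := @image_open R S i.
have : (Defs.coord i @` dom i) (Defs.coord i x) by exists x.
by rewrite imU => -[].
Qed.

Lemma diffeo_boundary (f : diffeo S) x : boundary_points S x -> f x = x.
Proof.
by have [_ _ [U [_ bU fU]]] := diffeoP f => /bU/fU.
Qed.

Lemma compact_neighbourhood (x : S) (V : set S) : nbhs x V ->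
  exists K, [/\ compact K, nbhs x K & K `<=` V].
Proof.
move=> xV; have setTx : nbhs x [set: S] by exact: filterT.
have [K xK KV] := compact_regular hausS compS setTx xV.
exists (closure K); split=> //.
- apply: (@subclosed_compact _ _ setT) => //; exact: closed_closure.
- by apply: filterS xK; exact: subset_closure.
Qed.

(** Joint continuity of evaluation needs only the subbasic sets without derivatives, over a compact
    neighbourhood [K] of x0 inside one chart: closeness is then uniform on [K]. *)
Lemma isotopy_continuous (gamma : R -> diffeo S) :
  {within `[0, 1], continuous gamma} ->
  continuous (fun p : R * S => gamma (clamp p.1) p.2).
Proof.
move=> cgamma [t0 x0] N /=; set f := gamma (clamp t0) => fN.
have [i ix] := dom_cover x0; have [j jf] := dom_cover (f x0).
have fj : (Defs.coord j @` dom j) (Defs.coord j (f x0)) by exists (f x0).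
have := within_continuous_near (@Defs.param_continuous R S j) fj.
rewrite coordK // => /(_ N fN); rewrite /within /= => /nbhs_ballP[eps /= eps0 epsN].
have e2 : 0 < eps / 2 by rewrite divr_gt0.
have near_f : nbhs x0 [set x | [/\ dom i x, dom j (f x) &
    ball (Defs.coord j (f x0)) (eps / 2) (Defs.coord j (f x))]].
  have n1 : \forall x \near x0, dom i x.
    by apply: open_nbhs_nbhs; split => //; exact: dom_open.
  have nj : \forall y \near f x0, dom j y.
    by apply: open_nbhs_nbhs; split => //; exact: dom_open.
  have n2 : \forall x \near x0, dom j (f x) by exact: (diffeo_continuous nj).
  have cj := within_continuous_near (@Defs.coord_continuous R S j) jf.
  have nb := cj _ (nbhsx_ballx _ _ e2).
  have n3 : \forall x \near x0, dom j (f x) ->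
      ball (Defs.coord j (f x0)) (eps / 2) (Defs.coord j (f x)).
    exact: (diffeo_continuous nb).
  by apply: filterS3 n1 n2 n3 => x ? jx /(_ jx).
have [K [cK x0K KV]] := compact_neighbourhood near_f.
pose W := [set g : diffeo S | g @` K `<=` dom j /\
   forall x, K x -> 0 < (Defs.coord i x).1 ->
     `| iterated_derive [::] (Defs.coord j \o g \o param i) (Defs.coord i x)
      - iterated_derive [::] (Defs.coord j \o f \o param i) (Defs.coord i x) | < eps / 2].
have fW : nbhs f W.
  apply: open_nbhs_nbhs; split.
    apply: whitney_open; exists f, i, j, K, [::], (eps / 2); split => //.
    - by move=> x /KV[].
    - by move=> _ [x /KV[_ jx _] <-].
  split; first by move=> _ [x /KV[_ jx _] <-].
  by move=> x _ _; rewrite subrr normr0.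
have near_t : \forall t \near t0, W (gamma (clamp t)).
  have c01 : [set` `[0, 1]] (clamp t0) by rewrite /= in_itv /= clamp_ge0 clamp_le1.
  have := within_continuous_near cgamma c01 fW; rewrite /within /= => H.
  have {}H : \forall t \near t0, clamp t \in `[0, 1] -> W (gamma (clamp t)).
    exact: (clamp_continuous H).
  by apply: filterS H => t; apply; rewrite in_itv /= clamp_ge0 clamp_le1.
exists ([set t | W (gamma (clamp t))], K) => // -[t x] /= [[gK gW] Kx].
have [ixx jfx fxb] := KV _ Kx; set g := gamma (clamp t) in gK gW *.
have jg : dom j (g x) by apply: gK; exists x.
(* The subbasic sets compare nothing at boundary points, but there every diffeomorphism is the
   identity. *)
have := boundary_coord ixx; rewrite le_eqVlt => /orP[/eqP b0|pos].
  have bx : boundary_points S x by exists i.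
  rewrite (diffeo_boundary g bx) -(diffeo_boundary f bx) -(coordK jfx); apply: epsN.
    by apply: le_ball fxb; lra.
  by exists (f x).
have := gW x Kx pos; rewrite /= coordK // => gf.
rewrite -(coordK jg); apply: epsN; last by exists (g x).
apply: (ball_split fxb); rewrite ball_prod_normE /ball_ /= distrC.
exact: gf.
Qed.

Lemma isotopic_pushforward (f g : diffeo S) : isotopic f g ->
  homology_pushforward R (mkcts (@diffeo_continuous R S f)) 1 =1
  homology_pushforward R (mkcts (@diffeo_continuous R S g)) 1.
Proof.
move=> [gamma [cg g0 g1]].
apply: (homotopic_pushforward (isotopy_continuous cg)) => x /=.
  by rewrite clampE ?lexx ?ler01 // g0.
by rewrite clampE ?lexx ?ler01 // g1.
Qed.

Lemma isotopic_refl (f : diffeo S) : isotopic f f.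
Proof.
by exists (fun=> f); split => //; apply: continuous_subspaceT => t; exact: cvg_cst.
Qed.

(** The chosen representative has the same set of isotopic diffeomorphisms as f, and f belongs to
    that set by reflexivity. *)
Lemma representative_isotopic (f : diffeo S) : isotopic (representative (class_of f)) f.
Proof.
rewrite /representative; case: (cid _) => g /= <-; exact: isotopic_refl.
Qed.

Lemma action_class_of (f : diffeo S) :
  mapping_class_action (class_of f) =1
  homology_pushforward R (mkcts (@diffeo_continuous R S f)) 1.
Proof. by apply: isotopic_pushforward; exact: representative_isotopic. Qed.

Lemma pushforward_comp (f g : diffeo S) x :
  homology_pushforward R (mkcts (@diffeo_continuous R S (diffeo_comp f g))) 1 x =
  homology_pushforward R (mkcts (@diffeo_continuous R S f)) 1
    (homology_pushforward R (mkcts (@diffeo_continuous R S g)) 1 x).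
Proof.
apply: H1_chain_class_inj; rewrite -[x]homology_class_repr.
set z := repr x.
have -> : homology_pushforward R (mkcts (@diffeo_continuous R S g)) 1 (homology_class 1 z)
    = homology_class 1 (Defs.cycle_map (@chain_pushforward_diff R S S
        (mkcts (@diffeo_continuous R S g))) z).
  exact: homology_map_pi.
rewrite !H1_pushforwardE; congr (chain_class _).
apply: (@chains_eq1 _ _ (chain_pushforward R (mkcts (@diffeo_continuous R S (diffeo_comp f g))) 1)
  (chain_pushforward R (mkcts (@diffeo_continuous R S f)) 1 \o
   chain_pushforward R (mkcts (@diffeo_continuous R S g)) 1)) => s /=.
by rewrite !chains_mapU /=; congr (monalg.mkmalgU _ _); exact/continuousEP.
Qed.

Lemma action_mul (a b : mapping_class_group S) x :
  mapping_class_action (class_mul a b) x =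
  mapping_class_action a (mapping_class_action b x).
Proof. by rewrite action_class_of pushforward_comp. Qed.

Lemma action_inj (a : mapping_class_group S) : injective (mapping_class_action a).
Proof.
have [[cf _] [h [[ch _] hK _]] _] := diffeoP (representative a).
apply: (can_inj (g := homology_pushforward R (mkcts ch) 1)) => x.
apply: H1_chain_class_inj; rewrite -[x]homology_class_repr; set z := repr x.
have -> : mapping_class_action a (homology_class 1 z)
    = homology_class 1 (Defs.cycle_map (@chain_pushforward_diff R S S
        (mkcts (@diffeo_continuous R S (representative a)))) z).
  exact: homology_map_pi.
rewrite H1_pushforwardE H1_chain_classE; congr (chain_class _).
apply: (@chains_eq1 _ _ (chain_pushforward R (mkcts ch) 1 \o
   chain_pushforward R (mkcts (@diffeo_continuous R S (representative a))) 1) idfun) => s /=.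
by rewrite !chains_mapU /=; congr (monalg.mkmalgU _ _); apply/continuousEP => y /=; exact: hK.
Qed.
End Isotopy.

(** * Dehn twists as transvections of the first homology *)

Section TwistForm.
Context {R : realType} (S : oriented_surface R).
Hypothesis hausS : hausdorff_space S.

Definition curve_class (e : R -> S) (ce : simple_closed_curve e) :
    singular_homology R S 1 := loop_class (curve_continuous ce) (curve_loop ce).

Lemma meet_transversely_onceC (c e : R -> S) :
  meet_transversely_once c e -> meet_transversely_once e c.
Proof.
move=> [s [t [st ct tr]]]; exists t, s; split; first by rewrite st.
  by rewrite setIC ct st.
move=> j jt; rewrite det2C oppr_eq0; apply: tr.
by rewrite st.
Qed.

(** Collects what the braid representation needs from geometry: the transvection formula and the
    vanishing pattern of the form on the curves of a chain. The value at a crossing is left open up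
    to being nonzero. *)
Lemma dehn_twist_form (c : R -> S) (cc : simple_closed_curve c) (T : diffeo S) :
  dehn_twist c T -> exists k : {additive singular_homology R S 1 -> int},
  [/\ forall x, homology_pushforward R (mkcts (@diffeo_continuous R S T)) 1 x =
        x + curve_class cc *~ k x,
      k (curve_class cc) = 0,
      forall e (ce : simple_closed_curve e), range c `&` range e = set0 ->
        k (curve_class ce) = 0 &
      forall e (ce : simple_closed_curve e), meet_transversely_once c e ->
        k (curve_class ce) != 0].
Proof.
move=> [a [chi [an [schi chi_lo chi_hi] Tin Tout]]].
have chi_cont : continuous chi.
  by move=> t; apply: differentiable_continuous; exact: (schi [::] t I).
have ch := annulus_height_continuous hausS an chi_cont chi_lo chi_hi.
exists (wind_class (annulus_height a chi : S -> R)); split.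
- move=> x; rewrite (twist_homology hausS an chi_cont chi_lo chi_hi
    (@diffeo_continuous R S T) Tin Tout).
  by congr (x + _ *~ _); apply: H1_chain_class_inj; rewrite !H1_loop_class.
- exact: etrans (wind_loop ch (curve_continuous cc) (curve_loop cc)) (wind_core chi an).
- move=> e ce ce0; apply: etrans (wind_loop ch (curve_continuous ce) (curve_loop ce)) _.
  apply: (wind_disjoint hausS an chi_cont chi_lo chi_hi) => //.
    exact: curve_continuous.
  exact: curve_loop.
- move=> e ce [s [t [st ct tr]]].
  exact: (wind_class_crossing hausS an chi_cont chi_lo chi_hi ce st ct tr).
Unshelve. exact: ch.
Qed.
End TwistForm.

Theorem theorem1p3 (R : realType) (g : nat) (S : oriented_surface R)
    (c : 'I_(2 * g) -> R -> S)
    (phi : braid_group (2 * g).+1 -> mapping_class_group S) :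
  surface_g1 S g -> curve_chain c -> birman_hilden c phi ->
  forall (k : nat)
    (a : group_homology (fun b => mapping_class_action (phi b)) k),
    a *+ 4 = 0.
Proof.
move=> [hausS compS _ _ [e e_bij]] [simple far adjacent] [phiM phi_sigma] k a.
set n := (2 * g)%N in c phi e e_bij simple far adjacent phiM phi_sigma a *.
pose rho b := mapping_class_action (phi b).
have rhoM b b' x : rho (b * b')%g x = rho b (rho b' x).
  by rewrite /rho phiM (action_mul hausS compS).
(* [phi] is only known to respect products, which makes [rho 1] idempotent; an injective idempotent
   map is the identity. *)
have rho1 x : rho 1%g x = x.
  by apply: (@action_inj R S (phi 1%g)); rewrite -[LHS]rhoM mulg1.
have form (i : 'I_n) : exists ki : {additive singular_homology R S 1 -> int},
  [/\ forall x, rho (sigma (n := n.+1) i) x = x + curve_class (simple i) *~ ki x,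
      ki (curve_class (simple i)) = 0,
      forall j, range (c i) `&` range (c j) = set0 -> ki (curve_class (simple j)) = 0 &
      forall j, meet_transversely_once (c i) (c j) -> ki (curve_class (simple j)) != 0].
  have [T dT phiT] := phi_sigma i.
  have [ki [kx kc k0 k1]] := dehn_twist_form hausS (simple i) dT.
  exists ki; split=> // [x|j|j]; [|exact: k0|exact: k1].
  by rewrite /rho phiT (action_class_of hausS compS) kx.
have [kk kkP] := choice form.
pose cn i := if insub i is Some j then curve_class (simple (j : 'I_n)) else 0.
pose kn i : {additive singular_homology R S 1 -> int} :=
  if insub i is Some j then kk (j : 'I_n) else \0.
have cnE (i : 'I_n) : cn i = curve_class (simple i) by rewrite /cn valK.
have knE (i : 'I_n) : kn i = kk i by rewrite /kn valK.
have n_even : ~~ odd n by rewrite /n oddM.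
have gen i x : (i < n)%N -> rho (generator n i) x = transvection cn kn i x.
  move=> ni; rewrite -[i]/(nat_of_ord (Ordinal ni)) generatorE /transvection cnE knE.
  by have [-> _ _ _] := kkP (Ordinal ni).
have self i : (i < n)%N -> kn i (cn i) = 0.
  move=> ni; rewrite -[i]/(nat_of_ord (Ordinal ni)) cnE knE.
  by have [_ -> _ _] := kkP (Ordinal ni).
have far0 i j : (i < n)%N -> (j < n)%N -> (i.+1 < j)%N \/ (j.+1 < i)%N -> kn i (cn j) = 0.
  move=> ni nj ij; rewrite -[i]/(nat_of_ord (Ordinal ni)) -[j]/(nat_of_ord (Ordinal nj)).
  rewrite cnE knE; have [_ _ H _] := kkP (Ordinal ni); apply: H.
  by case: ij => ij; [|rewrite setIC]; apply: far.
have succ0 i : (i.+1 < n)%N -> kn i (cn i.+1) != 0.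
  move=> nj; have ni : (i < n)%N by lia.
  rewrite -[kn i]/(kn (Ordinal ni)) -[cn i.+1]/(cn (Ordinal nj)) cnE knE.
  by have [_ _ _ H] := kkP (Ordinal ni); apply: H; exact: adjacent.
have pred0 i : (i.+1 < n)%N -> kn i.+1 (cn i) != 0.
  move=> nj; have ni : (i < n)%N by lia.
  rewrite -[kn i.+1]/(kn (Ordinal nj)) -[cn i]/(cn (Ordinal ni)) cnE knE.
  have [_ _ _ H] := kkP (Ordinal nj); apply: H.
  by apply: meet_transversely_onceC; exact: adjacent.
have [z zC rhoz] := central_opp e_bij n_even rhoM rho1 gen self far0 succ0 pred0.
have a2 : a *+ 2 = 0 by exact: (central_opp_homology zC a rhoz).
(* The central element already gives exponent 2. *)
by rewrite -[4%N]/(2 * 2)%N mulrnA a2 mul0rn.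
Qed.
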